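(* Suppose that $1<\alpha\le 2$ and $s>\frac72-\alpha$. Then for every $\varphi_0\in\dot H^s(\mathbb{T})$ there exists $T>0$, depending on $\|\varphi_0\|_{\dot H^s}$, such that the initial value problem $$ \varphi_t+\frac12 c_\alpha\,\partial_x\Big\{\varphi^2|\partial_x|^{3-\alpha}\varphi-\varphi\,|\partial_x|^{3-\alpha}(\varphi^2)+\frac13|\partial_x|^{3-\alpha}(\varphi^3)\Big\}+b_\alpha|\partial_x|^{1-\alpha}\varphi_x=0,\qquad \varphi(x,0)=\varphi_0(x), $$ has a solution with $$ \varphi\in C\big([0,T];\dot H^s(\mathbb{T})\big)\cap C^1\big([0,T];\dot H^{s-1}(\mathbb{T})\big). $$ The solution is unique if $s>\frac52$.
   Context: $\mathbb{T}=\mathbb{R}/2\pi\mathbb{Z}$ and $\mathbb{Z}_*=\mathbb{Z}\setminus\{0\}$. Fourier coefficients of a $2\pi$-periodic function or distribution $f$ are $\hat f(k)=\frac1{2\pi}\int_{\mathbb{T}}f(x)e^{-ikx}\,dx$. For $s\in\mathbb{R}$, $\dot H^s(\mathbb{T})$ is the Hilbert space of real-valued periodic functions (distributions) $f$ with $\hat f(0)=0$ and $\|f\|_{\dot H^s}=\big(\sum_{k\in\mathbb{Z}_*}|k|^{2s}|\hat f(k)|^2\big)^{1/2}<\infty$. The function $\varphi=\varphi(x,t)$ is real-valued, $2\pi$-periodic in $x$, with zero mean. The operator $|\partial_x|^{r}$ is the Fourier multiplier with symbol $|k|^r$ (for $r>0$ it annihilates constants; for $r\le 0$ it is applied only to zero-mean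 functions). The constants are, for $1<\alpha<2$, $b_\alpha=2\sin\left(\frac{\pi\alpha}{2}\right)\Gamma(\alpha-1)$ and $c_\alpha=2(2-\alpha)\int_0^\infty\frac{1-\cos\eta}{\eta^{4-\alpha}}\,d\eta=\frac{b_\alpha}{3-\alpha}$, and, for $\alpha=2$ (the Euler case), $b_2=c_2=\frac12$. *)

(* Defs.v *)
From mathcomp Require Import all_boot all_order all_algebra complex.
From mathcomp Require Import all_classical all_reals all_analysis.

Set Implicit Arguments.
Unset Strict Implicit.
Unset Printing Implicit Defensive.

Import Order.TTheory GRing.Theory Num.Theory.
Import numFieldNormedType.Exports.

Local Open Scope classical_set_scope.
Local Open Scope ring_scope.

Section PeriodicFunctions.
Variable R : realType.
Local Notation mu := (@lebesgue_measure R).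

(* Functions on the circle are 2 pi-periodic functions on the line, considered
   up to equality almost everywhere. *)
Definition periodicL1 (f : R -> R) : Prop :=
  periodic f (2 * pi) /\ mu.-integrable `[0, 2 * pi] (EFin \o f).

Definition cexp (theta : R) : R[i] := (cos theta +i* sin theta)%C.

Definition cRintegral (D : set R) (h : R -> R[i]) : R[i] :=
  ((\int[mu]_(x in D) complex.Re (h x)) +i*
   (\int[mu]_(x in D) complex.Im (h x)))%C.

Definition fourier (f : R -> R) (k : int) : R[i] :=
  ((2 * pi)^-1)%:C%C *
  cRintegral `[0, 2 * pi] (fun x => (f x)%:C%C * cexp (- (k%:~R * x))).

Definition Hdot_energy (s : R) (f : R -> R) : \bar R :=
  \esum_(k in [set k : int | k != 0])
    (`|k%:~R : R| `^ (2 * s) * ComplexField.Normc.normc (fourier f k) ^+ 2)%:E.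

(* For s >= 0 this is all of the homogeneous Sobolev space, whose elements are
   then functions; for s < 0 it would only be the part made of functions. *)
Definition Hdot (s : R) (f : R -> R) : Prop :=
  [/\ periodicL1 f, fourier f 0 = 0 & (Hdot_energy s f < +oo)%E].

(* Meaningful for f in Hdot s; [fine] sends an infinite energy to 0. *)
Definition Hdot_norm (s : R) (f : R -> R) : R :=
  Num.sqrt (fine (Hdot_energy s f)).

(* g is |d/dx|^r f. For r <= 0 the operator is restricted to zero-mean f. *)
Definition is_absD (r : R) (f g : R -> R) : Prop :=
  [/\ periodicL1 f, periodicL1 g,
      r <= 0 -> fourier f 0 = 0,
      fourier g 0 = 0 &
      forall k : int, k != 0 ->
        fourier g k = (`|k%:~R : R| `^ r)%:C%C * fourier f k].

Definition test_function (psi : R -> R) : Prop :=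
  periodic psi (2 * pi) /\ forall n x, derivable (derive1n n psi) x 1.

(* g is the derivative of f in the sense of periodic distributions *)
Definition is_weak_derivative (f g : R -> R) : Prop :=
  [/\ periodicL1 f, periodicL1 g &
      forall psi : R -> R, test_function psi ->
        \int[mu]_(x in `[0, 2 * pi]) (f x * derive1 psi x) =
        - \int[mu]_(x in `[0, 2 * pi]) (g x * psi x)].

(* Curves [0, T] -> Hdot s; here u t x stands for u(x, t). *)
Definition C0_Hdot (T s : R) (u : R -> R -> R) : Prop :=
  (forall t, t \in `[0, T] -> Hdot s (u t)) /\
  (forall t0, t0 \in `[0, T] ->
     (fun t => Hdot_norm s (fun x => u t x - u t0 x))
       @ within `[0, T] (nbhs t0) --> (0 : R)).

(* u is in C^1([0, T]; Hdot s) with time derivative v; the derivative is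
   one-sided at the end points. *)
Definition C1_Hdot (T s : R) (u v : R -> R -> R) : Prop :=
  [/\ C0_Hdot T s u, C0_Hdot T s v &
      forall t0, t0 \in `[0, T] ->
        (fun t => Hdot_norm s (fun x => (u t x - u t0 x) / (t - t0) - v t0 x))
          @ within `[0, T] (dnbhs t0) --> (0 : R)].

End PeriodicFunctions.

Section FrontEquation.
Variable R : realType.
Local Notation mu := (@lebesgue_measure R).

Definition Gamma (a : R) : R :=
  \int[mu]_(t in `]0, +oo[) (t `^ (a - 1) * expR (- t)).

Definition b_coef (alpha : R) : R :=
  if alpha == 2 then 2^-1 else 2 * sin (pi * alpha / 2) * Gamma (alpha - 1).

Definition c_coef (alpha : R) : R :=
  if alpha == 2 then 2^-1 else
  2 * (2 - alpha) *
    \int[mu]_(eta in `]0, +oo[) ((1 - cos eta) / eta `^ (4 - alpha)).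

(* The equation at a fixed time, for f = phi(., t) and ft = phi_t(., t).
   The derivative of the flux is a distributional one; that it is a function
   is forced, the other two terms of the equation being functions. *)
Definition front_equation (alpha : R) (f ft : R -> R) : Prop :=
  exists Lf Lf2 Lf3 dflux fx Nfx : R -> R,
    [/\ is_absD (3 - alpha) f Lf,
        is_absD (3 - alpha) (fun x => f x ^+ 2) Lf2 &
        is_absD (3 - alpha) (fun x => f x ^+ 3) Lf3] /\
    [/\ is_weak_derivative
          (fun x => f x ^+ 2 * Lf x - f x * Lf2 x + 3^-1 * Lf3 x) dflux,
        is_weak_derivative f fx,
        is_absD (1 - alpha) fx Nfx &
        \forall x \ae mu,
          ft x + 2^-1 * c_coef alpha * dflux x + b_coef alpha * Nfx x = 0].

Definition is_solution (alpha s T : R) (phi0 : R -> R) (phi : R -> R -> R)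
    : Prop :=
  exists phit : R -> R -> R,
    [/\ C0_Hdot T s phi,
        C1_Hdot T (s - 1) phi phit,
        \forall x \ae mu, phi 0 x = phi0 x &
        forall t, t \in `[0, T] -> front_equation alpha (phi t) (phit t)].

End FrontEquation.

(* Main.v *)
(* With p = 3 - alpha, the Fourier coefficients of the flux are sums over
   k1 + k2 + k3 = k of S(k1, k2, k3) / 3 times a(k1) a(k2) a(k3), where
   S = sum |ki|^p - sum |ki + kj|^p + |k1 + k2 + k3|^p is symmetric in the four
   frequencies k1, k2, k3 and -k, and is O(|ki|^(p-1) |kj|) for all i <> j.
   Symmetrizing the time derivative of the H^s energy over the four frequencies
   bounds it by a constant times the fourth power of the norm, as soon as
   |k|^p a(k) is summable, that is for s > p + 1/2 = 7/2 - alpha.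

   The Galerkin truncations, discretized by an Euler scheme whose step goes to
   0 with the truncation, hence stay bounded in H^s on a common time interval.
   Their coefficients converge along an ultrafilter; a quadratic Taylor estimate
   passes to the limit and shows that the limit solves the equation, while the
   energy estimate passes to the limit and yields strong continuity in H^s.
   The same symmetrization bounds the growth of the L^2 norm of the difference
   of two solutions, and Gronwall's inequality gives uniqueness. *)

Require Import Defs.
From mathcomp Require Import all_boot all_order all_algebra complex.
From mathcomp Require Import all_classical all_reals all_analysis.
From mathcomp Require Import measurable_realfun.
From mathcomp Require Import ring lra zify.

Set Implicit Arguments.
Unset Strict Implicit.
Unset Printing Implicit Defensive.

Import Order.TTheory GRing.Theory Num.Theory.
Import numFieldNormedType.Exports.

Local Open Scope classical_set_scope.
Local Open Scope ring_scope.

(** The obstacle is the loss of derivatives, recovered in two stages. The symbol S is a third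
    difference of |k|^p, so its powers can be placed on any two of the four frequencies; placed on
    the two smaller inputs they make the flux a bounded trilinear map of H^s, and only the outer
    derivative is lost. In the energy that derivative becomes the sum of ki w(ki) over the four
    frequencies, w being the weight. The function k w(k) is odd and the frequencies add up to 0, so
    the contributions of the two largest nearly cancel and the derivative falls on the other two.
    The linear term is skew and drops out of every energy.

    Limits are taken coefficient by coefficient, at fixed time. A supremum of finite sums is only
    lower semicontinuous under such limits; continuity in time of the norm is recovered from an
    energy whose weight has finite support, with a growth rate independent of that support.

    For uniqueness the L^2 energy of the difference is cut at frequency M, which leaves in its
    growth rate an error O(1/M) that disappears at the end. *)

Lemma eq_ler (R : realDomainType) (x y : R) : x = y -> x <= y.
Proof. by move->. Qed.

(** * The symbol of the flux *)

Section PowerInequalities.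
Variable R : realType.
Implicit Types (x y p r s : R).

Lemma is_derive_within_powR (p x y : R) : 0 < x -> x < y ->
  {within `[x, y], continuous (fun z : R => z `^ p)}.
Proof.
move=> x0 xy; apply: derivable_within_continuous => z.
rewrite in_itv/= => /andP[xz _]; apply: derivable_powR.
by rewrite in_itv/= andbT (lt_le_trans x0).
Qed.

(** Mean value theorem for z^p on [x, y], whose derivative is monotone since p >= 1. The case x = 0
    is treated apart, the derivative being taken at positive points only. *)
Lemma powR_tangent (p x y : R) : 1 <= p -> 0 <= x -> x <= y ->
  p * x `^ (p - 1) * (y - x) <= y `^ p - x `^ p <= p * y `^ (p - 1) * (y - x).
Proof.
move=> p1; rewrite [0 <= _]le_eqVlt => /predU1P[<-|x0].
  rewrite [0 <= _]le_eqVlt => /predU1P[<-|y0]; first by rewrite !subrr !mulr0 lexx.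
  rewrite subr0 (@powR0 _ p) ?subr0; last by rewrite gt_eqF//; lra.
  have -> : p * y `^ (p - 1) * y = p * y `^ p.
    by rewrite -mulrA [_ * y]mulrC mulr_powRB1 ?ltW//; lra.
  rewrite ler_peMl ?powR_ge0// andbT.
  (* At p = 1 the power 0^(p - 1) is 1, not 0. *)
  have [->|p_neq1] := eqVneq p 1; first by rewrite subrr powRr0 powRr1 ?(ltW y0)// !mul1r.
  by rewrite powR0 ?mulr0 ?mul0r ?powR_ge0// subr_eq0.
rewrite [x <= y]le_eqVlt => /predU1P[<-|xy]; first by rewrite !subrr !mulr0 lexx.
have [z zxy ->] : exists2 z, z \in `]x, y[ & y `^ p - x `^ p = p * z `^ (p - 1) * (y - x).
  apply: (@MVT _ (fun z => z `^ p) (fun z => p * z `^ (p - 1))) => //; last exact: is_derive_within_powR.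
  by move=> z; rewrite in_itv/= => /andP[xz _]; apply: is_derive1_powR; rewrite (lt_trans x0).
move: zxy; rewrite in_itv/= => /andP[xz zy].
rewrite !ler_pM2r ?subr_gt0// !ler_pM2l; [|lra|lra].
by apply/andP; split; rewrite ge0_ler_powR ?nnegrE ?subr_ge0//; lra.
Qed.

(** Write (x + y)^q = x (x + y)^(q-1) + y (x + y)^(q-1); the power t^(q-1) does not increase with t,
    as q <= 1. *)
Lemma powR_subadd (q x y : R) : 0 <= q <= 1 -> 0 <= x -> 0 <= y ->
  (x + y) `^ q <= x `^ q + y `^ q.
Proof.
move=> /andP[q0 q1]; rewrite le_eqVlt => /predU1P[<-|x0].
  by rewrite add0r lerDr powR_ge0.
rewrite le_eqVlt => /predU1P[<-|y0]; first by rewrite addr0 lerDl powR_ge0.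
have xy0 : 0 < x + y by rewrite addr_gt0.
have key u : 0 < u -> u <= x + y -> u * (x + y) `^ (q - 1) <= u `^ q.
  move=> u0 uxy; have -> : u `^ q = u * u `^ (q - 1).
    rewrite -{2}[u]powRr1 ?ltW// -powRD ?subrKC//.
    by apply/implyP => _; rewrite gt_eqF.
  rewrite (ler_wpM2l (ltW u0))// -(opprB 1 q) !powRN lef_pV2 ?posrE ?powR_gt0//.
  by rewrite ge0_ler_powR ?nnegrE ?subr_ge0// ltW.
have -> : (x + y) `^ q = x * (x + y) `^ (q - 1) + y * (x + y) `^ (q - 1).
  rewrite -mulrDl -{2}[x + y]powRr1 ?ltW// -powRD ?subrKC//.
  by apply/implyP => _; rewrite gt_eqF.
by apply: lerD; apply: key => //; lra.
Qed.

Lemma powR_sum_le (s x y : R) : 0 <= s -> 0 <= x -> 0 <= y ->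
  (x + y) `^ s <= 2 `^ s * (x `^ s + y `^ s).
Proof.
move=> s0; wlog xy : x y / x <= y.
  move=> H x0 y0; have [xy|/ltW yx] := leP x y; first exact: H.
  by rewrite addrC [X in _ * X]addrC; apply: H.
move=> x0 y0; apply: (@le_trans _ _ ((2 * y) `^ s)).
  by rewrite ge0_ler_powR ?nnegrE//; lra.
by rewrite powRM// ler_wpM2l ?powR_ge0// lerDr powR_ge0.
Qed.

End PowerInequalities.

(** * The multiplier |k|^p, its finite differences and the symbol *)

Section Symbol.
Variable R : realType.
Implicit Types (p q r s : R) (k x y z u v : int).

(** The symbol of |d/dx|^r. By the convention for powers of 0 it vanishes at k = 0 for every r != 0,
    negative r included, and equals 1 there for r = 0. *)
Definition wp r k : R := `|k%:~R| `^ r.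

Lemma wp_ge0 r k : 0 <= wp r k. Proof. exact: powR_ge0. Qed.
Hint Resolve wp_ge0 : core.

Lemma wpN r k : wp r (- k) = wp r k.
Proof. by rewrite /wp intrN normrN. Qed.

Lemma wp0 r : r != 0 -> wp r 0 = 0.
Proof. by move=> r0; rewrite /wp normr0 powR0. Qed.

Lemma wp1 k : wp 1 k = `|k%:~R|.
Proof. by rewrite /wp powRr1. Qed.

Lemma norm_intr_ge1 k : k != 0 -> 1 <= `|k%:~R : R|.
Proof. by move=> k0; rewrite -intr_norm ler1z -gtz0_ge1 normr_gt0. Qed.

Lemma wpD r s k : k != 0 -> wp (r + s) k = wp r k * wp s k.
Proof.
move=> k0; rewrite /wp powRD//; apply/implyP => _.
by rewrite normr_eq0 intr_eq0.
Qed.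

Lemma wp_sqr s k : wp (2 * s) k = wp s k ^+ 2.
Proof. by rewrite /wp mulrC powRrM powR_mulrn// powR_ge0. Qed.

Lemma wp_le r s k : k != 0 -> r <= s -> wp r k <= wp s k.
Proof. by move=> k0 rs; apply: ler_powR => //; exact: norm_intr_ge1. Qed.

Lemma wp_0 k : wp 0 k = 1. Proof. by rewrite /wp powRr0. Qed.

Lemma wp_ge1 r k : k != 0 -> 0 <= r -> 1 <= wp r k.
Proof. by move=> k0 r0; rewrite -(wp_0 k); exact: wp_le. Qed.

Lemma wp_le1 r k : k != 0 -> r <= 0 -> wp r k <= 1.
Proof. by move=> k0 r0; rewrite -(wp_0 k); exact: wp_le. Qed.

Lemma wp_homo r x y : 0 <= r -> `|x| <= `|y| -> wp r x <= wp r y.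
Proof.
move=> r0 xy; rewrite /wp ge0_ler_powR ?nnegrE//.
by rewrite -!intr_norm ler_int.
Qed.

Lemma wpD1 r k : 0 <= r -> wp (r + 1) k = wp r k * `|k%:~R|.
Proof.
move=> r0; have [->|k0] := eqVneq k 0; last by rewrite wpD// wp1.
by rewrite normr0 mulr0 wp0// gt_eqF//; lra.
Qed.

Lemma wp_add r x y : 0 <= r -> wp r (x + y) <= 2 `^ r * (wp r x + wp r y).
Proof.
move=> r0; apply: le_trans (powR_sum_le r0 (normr_ge0 _) (normr_ge0 _)).
by rewrite /wp ge0_ler_powR ?nnegrE ?addr_ge0// intrD ler_normD.
Qed.

Definition wp_diff p u : R := wp p (u + 1) - wp p u.

Lemma wp_diff_bounds p (n : nat) : 1 <= p ->
  p * n%:R `^ (p - 1) <= wp_diff p n <= p * n.+1%:R `^ (p - 1).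
Proof.
move=> p1; rewrite /wp_diff /wp !ger0_norm ?ler0z//.
have -> : (n%:Z + 1)%:~R = n.+1%:R :> R by rewrite intrD -natr1.
have := @powR_tangent R p n%:R n.+1%:R p1 (ler0n _ _).
by rewrite ler_nat leqnSn -natrB// subSnn !mulr1 => /(_ isT).
Qed.

(** Reflection about -1/2 sends negative integers to nonnegative ones, where [wp_diff_bounds]
    applies. *)
Lemma wp_diff_refl p u : wp_diff p (- u - 1) = - wp_diff p u.
Proof. by rewrite /wp_diff subrK wpN -opprD wpN opprB. Qed.

(** Discrete form of the Hoelder continuity, of order p - 1, of the derivative of |x|^p. For
    arguments on the same side of 0 it comes from the subadditivity of t^(p-1); on opposite sides
    each of the two increments is at most p times the distance to the power p - 1. *)
Lemma wp_diff_holder p u v : 1 <= p <= 2 -> u != v ->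
  `|wp_diff p u - wp_diff p v| <= 2 * p * wp (p - 1) (u - v).
Proof.
move=> /andP[p1 p2]; have p0 : 0 <= p by lra.
have q01 : 0 <= p - 1 <= 1 by lra.
have /andP[q0 q1] := q01.
have two_q : 2 `^ (p - 1) <= 2 :> R by rewrite -{2}[2]powRr1 ?ler_powR// ler1n.
have nn (m n : nat) : (n < m)%N ->
    `|wp_diff p m - wp_diff p n| <= 2 * p * wp (p - 1) (m%:Z - n%:Z).
  move=> nm.
  have /andP[m1 m2] := wp_diff_bounds m p1.
  have /andP[n1 n2] := wp_diff_bounds n p1.
  have nmq : (n.+1%:R : R) `^ (p - 1) <= m%:R `^ (p - 1).
    by rewrite ge0_ler_powR ?nnegrE// ler_nat.
  have : p * n.+1%:R `^ (p - 1) <= p * m%:R `^ (p - 1) by rewrite ler_wpM2l.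
  move=> h; rewrite ger0_norm; last by lra.
  apply: (@le_trans _ _ (p * (m.+1%:R `^ (p - 1) - n%:R `^ (p - 1)))).
    by rewrite mulrBr; lra.
  rewrite [2 * p]mulrC -mulrA ler_wpM2l//.
  have -> : (m.+1%:R : R) = n%:R + (m.+1 - n)%:R.
    by rewrite -natrD subnKC// ltnW// ltnS ltnW.
  have := powR_subadd q01 (ler0n R n) (ler0n R (m.+1 - n)).
  suff : ((m.+1 - n)%:R : R) `^ (p - 1) <= 2 * wp (p - 1) (m%:Z - n%:Z) by lra.
  (* The bounds on unit increments are off by one, which gives m + 1 - n; it is at most 2 (m - n)
     since n < m, and this is the origin of the factor 2. *)
  apply: (@le_trans _ _ ((2 * (m - n)%:R) `^ (p - 1))).
    rewrite ge0_ler_powR ?nnegrE ?mulr_ge0// -natrM ler_nat; clear -nm; lia.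
  have -> : wp (p - 1) (m%:Z - n%:Z) = (m - n)%:R `^ (p - 1).
    by rewrite /wp subzn 1?ltnW// ger0_norm ?ler0z.
  by rewrite powRM// ler_wpM2r// powR_ge0.
have pn (m n : nat) :
    `|wp_diff p m - wp_diff p (- n%:Z - 1)| <= 2 * p * wp (p - 1) (m%:Z - (- n%:Z - 1)).
  rewrite wp_diff_refl opprK.
  have /andP[m1 m2] := wp_diff_bounds m p1.
  have /andP[n1 n2] := wp_diff_bounds n p1.
  have hm : 0 <= p * m%:R `^ (p - 1) by rewrite mulr_ge0// powR_ge0.
  have hn : 0 <= p * n%:R `^ (p - 1) by rewrite mulr_ge0// powR_ge0.
  rewrite ger0_norm; last by lra.
  have k (i : nat) : (i <= m + n)%N -> p * i.+1%:R `^ (p - 1) <= p * wp (p - 1) (m%:Z - (- n%:Z - 1)).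
    move=> imn; rewrite ler_wpM2l// /wp ge0_ler_powR ?nnegrE//.
    have -> : m%:Z - (- n%:Z - 1) = (m + n).+1%:Z by clear; lia.
    by rewrite ger0_norm ?ler0z// ler_nat.
  have := k m (leq_addr _ _); have := k n (leq_addl _ _).
  by lra.
wlog uv : u v / v < u.
  move=> H; rewrite neq_lt => /orP[h|h]; last by apply: H => //; rewrite gt_eqF.
  by rewrite (distrC (wp_diff p u)) -(opprB v u) wpN; apply: H => //; rewrite gt_eqF.
move=> _.
case: u v uv => [m|m] [n|n] uv.
- by apply: nn; lia.
- by have -> : Negz n = - n%:Z - 1 by lia.
- by lia.
- have -> : Negz m = - m%:Z - 1 by lia.
  have -> : Negz n = - n%:Z - 1 by lia.
  rewrite !wp_diff_refl -opprD normrN.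
  have -> : - m%:Z - 1 - (- n%:Z - 1) = n%:Z - m%:Z by lia.
  by rewrite (distrC (wp_diff p m)); apply: nn; lia.
Qed.

Definition wp_diff2 p x y z : R := wp p (x + y + z) - wp p (x + y) - wp p (x + z) + wp p x.

(** Induction on z: one more unit adds the difference of two values of [wp_diff] at points y apart.
    A negative z is turned into a positive one by moving the base point to x + z, at the price of a
    sign. *)
Lemma wp_diff2_bound p x y z : 1 <= p <= 2 ->
  `|wp_diff2 p x y z| <= 2 * p * wp (p - 1) y * `|z%:~R|.
Proof.
move=> p12; have [->|y0] := eqVneq y 0.
  rewrite /wp_diff2 addr0 (_ : _ - _ - _ + _ = 0); last by ring.
  by rewrite normr0 !mulr_ge0//; lra.
have nat_case x' (n : nat) : `|wp_diff2 p x' y n| <= 2 * p * wp (p - 1) y * n%:R.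
  elim: n => [|n IH].
    rewrite mulr0 /wp_diff2 !addr0 (_ : _ - _ - _ + _ = 0) ?normr0//; by ring.
  have -> : wp_diff2 p x' y n.+1 = wp_diff2 p x' y n +
      (wp_diff p (x' + y + n) - wp_diff p (x' + n)).
    rewrite /wp_diff2 /wp_diff -!addrA (_ : n%:Z + 1 = n.+1%:Z); last by lia.
    by ring.
  rewrite -[n.+1%:R]natr1 mulrDr mulr1; apply: le_trans (ler_normD _ _) _; apply: lerD => //.
  rewrite (_ : wp (p - 1) y = wp (p - 1) (x' + y + n - (x' + n))); last by congr wp; lia.
  by apply: wp_diff_holder => //; lia.
case: z => [n|n].
  have -> : `|(n : int)%:~R : R| = n%:R by rewrite ger0_norm ?ler0z.
  exact: nat_case.
rewrite NegzE intrN normrN.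
have -> : `|(n.+1 : int)%:~R : R| = n.+1%:R by rewrite ger0_norm ?ler0z.
have -> : wp_diff2 p x y (- n.+1%:Z) = - wp_diff2 p (x - n.+1%:Z) y n.+1.
  rewrite /wp_diff2 (_ : x - n.+1%:Z + y + n.+1%:Z = x + y); last by ring.
  rewrite (_ : x - n.+1%:Z + y = x + y - n.+1%:Z); last by ring.
  by rewrite subrK; ring.
by rewrite normrN.
Qed.

(* The symbol of three times the flux; as a function of the four frequencies
   k1, k2, k3 and -(k1 + k2 + k3) it is symmetric. *)
Definition symb p k1 k2 k3 : R :=
  wp p k1 + wp p k2 + wp p k3 - wp p (k1 + k2) - wp p (k1 + k3) - wp p (k2 + k3)
  + wp p (k1 + k2 + k3).

Lemma symb_swap12 p k1 k2 k3 : symb p k1 k2 k3 = symb p k2 k1 k3.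
Proof. by rewrite /symb [k2 + k1]addrC; ring. Qed.

Lemma symb_swap23 p k1 k2 k3 : symb p k1 k2 k3 = symb p k1 k3 k2.
Proof. by rewrite /symb [k3 + k2]addrC -!addrA [k3 + k2]addrC; ring. Qed.

(** Each sum of two frequencies is minus the sum of the other two, each sum of three is minus the
    fourth, and |k|^p is even. *)
Lemma symb_swap14 p k1 k2 k3 k4 : k1 + k2 + k3 + k4 = 0 ->
  symb p k1 k2 k3 = symb p k4 k2 k3.
Proof.
move=> k0; rewrite /symb.
rewrite (_ : k4 + k2 + k3 = - k1); last by lia.
rewrite (_ : k1 + k2 + k3 = - k4); last by lia.
rewrite (_ : k4 + k2 = - (k1 + k3)); last by lia.
rewrite (_ : k4 + k3 = - (k1 + k2)); last by lia.
by rewrite !wpN; ring.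
Qed.

Lemma symb_swap34 p k1 k2 k3 k4 : k1 + k2 + k3 + k4 = 0 ->
  symb p k1 k2 k3 = symb p k1 k2 k4.
Proof.
move=> k0; rewrite symb_swap12 symb_swap23 symb_swap12 (@symb_swap14 _ _ _ _ k4); last by lia.
by rewrite symb_swap12 symb_swap23 symb_swap12.
Qed.

Lemma symbN p k1 k2 k3 : symb p (- k1) (- k2) (- k3) = symb p k1 k2 k3.
Proof. by rewrite /symb -!opprD !wpN. Qed.

(** The symbol is the second difference with increments k2 and k3 at k1 minus the same one at 0,
    which doubles the constant of [wp_diff2_bound]. By symmetry any two of the four frequencies can
    stand for k2 and k3. *)
Lemma symb_bound p k1 k2 k3 : 1 <= p <= 2 ->
  `|symb p k1 k2 k3| <= 4 * p * wp (p - 1) k2 * `|k3%:~R|.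
Proof.
move=> p12; have p0 : p != 0 by rewrite gt_eqF//; lra.
have -> : symb p k1 k2 k3 = wp_diff2 p k1 k2 k3 - wp_diff2 p 0 k2 k3.
  by rewrite /symb /wp_diff2 !add0r wp0//; ring.
apply: le_trans (ler_normB _ _) _.
have := wp_diff2_bound k1 k2 k3 p12; have := wp_diff2_bound 0 k2 k3 p12.
by lra.
Qed.

End Symbol.
#[global] Hint Extern 0 (is_true (_ <= _)) => exact: wp_ge0 : core.

(** * Sums over frequencies *)

Section ComplexModulus.
Variable R : realType.
Local Notation C := R[i].
Local Notation nc := (@ComplexField.Normc.normc R).
Local Notation Re := (@complex.Re R).
Local Notation Im := (@complex.Im R).
Implicit Types (z w : C) (x : R).

Lemma nc0 : nc 0 = 0. Proof. exact: ComplexField.Normc.normc0. Qed.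

Lemma ncM z w : nc (z * w) = nc z * nc w.
Proof. exact: ComplexField.Normc.normcM. Qed.

Lemma nc_ge0 z : 0 <= nc z.
Proof. by case: z => a b /=; exact: sqrtr_ge0. Qed.
Hint Resolve nc_ge0 : core.

Lemma nc_leD z w : nc (z + w) <= nc z + nc w.
Proof. exact: le_normcD. Qed.

Lemma ncN z : nc (- z) = nc z.
Proof. exact: normcN. Qed.

Lemma nc_leB z w : nc (z - w) <= nc z + nc w.
Proof. by rewrite -(ncN w); exact: nc_leD. Qed.

Lemma ncB z w : nc (z - w) = nc (w - z).
Proof. by rewrite -ncN opprB. Qed.

Lemma nc_real x : nc x%:C%C = `|x|.
Proof. by rewrite /= expr0n addr0 sqrtr_sqr. Qed.

Lemma rcM x y : (x * y)%:C%C = x%:C%C * y%:C%C.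
Proof. by simpc. Qed.

Lemma rcD x y : (x + y)%:C%C = x%:C%C + y%:C%C.
Proof. by simpc. Qed.

Lemma rc_int (k : int) : (k%:~R)%:C%C = k%:~R :> C.
Proof. exact: rmorph_int. Qed.

Lemma conj_int (k : int) : (k%:~R : C)^*%C = k%:~R.
Proof. by rewrite -rc_int conjc_real. Qed.

Lemma conj_i : ('i%C : C)^*%C = - 'i%C.
Proof. by simpc. Qed.

Lemma conjM z w : (z * w)^*%C = z^*%C * w^*%C.
Proof. exact: rmorphM. Qed.

Lemma conjD z w : (z + w)^*%C = z^*%C + w^*%C.
Proof. exact: rmorphD. Qed.

Lemma conjN z : (- z)^*%C = - z^*%C.
Proof. exact: rmorphN. Qed.

Lemma nc_i : nc 'i%C = 1.
Proof. by rewrite /= expr0n add0r expr1n sqrtr1. Qed.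

Lemma nc_sqr z : nc z ^+ 2 = Re z ^+ 2 + Im z ^+ 2.
Proof. by case: z => a b /=; rewrite sqr_sqrtr// addr_ge0// sqr_ge0. Qed.

Lemma nc_conj z : nc z^*%C = nc z.
Proof. by case: z => a b /=; rewrite sqrrN. Qed.

Lemma Re_le_nc z : `|Re z| <= nc z.
Proof.
by case: z => a b /=; rewrite -sqrtr_sqr ler_wsqrtr// lerDl sqr_ge0.
Qed.

Lemma Im_le_nc z : `|Im z| <= nc z.
Proof.
by case: z => a b /=; rewrite -sqrtr_sqr ler_wsqrtr// lerDr sqr_ge0.
Qed.

Lemma nc_leReIm z : nc z <= `|Re z| + `|Im z|.
Proof.
rewrite -(@ler_pXn2r _ 2) ?nnegrE ?addr_ge0// nc_sqr sqrrD !real_normK ?num_real//.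
by rewrite -[_ + _ *+ 2 + _]addrA lerD2l lerDr mulrn_wge0// mulr_ge0.
Qed.

Lemma nc_eq0 z : nc z = 0 -> z = 0.
Proof. exact: ComplexField.Normc.eq0_normc. Qed.

Lemma nc_int (k : int) : nc k%:~R = `|k%:~R|.
Proof. by rewrite -nc_real rmorph_int. Qed.

Lemma nc_sum (T : Type) (r : seq T) (F : T -> C) :
  nc (\sum_(k <- r) F k) <= \sum_(k <- r) nc (F k).
Proof.
elim: r => [|k r IH]; first by rewrite !big_nil nc0.
by rewrite !big_cons; apply: le_trans (nc_leD _ _) _; rewrite lerD2l.
Qed.

Lemma ReM_conj z : z^*%C * z = (nc z ^+ 2)%:C%C.
Proof. by rewrite nc_sqr; case: z => a b /=; simpc; rewrite !expr2; congr Complex; ring. Qed.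

Lemma nc_sqrD z w : nc (z + w) ^+ 2 = nc z ^+ 2 + 2 * Re (z^*%C * w) + nc w ^+ 2.
Proof. by rewrite !nc_sqr; case: z w => a b [c d] /=; ring. Qed.

Lemma nc_sqrD_le z w : nc (z + w) ^+ 2 <= 2 * (nc z ^+ 2 + nc w ^+ 2).
Proof.
apply: (@le_trans _ _ ((nc z + nc w) ^+ 2)).
  by rewrite ler_sqr ?nnegrE ?addr_ge0// nc_leD.
rewrite -subr_ge0 (_ : _ - _ = (nc z - nc w) ^+ 2) ?sqr_ge0//; by ring.
Qed.

End ComplexModulus.
#[global] Hint Extern 0 (is_true (_ <= _)) => exact: nc_ge0 : core.

Section FiniteSums.
Variable R : realType.

Lemma le_sqrt (x y : R) : x ^+ 2 <= y -> x <= Num.sqrt y.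
Proof.
move=> xy; apply: (le_trans (ler_norm x)).
by rewrite -sqrtr_sqr ler_wsqrtr.
Qed.

(** Induction on the list: adding one term is the inequality in the plane for the vectors (f k, sqrt
    F) and (g k, sqrt G), where F and G are the sums so far. *)
Lemma cauchy_schwarz (T : Type) (r : seq T) (f g : T -> R) :
  \sum_(k <- r) f k * g k <=
  Num.sqrt (\sum_(k <- r) f k ^+ 2) * Num.sqrt (\sum_(k <- r) g k ^+ 2).
Proof.
elim: r => [|k r IH]; first by rewrite !big_nil sqrtr0 mulr0.
rewrite !big_cons; set F := \sum_(_ <- _) f _ ^+ 2 in IH *.
set G := \sum_(_ <- _) g _ ^+ 2 in IH *.
have F0 : 0 <= F by apply: sumr_ge0 => i _; exact: sqr_ge0.
have G0 : 0 <= G by apply: sumr_ge0 => i _; exact: sqr_ge0.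
apply: (@le_trans _ _ (f k * g k + Num.sqrt F * Num.sqrt G)); first by rewrite lerD2l.
rewrite -[X in _ <= X]sqrtrM ?addr_ge0 ?sqr_ge0//; apply: le_sqrt.
move: (Num.sqrt F) (Num.sqrt G) (sqr_sqrtr F0) (sqr_sqrtr G0) => x y <- <-.
have : 0 <= (f k * y - g k * x) ^+ 2 by exact: sqr_ge0.
by rewrite !expr2; nra.
Qed.

Lemma le_of_sqr_le (x y : R) : 0 <= x -> 0 <= y -> x ^+ 2 <= x * y -> x <= y.
Proof.
rewrite le_eqVlt => /predU1P[<- //|x0] _; by rewrite expr2 ler_pM2l.
Qed.

Lemma sum_indic_le1 (T : eqType) (r : seq T) (x : T) (P : pred T) :
  uniq r -> (forall k, P k -> k = x) -> \sum_(k <- r) (P k)%:R <= 1 :> R.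
Proof.
move=> ur Px; rewrite (@eq_bigr _ _ _ _ _ _ _ (fun k => if P k then 1 else 0)); last first.
  by move=> k _; case: (P k).
rewrite -big_mkcond/= (_ : \sum_(i <- r | P i) 1 = (count P r)%:R); last first.
  by rewrite -sum1_count natr_sum.
rewrite -[X in _ <= X]/(1%:R) ler_nat.
apply: (@leq_trans (count (pred1 x) r)); last by rewrite count_uniq_mem// leq_b1.
by apply: sub_count => k /Px ->; rewrite /= eqxx.
Qed.

(** * Sums over four frequencies of zero sum *)

Section Sum4.
Variable V : nmodType.
Implicit Types (r : seq int) (F : int -> int -> int -> int -> V).

(** With r4 = [:: - k] this is a convolution of three sequences at the frequency k; with a longer r4
    it is such a convolution paired with a fourth sequence. Keeping the constraint in the summand
    turns every permutation of the frequencies into an exchange of sums. *)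
Definition sum4 r1 r2 r3 r4 F : V :=
  \sum_(k1 <- r1) \sum_(k2 <- r2) \sum_(k3 <- r3) \sum_(k4 <- r4)
    if k1 + k2 + k3 + k4 == 0 then F k1 k2 k3 k4 else 0.

Lemma sum4_swap12 r1 r2 r3 r4 F :
  sum4 r1 r2 r3 r4 F = sum4 r2 r1 r3 r4 (fun k1 k2 k3 k4 => F k2 k1 k3 k4).
Proof.
rewrite /sum4 exchange_big/=; do 4 (apply: eq_bigr => ? _).
by rewrite [X in X + _ + _]addrC.
Qed.

Lemma sum4_swap23 r1 r2 r3 r4 F :
  sum4 r1 r2 r3 r4 F = sum4 r1 r3 r2 r4 (fun k1 k2 k3 k4 => F k1 k3 k2 k4).
Proof.
rewrite /sum4; apply: eq_bigr => k1 _; rewrite exchange_big/=.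
by do 3 (apply: eq_bigr => ? _); rewrite [X in X + _ == 0]addrAC.
Qed.

Lemma sum4_swap34 r1 r2 r3 r4 F :
  sum4 r1 r2 r3 r4 F = sum4 r1 r2 r4 r3 (fun k1 k2 k3 k4 => F k1 k2 k4 k3).
Proof.
rewrite /sum4; apply: eq_bigr => k1 _; apply: eq_bigr => k2 _; rewrite exchange_big/=.
by do 2 (apply: eq_bigr => ? _); rewrite addrAC.
Qed.

Lemma eq_sum4 r1 r2 r3 r4 F G :
  (forall k1 k2 k3 k4, k1 + k2 + k3 + k4 = 0 -> F k1 k2 k3 k4 = G k1 k2 k3 k4) ->
  sum4 r1 r2 r3 r4 F = sum4 r1 r2 r3 r4 G.
Proof.
by move=> FG; do 4 (apply: eq_bigr => ? _); case: eqP => // /FG.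
Qed.

Lemma sum4D r1 r2 r3 r4 F G :
  sum4 r1 r2 r3 r4 (fun k1 k2 k3 k4 => F k1 k2 k3 k4 + G k1 k2 k3 k4) =
  sum4 r1 r2 r3 r4 F + sum4 r1 r2 r3 r4 G.
Proof.
rewrite /sum4; do 4 (rewrite -big_split/=; apply: eq_bigr => ? _).
by case: ifP; rewrite ?addr0.
Qed.

Lemma perm_sum4 r1 r2 r3 r4 r1' r2' r3' r4' F :
  perm_eq r1 r1' -> perm_eq r2 r2' -> perm_eq r3 r3' -> perm_eq r4 r4' ->
  sum4 r1 r2 r3 r4 F = sum4 r1' r2' r3' r4' F.
Proof.
move=> h1 h2 h3 h4; rewrite /sum4 (perm_big _ h1)/=; apply: eq_bigr => ? _.
rewrite (perm_big _ h2)/=; apply: eq_bigr => ? _.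
rewrite (perm_big _ h3)/=; apply: eq_bigr => ? _.
by rewrite (perm_big _ h4).
Qed.

Lemma sum4_opp r1 r2 r3 r4 F :
  sum4 (map -%R r1) (map -%R r2) (map -%R r3) (map -%R r4) F =
  sum4 r1 r2 r3 r4 (fun k1 k2 k3 k4 => F (- k1) (- k2) (- k3) (- k4)).
Proof.
rewrite /sum4 big_map; apply: eq_bigr => ? _; rewrite big_map; apply: eq_bigr => ? _.
rewrite big_map; apply: eq_bigr => ? _; rewrite big_map; apply: eq_bigr => ? _.
by rewrite -!opprD oppr_eq0.
Qed.

End Sum4.

Lemma sum4_additive (V W : nmodType) (f : V -> W) r1 r2 r3 r4 F :
  f 0 = 0 -> {morph f : x y / x + y} ->
  f (sum4 r1 r2 r3 r4 F) = sum4 r1 r2 r3 r4 (fun k1 k2 k3 k4 => f (F k1 k2 k3 k4)).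
Proof.
move=> f0 fD; rewrite /sum4; do 4 (rewrite (big_morph f fD f0)/=; apply: eq_bigr => ? _).
by case: ifP.
Qed.

Lemma sum4Z (V : pzRingType) (c : V) r1 r2 r3 r4 F :
  c * sum4 r1 r2 r3 r4 F = sum4 r1 r2 r3 r4 (fun k1 k2 k3 k4 => c * F k1 k2 k3 k4).
Proof. by rewrite (sum4_additive r1 r2 r3 r4 F (mulr0 c) (mulrDr c)). Qed.

Lemma le_sum4 r1 r2 r3 r4 (F G : int -> int -> int -> int -> R) :
  (forall k1 k2 k3 k4, k1 + k2 + k3 + k4 = 0 -> F k1 k2 k3 k4 <= G k1 k2 k3 k4) ->
  sum4 r1 r2 r3 r4 F <= sum4 r1 r2 r3 r4 G.
Proof.
by move=> FG; do 4 (apply: ler_sum => ? _); case: eqP => // /FG.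
Qed.

Lemma nc_sum4 r1 r2 r3 r4 (F : int -> int -> int -> int -> R[i]) :
  ComplexField.Normc.normc (sum4 r1 r2 r3 r4 F) <=
  sum4 r1 r2 r3 r4 (fun k1 k2 k3 k4 => ComplexField.Normc.normc (F k1 k2 k3 k4)).
Proof.
rewrite /sum4; do 4 (apply: le_trans (nc_sum _ _) _; apply: ler_sum => ? _).
by case: ifP => // _; rewrite nc0.
Qed.

(** Young's inequality in dual form: two sequences in l^2, two in l^1. For fixed k2 and k3 the
    frequencies k1 and k4 determine each other, so Cauchy-Schwarz bounds the inner sum. *)
Lemma sum4_young r1 r2 r3 r4 (X A B D : int -> R) : uniq r1 -> uniq r4 ->
  (forall k, 0 <= X k) -> (forall k, 0 <= A k) ->
  (forall k, 0 <= B k) -> (forall k, 0 <= D k) ->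
  sum4 r1 r2 r3 r4 (fun k1 k2 k3 k4 => A k1 * B k2 * D k3 * X k4) <=
  Num.sqrt (\sum_(k <- r1) A k ^+ 2) * Num.sqrt (\sum_(k <- r4) X k ^+ 2) *
  (\sum_(k <- r2) B k) * (\sum_(k <- r3) D k).
Proof.
move=> u1 u4 X0 A0 B0 D0.
rewrite sum4_swap12 sum4_swap23 /sum4.
rewrite -mulrA big_distrlr/= mulr_sumr; apply: ler_sum => k2 _.
rewrite mulr_sumr; apply: ler_sum => k3 _.
(* The indicator of the constraint is its own square, so that each factor receives a copy before
   Cauchy-Schwarz. *)
pose c k1 k4 := (k2 + k3 + k1 + k4 == 0).
pose pr := [seq (k1, k4) | k1 <- r1, k4 <- r4].
have -> : \sum_(k1 <- r1) \sum_(k4 <- r4)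
    (if k2 + k3 + k1 + k4 == 0 then A k1 * B k2 * D k3 * X k4 else 0) =
    \sum_(u <- pr) ((c u.1 u.2)%:R * A u.1) * ((c u.1 u.2)%:R * X u.2) * (B k2 * D k3).
  rewrite big_allpairs_dep/=; apply: eq_bigr => k1 _; apply: eq_bigr => k4 _.
  by rewrite -/(c k1 k4); case: (c k1 k4); rewrite ?mul1r ?mul0r//; ring.
rewrite -mulr_suml ler_wpM2r ?mulr_ge0//.
apply: le_trans (cauchy_schwarz _ _ _) _.
apply: ler_pM; rewrite ?sqrtr_ge0//; apply: ler_wsqrtr.
- rewrite big_allpairs_dep/=; apply: ler_sum => k1 _.
  under eq_bigr do rewrite exprMn mulrC.
  rewrite -mulr_sumr ler_piMr ?sqr_ge0//.
  under eq_bigr do rewrite -natrX.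
  rewrite (@eq_bigr _ _ _ _ _ _ _ (fun k => (c k1 k)%:R)); last by move=> k _; case: (c k1 k).
  by apply: (@sum_indic_le1 _ _ (- (k2 + k3 + k1))) => // k /eqP; lia.
- rewrite big_allpairs_dep/= exchange_big/=; apply: ler_sum => k4 _.
  under eq_bigr do rewrite exprMn mulrC.
  rewrite -mulr_sumr ler_piMr ?sqr_ge0//.
  under eq_bigr do rewrite -natrX.
  rewrite (@eq_bigr _ _ _ _ _ _ _ (fun k => (c k k4)%:R)); last by move=> k _; case: (c k k4).
  by apply: (@sum_indic_le1 _ _ (- (k2 + k3 + k4))) => // k /eqP; lia.
Qed.

End FiniteSums.

(** * Symmetric ranges of frequencies and the series of |k|^(-g) *)

Section Ranges.
Variable R : realType.

Definition zs (N : nat) : seq int := [seq i%:Z - N%:Z | i <- iota 0 N.*2.+1].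

Lemma mem_zs N k : (k \in zs N) = (`|k| <= N)%N.
Proof.
apply/mapP/idP => [[j]|kN].
  by rewrite mem_iota => /andP[_ iN] ->; lia.
exists (absz (k + N%:Z)); first by rewrite mem_iota; lia.
by lia.
Qed.

Lemma uniq_zs N : uniq (zs N).
Proof.
rewrite map_inj_uniq ?iota_uniq// => i j /eqP; rewrite (inj_eq (addIr _)) => /eqP.
by move=> [].
Qed.

Lemma perm_opp_zs N : perm_eq (map -%R (zs N)) (zs N).
Proof.
apply: uniq_perm; rewrite ?uniq_zs// ?(map_inj_uniq oppr_inj) ?uniq_zs// => k.
by rewrite -[k in LHS]opprK (mem_map oppr_inj) !mem_zs abszN.
Qed.

Lemma big_zs_opp (V : nmodType) N (F : int -> V) :
  \sum_(k <- zs N) F (- k) = \sum_(k <- zs N) F k.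
Proof. by rewrite -(big_map -%R xpredT F); apply: perm_big; exact: perm_opp_zs. Qed.

Lemma perm_zsS N : perm_eq (zs N.+1) [:: N.+1%:Z, - N.+1%:Z & zs N].
Proof.
apply: uniq_perm; rewrite ?uniq_zs//.
  by rewrite 2!cons_uniq in_cons uniq_zs !mem_zs andbT; lia.
by move=> k; rewrite mem_zs 2!in_cons mem_zs; lia.
Qed.

Lemma big_zsS (V : nmodType) N (P : pred int) (F : int -> V) :
  \sum_(k <- zs N.+1 | P k) F k =
  (if P N.+1%:Z then F N.+1%:Z else 0) +
  ((if P (- N.+1%:Z) then F (- N.+1%:Z) else 0) + \sum_(k <- zs N | P k) F k).
Proof.
rewrite (perm_big _ (perm_zsS N)) !big_cons.
by case: (P _); case: (P _); rewrite ?add0r.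
Qed.

Lemma ler_zs N M (F : int -> R) : (N <= M)%N -> (forall k, 0 <= F k) ->
  \sum_(k <- zs N) F k <= \sum_(k <- zs M) F k.
Proof.
move=> NM F0; elim: M NM => [|M IH]; first by rewrite leqn0 => /eqP ->.
rewrite leq_eqVlt => /predU1P[-> //|]; rewrite ltnS => /IH h.
by rewrite big_zsS; apply: (le_trans h); rewrite addrA lerDr addr_ge0.
Qed.

Lemma zs_split N M (F : int -> R) : (M <= N)%N ->
  \sum_(k <- zs N) F k = \sum_(k <- zs M) F k + \sum_(k <- zs N | (M < `|k|)%N) F k.
Proof.
move=> MN; rewrite (bigID (fun k => (M < `|k|)%N))/= addrC; congr (_ + _).
rewrite -big_filter; apply: perm_big; apply: uniq_perm; rewrite ?filter_uniq ?uniq_zs//.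
by move=> k; rewrite mem_filter !mem_zs; lia.
Qed.

(** Comparison of one term with the integral of t^(-g) over [n, n + 1], obtained from the mean value
    theorem for t^(1-g). *)
Lemma pseries_step (g : R) (n : nat) : 1 < g -> (0 < n)%N ->
  (n.+1%:R : R) `^ (- g) <= (n%:R `^ (1 - g) - n.+1%:R `^ (1 - g)) / (g - 1).
Proof.
move=> g1 n0; have n0R : 0 < n%:R :> R by rewrite ltr0n.
rewrite ler_pdivlMr ?subr_gt0//.
have nn : n%:R < n.+1%:R :> R by rewrite ltr_nat.
have [z] : exists2 z, z \in `]n%:R, n.+1%:R[ &
    n.+1%:R `^ (1 - g) - n%:R `^ (1 - g) = (1 - g) * z `^ (1 - g - 1) * (n.+1%:R - n%:R).
  apply: (@MVT _ (fun z => z `^ (1 - g)) (fun z => (1 - g) * z `^ (1 - g - 1))) => //.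
    by move=> z; rewrite in_itv/= => /andP[xz _]; apply: is_derive1_powR; rewrite (lt_trans n0R).
  exact: is_derive_within_powR.
rewrite in_itv/= => /andP[nz zn]; rewrite -natrB// subSnn mulr1 => e.
rewrite -[leRHS]opprB e (_ : 1 - g - 1 = - g); last by lra.
rewrite -mulNr opprB [leLHS]mulrC ler_wpM2l ?subr_ge0 ?ltW//.
have z0 := lt_trans n0R nz.
by rewrite !powRN ltf_pV2 ?posrE ?powR_gt0// gt0_ltr_powR ?nnegrE; lra.
Qed.

(** Telescopes [pseries_step]; the frequencies k and -k contribute equally, whence the 2. *)
Lemma wp_tail (g : R) (M N : nat) : 1 < g -> (0 < M)%N ->
  \sum_(k <- zs N | (M < `|k|)%N) wp (- g) k <= 2 / (g - 1) * M%:R `^ (1 - g).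
Proof.
move=> g1 M0; have g10 : 0 < g - 1 by lra.
have [NM|MN] := leqP N M.
  rewrite big1_seq ?mulr_ge0 ?invr_ge0 ?powR_ge0 1?ltW// => k /andP[]; rewrite mem_zs; lia.
(* The subtracted term at N is what makes the induction telescope. *)
suff : \sum_(k <- zs N | (M < `|k|)%N) wp (- g) k <=
    2 / (g - 1) * (M%:R `^ (1 - g) - N%:R `^ (1 - g)).
  move=> /le_trans; apply; rewrite ler_wpM2l ?gerBl ?powR_ge0//.
  by rewrite mulr_ge0// invr_ge0 ltW.
elim: N {MN} (ltnW MN) => [|N IH]; first by rewrite leqNgt M0.
rewrite leq_eqVlt => /predU1P[->|].
  rewrite subrr mulr0 big1_seq// => k /andP[]; rewrite mem_zs; lia.
rewrite ltnS => MN; rewrite big_zsS abszN absz_nat ltnS MN wpN.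
have := IH MN; have := pseries_step g1 (leq_trans M0 MN).
have -> : wp (- g) N.+1 = (N.+1%:R : R) `^ (- g) by rewrite /wp ger0_norm ?ler0z.
move: (M%:R `^ _) (N%:R `^ _) (N.+1%:R `^ (1 - g)) (N.+1%:R `^ _) => t y z x.
move=> h1 h2; have -> : 2 / (g - 1) * (t - z) =
   (y - z) / (g - 1) + ((y - z) / (g - 1) + 2 / (g - 1) * (t - y)) by ring.
by rewrite lerD// lerD.
Qed.

Lemma wp_full (g : R) (N : nat) : 1 < g ->
  \sum_(k <- zs N | (0 < `|k|)%N) wp (- g) k <= 2 + 2 / (g - 1).
Proof.
move=> g1; have g10 : 0 < g - 1 by lra.
have c0 : 0 <= 2 / (g - 1) by rewrite mulr_ge0// invr_ge0 ltW.
case: N => [|N]; first by rewrite big1_seq ?addr_ge0// => k /andP[]; rewrite mem_zs; lia.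
rewrite (bigID (fun k => (1 < `|k|)%N))/= addrC; apply: lerD; last first.
  rewrite (eq_bigl (fun k => (1 < `|k|)%N)); last by move=> k; lia.
  by apply: le_trans (@wp_tail g 1 N.+1 g1 isT) _; rewrite powR1 mulr1.
rewrite -big_filter (perm_big [:: Posz 1; - Posz 1]).
  by rewrite !big_cons big_nil /= wpN /wp mulr1z normr1 powR1 addr0.
apply: uniq_perm; rewrite ?filter_uniq ?uniq_zs// => k.
by rewrite mem_filter mem_zs !inE; lia.
Qed.

End Ranges.
#[global] Opaque zs.

(** * Weighted l^1 norms controlled by Sobolev norms *)

Section TailOfL1Norms.
Variables (R : realType) (p s : R).
Hypothesis ps : p + 2^-1 < s.
Local Notation g := (2 * (s - p)).

(** Cauchy-Schwarz applied to |k|^p = |k|^(p-s) |k|^s leaves the series of |k|^(-g) with g = 2 (s -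
    p) > 1. The square roots of the bounds for its tail and for its whole sum are [tau M] and
    [l1_const]. *)
Definition tau (M : nat) : R := Num.sqrt (2 / (g - 1) * M%:R `^ (1 - g)).
Definition l1_const : R := Num.sqrt (2 + 2 / (g - 1)).

Lemma g_gt1 : 1 < g. Proof. by move: ps; lra. Qed.

Lemma wp_cs (r : seq int) (P : pred int) (A : int -> R) :
  (forall k, P k -> k != 0) ->
  \sum_(k <- r | P k) wp p k * A k <=
  Num.sqrt (\sum_(k <- r | P k) wp (- g) k) *
  Num.sqrt (\sum_(k <- r | P k) wp (2 * s) k * A k ^+ 2).
Proof.
move=> P0; rewrite -!(big_filter r P).
have P0' k : k \in [seq k <- r | P k] -> k != 0 by rewrite mem_filter => /andP[/P0].
rewrite [leLHS](@eq_big_seq _ _ _ _ _ _ (fun k => wp (p - s) k * (wp s k * A k))); last first.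
  by move=> k /P0' k0; rewrite mulrA -wpD// subrK.
apply: le_trans (cauchy_schwarz _ _ _) _.
rewrite [in leLHS](_ : \sum_(k <- _) _ = \sum_(k <- r | P k) wp (- g) k); last first.
  by rewrite big_filter; apply: eq_bigr => k _; rewrite -wp_sqr; congr wp; ring.
rewrite [X in _ * Num.sqrt X <= _](_ : _ = \sum_(k <- r | P k) wp (2 * s) k * A k ^+ 2); last first.
  by rewrite big_filter; apply: eq_bigr => k _; rewrite wp_sqr exprMn.
by rewrite !big_filter.
Qed.

Lemma l1_tail M N (A : int -> R) : (0 < M)%N ->
  \sum_(k <- zs N | (M < `|k|)%N) wp p k * A k <=
  tau M * Num.sqrt (\sum_(k <- zs N | (M < `|k|)%N) wp (2 * s) k * A k ^+ 2).
Proof.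
move=> M0; apply: le_trans (wp_cs _ _ _) _; first by move=> k; lia.
rewrite ler_wpM2r ?sqrtr_ge0//; apply: ler_wsqrtr.
exact: wp_tail g_gt1 M0.
Qed.

Lemma l1_full N (A : int -> R) : p != 0 ->
  \sum_(k <- zs N) wp p k * A k <=
  l1_const * Num.sqrt (\sum_(k <- zs N) wp (2 * s) k * A k ^+ 2).
Proof.
move=> p0.
have -> : \sum_(k <- zs N) wp p k * A k = \sum_(k <- zs N | (0 < `|k|)%N) wp p k * A k.
  rewrite [RHS]big_mkcond; apply: eq_bigr => k _.
  by case: ifPn => //; rewrite absz_gt0 negbK => /eqP ->; rewrite wp0 ?mul0r.
apply: le_trans (wp_cs _ _ _) _; first by move=> k; lia.
apply: ler_pM; rewrite ?sqrtr_ge0//; apply: ler_wsqrtr.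
  exact: wp_full g_gt1.
rewrite [leLHS]big_mkcond; apply: ler_sum => k _.
by case: ifP => // _; rewrite mulr_ge0 ?wp_ge0 ?sqr_ge0.
Qed.

Lemma tau_ge0 M : 0 <= tau M. Proof. exact: sqrtr_ge0. Qed.

Lemma l1_const_ge0 : 0 <= l1_const. Proof. exact: sqrtr_ge0. Qed.

Lemma tau_small (e : R) : 0 < e -> exists2 M, (0 < M)%N & forall M', (M <= M')%N -> tau M' <= e.
Proof.
move=> e0; have g1 := g_gt1; have h1 : 0 < g - 1 by lra.
(* The solution of 2 / (g - 1) c^(1-g) = e^2. *)
pose c := (e ^+ 2 * (g - 1) / 2) `^ (1 - g)^-1.
have c0 : 0 < c by rewrite powR_gt0// !mulr_gt0// ?invr_gt0// exprn_gt0.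
exists (Num.truncn c).+1 => // M' cM.
have cM' : c <= M'%:R.
  by apply: le_trans (ltW (truncnS_gt c)) _; rewrite ler_nat.
have ce : c `^ (1 - g) = e ^+ 2 * (g - 1) / 2.
  by rewrite -powRrM mulVf ?powRr1 ?lt_eqF ?mulr_ge0// ?invr_ge0 ?sqr_ge0; lra.
rewrite /tau -[leRHS](ger0_norm (ltW e0)) -sqrtr_sqr; apply: ler_wsqrtr.
rewrite mulrC mulrA ler_pdivrMr// -ler_pdivlMr// -ce.
move: {cM} c c0 ce cM' => c c0 _ cM'.
rewrite (_ : 1 - g = - (g - 1)); last by ring.
have M0 := lt_le_trans c0 cM'.
rewrite !powRN lef_pV2 ?posrE ?powR_gt0//.
by rewrite ge0_ler_powR ?nnegrE// ltW.
Qed.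

End TailOfL1Norms.

(** * Energy estimates for finite Fourier sums *)

Section EnergySymbol.
Variable R : realType.
Variables (p s e : R).
Hypotheses (p12 : 1 <= p <= 2) (s0 : 0 <= s) (e0 : 0 <= e).
Implicit Types (k x y : int).

Lemma symb_bound34 k1 k2 k3 k4 : k1 + k2 + k3 + k4 = 0 ->
  `|symb p k1 k2 k3| <= 4 * p * wp (p - 1) k3 * `|k4%:~R|.
Proof.
move=> k0; rewrite symb_swap23 (@symb_swap34 _ p _ _ _ k4); last by lia.
exact: symb_bound.
Qed.

Lemma symb_bound43 k1 k2 k3 k4 : k1 + k2 + k3 + k4 = 0 ->
  `|symb p k1 k2 k3| <= 4 * p * wp (p - 1) k4 * `|k3%:~R|.
Proof. by move=> k0; rewrite (@symb_swap34 _ p _ _ _ k4)//; apply: symb_bound34; lia. Qed.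

(* For e = 0 this is the weight of the Sobolev norm. For e > 0 it has finite
   support, so the weighted energy passes to the limit, and its growth rate is
   bounded uniformly in e. *)
Definition cutoff (t : R) : R := Num.max 0 (1 - e * t).
Definition wcut k : R := wp (2 * s) k * cutoff `|k%:~R|.

Lemma cutoff_ge0 t : 0 <= cutoff t. Proof. by rewrite le_max lexx. Qed.

Lemma cutoff_le1 t : 0 <= t -> cutoff t <= 1.
Proof. by move=> t0; rewrite ge_max ler01 gerBl mulr_ge0. Qed.

Lemma wcut_ge0 k : 0 <= wcut k.
Proof. by rewrite mulr_ge0 ?cutoff_ge0 ?wp_ge0. Qed.

Lemma wcut_le k : wcut k <= wp (2 * s) k.
Proof. by rewrite ler_piMr ?wp_ge0 ?cutoff_le1. Qed.

Lemma wcutN k : wcut (- k) = wcut k.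
Proof. by rewrite /wcut wpN intrN normrN. Qed.

(** Product rule for t^(2s+1) times the cutoff. The slope e of the cutoff costs nothing: where the
    cutoff of y is positive, e y < 1, hence e y^(2s+1) <= y^(2s). The constant is therefore
    independent of e. *)
Lemma cutoff_lip (x y : R) : 0 <= y -> y <= x ->
  `|x `^ (2 * s + 1) * cutoff x - y `^ (2 * s + 1) * cutoff y| <=
  (2 * s + 2) * (x - y) * x `^ (2 * s).
Proof.
have s0' := s0; move=> y0 yx; have x0 := le_trans y0 yx.
have s1 : 1 <= 2 * s + 1 by lra.
have /andP[_] := powR_tangent s1 y0 yx; rewrite addrK => hp.
have hp0 : 0 <= x `^ (2 * s + 1) - y `^ (2 * s + 1).
  by rewrite subr_ge0 ge0_ler_powR ?nnegrE//; lra.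
have c0 := cutoff_ge0 x; have c1 := cutoff_le1 x0.
have h1 : `|(x `^ (2 * s + 1) - y `^ (2 * s + 1)) * cutoff x| <=
    (2 * s + 1) * x `^ (2 * s) * (x - y).
  rewrite ger0_norm ?mulr_ge0//; apply: le_trans hp.
  by rewrite ler_piMr.
have h2 : `|y `^ (2 * s + 1) * (cutoff x - cutoff y)| <= x `^ (2 * s) * (x - y).
  have cxy : cutoff x <= cutoff y.
    by rewrite /cutoff ge_max le_max lexx/= le_max; apply/orP; right; rewrite lerB// ler_wpM2l.
  rewrite normrM ger0_norm ?powR_ge0// ler0_norm ?subr_le0// opprB.
  have [ey|ey] := leP 1 (e * y).
    have -> : cutoff y = 0 by apply/max_idPl; lra.
    have -> : cutoff x = 0.
      have exy : e * y <= e * x by rewrite ler_wpM2l.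
      by apply/max_idPl; lra.
    by rewrite subrr mulr0 mulr_ge0 ?powR_ge0 ?subr_ge0.
  have cB : cutoff y - cutoff x <= e * (x - y).
    have -> : cutoff y = 1 - e * y by apply/max_idPr; lra.
    have : 1 - e * x <= cutoff x by rewrite le_max lexx orbT.
    by rewrite mulrBr; lra.
  apply: (@le_trans _ _ (y `^ (2 * s + 1) * (e * (x - y)))).
    by rewrite ler_wpM2l ?powR_ge0.
  rewrite mulrA ler_wpM2r ?subr_ge0//.
  apply: (@le_trans _ _ (y `^ (2 * s))); last by rewrite ge0_ler_powR ?nnegrE//; lra.
  have -> : y `^ (2 * s + 1) = y * y `^ (2 * s).
    by rewrite -{2}(addrK 1 (2 * s)) mulr_powRB1//; lra.
  rewrite mulrC mulrA ler_piMl ?powR_ge0//; lra.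
have -> : x `^ (2 * s + 1) * cutoff x - y `^ (2 * s + 1) * cutoff y =
  (x `^ (2 * s + 1) - y `^ (2 * s + 1)) * cutoff x +
  y `^ (2 * s + 1) * (cutoff x - cutoff y) by ring.
apply: le_trans (ler_normD _ _) _.
move: h1 h2; move: `|_ * cutoff x| `|_ * (_ - _)| (x `^ (2 * s)) => u v w; clear.
by nra.
Qed.

(** The function k w(k) is odd: for x and y of opposite signs this is the Lipschitz bound
    [cutoff_lip] between |x| and |y|, whose distance is |x + y|. For equal signs |x + y| = |x| + |y|
    and the triangle inequality is enough. *)
Lemma wcut_commutator x y :
  `|x%:~R * wcut x + y%:~R * wcut y| <=
  (2 * s + 2) * `|(x + y)%:~R| * (wp (2 * s) x + wp (2 * s) y).
Proof.
have s0' := s0; wlog xy : x y / (`|y| <= `|x|)%N.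
  move=> H; have [|/ltnW] := leqP `|y|%N `|x|%N; first exact: H.
  move=> /H; rewrite [y + x]addrC [_ * wcut y + _]addrC.
  by rewrite [wp _ y + _]addrC.
have yx : `|y%:~R : R| <= `|x%:~R| by rewrite -!intr_norm ler_int; lia.
have gE k : `|k%:~R : R| * wcut k = `|k%:~R| `^ (2 * s + 1) * cutoff `|k%:~R|.
  rewrite /wcut mulrA; congr (_ * _).
  by rewrite /wp -{1}(addrK 1 (2 * s)) mulr_powRB1//; lra.
have [opp|same] := leP (x%:~R * y%:~R) (0 : R).
  have -> : `|(x + y)%:~R : R| = `|x%:~R| - `|y%:~R|.
    rewrite intrD; move: opp yx; move: (x%:~R : R) (y%:~R : R) => u v uv vu.
    by case: (ger0P u) vu; case: (ger0P v); case: (ger0P (u + v)) => *; nra.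
  have -> : `|x%:~R * wcut x + y%:~R * wcut y| = `| `|x%:~R| * wcut x - `|y%:~R| * wcut y|.
    move: opp yx (wcut_ge0 x) (wcut_ge0 y); move: (x%:~R : R) (y%:~R : R) (wcut x) (wcut y) => u v a b uv vu a0 b0.
    case: (ger0P u); case: (ger0P v) => hv hu.
    - have [->|->] : u = 0 \/ v = 0 by (have [|] := eqVneq u 0; [left|right; nra]).
      + by rewrite !mul0r add0r sub0r normrN.
      + by rewrite !mul0r addr0 subr0.
    - by rewrite mulNr opprK.
    - by rewrite mulNr -normrN; congr `|_|; ring.
    - by nra.
  rewrite !gE; apply: le_trans (cutoff_lip _ yx) _ => //.
  by rewrite ler_wpM2l ?mulr_ge0 ?subr_ge0 ?lerDl ?wp_ge0//; lra.
have -> : `|(x + y)%:~R : R| = `|x%:~R| + `|y%:~R|.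
  rewrite intrD; move: same; move: (x%:~R : R) (y%:~R : R) => u v uv.
  by case: (ger0P u); case: (ger0P v); case: (ger0P (u + v)) => *; nra.
apply: le_trans (ler_normD _ _) _; rewrite !(normrM _ (wcut _)) (ger0_norm (wcut_ge0 x)) (ger0_norm (wcut_ge0 y)).
have := wcut_le x; have := wcut_le y; have := wcut_ge0 x; have := wcut_ge0 y.
move: (wcut x) (wcut y) (wp (2 * s) x) (wp (2 * s) y) => a b c d b0 a0 bd ac.
have : 0 <= `|x%:~R : R| by []. have : 0 <= `|y%:~R : R| by [].
move: `|x%:~R : R| `|y%:~R : R| => u v v0 u0.
have u1 : u * a <= u * c by rewrite ler_wpM2l.
have v1 : v * b <= v * d by rewrite ler_wpM2l.
have : 0 <= s * ((u + v) * (c + d)) by rewrite !mulr_ge0 ?addr_ge0//; lra.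
have : 0 <= u * d by rewrite mulr_ge0//; lra.
have : 0 <= v * c by rewrite mulr_ge0//; lra.
by nra.
Qed.

(** The factor 4 p comes from the symbol, 4 s + 5 = 2 (2 s + 2) + 1 from the commutator of the two
    largest frequencies and the terms of the other two, and 3^s from comparing the two largest
    frequencies. *)
Definition energy_const : R := 4 * p * ((4 * s + 5) * 3 `^ s).

(** Here x and y stand for the two largest frequencies, which carry the Sobolev weights; z and w
    carry the p + 1 remaining powers. *)
Definition Vpair x y z w : R :=
  wp s x * wp s y * (wp p z * `|w%:~R| + wp p w * `|z%:~R|).

Lemma Vpair_ge0 x y z w : 0 <= Vpair x y z w.
Proof. by rewrite /Vpair !mulr_ge0 ?addr_ge0 ?wp_ge0// mulr_ge0 ?wp_ge0. Qed.

(* k1 and k2 being the two largest frequencies, k1 + k2 = - (k3 + k4) is small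
   with k3 and k4, and g(k) = k w(k) is odd, so g(k1) + g(k2) gains a factor
   |k1 + k2| over its two terms. *)
Lemma energy_symbol_sorted k1 k2 k3 k4 : k1 + k2 + k3 + k4 = 0 ->
  (`|k3| <= `|k1|)%N -> (`|k4| <= `|k1|)%N ->
  (`|k3| <= `|k2|)%N -> (`|k4| <= `|k2|)%N ->
  `|symb p k1 k2 k3| *
    `|k1%:~R * wcut k1 + k2%:~R * wcut k2 + k3%:~R * wcut k3 + k4%:~R * wcut k4| <=
  energy_const * Vpair k1 k2 k3 k4.
Proof.
have s0' := s0; have [p1 p2] := andP p12; move=> k0 k31 k41 k32 k42.
set D := 3 `^ s * (wp s k1 * wp s k2).
(* The two largest frequencies agree within a factor 3, since each of them is minus the sum of the
   other three; so the weight of either is at most D, which is symmetric in them. *)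
have three x y : (`|x| <= 3 * `|y|)%N -> wp s x <= 3 `^ s * wp s y.
  move=> xy; rewrite /wp -powRM// ge0_ler_powR ?nnegrE ?mulr_ge0//.
  have -> : 3 * `|y%:~R| = (3 * `|y|)%:~R :> R by rewrite intrM -intr_norm.
  by rewrite -intr_norm ler_int; lia.
have w1 : wp (2 * s) k1 <= D.
  rewrite wp_sqr expr2 /D mulrCA ler_wpM2l ?wp_ge0//; apply: three; lia.
have w2 : wp (2 * s) k2 <= D.
  rewrite wp_sqr expr2 /D mulrA ler_wpM2r ?wp_ge0//; apply: three; lia.
have w3 : wp (2 * s) k3 <= D.
  by apply: le_trans w1; apply: wp_homo; [lra|lia].
have w4 : wp (2 * s) k4 <= D.
  by apply: le_trans w1; apply: wp_homo; [lra|lia].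
have D0 : 0 <= D by apply: le_trans w1; rewrite wp_ge0.
pose x : R := `|k3%:~R|; pose y : R := `|k4%:~R|.
have x0 : 0 <= x by exact: normr_ge0. have y0 : 0 <= y by exact: normr_ge0.
have hg : `|k1%:~R * wcut k1 + k2%:~R * wcut k2 + k3%:~R * wcut k3 + k4%:~R * wcut k4| <=
    (4 * s + 5) * (x + y) * D.
  have h12 := wcut_commutator k1 k2.
  have h12' : `|(k1 + k2)%:~R : R| <= x + y.
    rewrite (_ : k1 + k2 = - (k3 + k4)); last by clear -k0; lia.
    by rewrite intrN normrN intrD ler_normD.
  have h3 : `|k3%:~R * wcut k3| <= x * D.
    by rewrite normrM ler_wpM2l// ger0_norm ?wcut_ge0// (le_trans (wcut_le _)).
  have h4 : `|k4%:~R * wcut k4| <= y * D.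
    by rewrite normrM ler_wpM2l// ger0_norm ?wcut_ge0// (le_trans (wcut_le _)).
  have h12'' : `|k1%:~R * wcut k1 + k2%:~R * wcut k2| <= (2 * s + 2) * (x + y) * (D + D).
    apply: le_trans h12 _; apply: ler_pM.
    - by rewrite mulr_ge0//; lra.
    - by rewrite addr_ge0 ?wp_ge0.
    - by rewrite ler_wpM2l//; lra.
    - exact: lerD.
  apply: le_trans (ler_normD _ _) _.
  apply: le_trans (lerD (ler_normD _ _) (lexx _)) _.
  apply: le_trans (lerD (lerD h12'' h3) h4) _.
  by apply: eq_ler; ring.
apply: (@le_trans _ _ (`|symb p k1 k2 k3| * ((4 * s + 5) * (x + y) * D))).
  by rewrite ler_wpM2l.
(* Of the gained factor x + y, the part x multiplies the bound |k3|^(p-1) |k4| of the symbol and the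
   part y the bound |k4|^(p-1) |k3|, which gives the two terms of [Vpair]. *)
have b1 := symb_bound34 k0; have b2 := symb_bound43 k0.
rewrite -/x -/y in b1 b2.
have q0 : 0 <= p - 1 by lra.
have px : wp p k3 = wp (p - 1) k3 * x by rewrite -{1}(subrK 1 p) wpD1.
have py : wp p k4 = wp (p - 1) k4 * y by rewrite -{1}(subrK 1 p) wpD1.
rewrite /energy_const /Vpair -/x -/y px py.
have -> : 4 * p * ((4 * s + 5) * 3 `^ s) *
    (wp s k1 * wp s k2 * (wp (p - 1) k3 * x * y + wp (p - 1) k4 * y * x)) =
  (4 * s + 5) * D * (x * (4 * p * wp (p - 1) k3 * y) + y * (4 * p * wp (p - 1) k4 * x)).
  by rewrite /D; ring.
rewrite (_ : `|_| * _ = (4 * s + 5) * D * (x * `|symb p k1 k2 k3| + y * `|symb p k1 k2 k3|)); last by ring.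
have c0 : 0 <= (4 * s + 5) * D by rewrite mulr_ge0//; lra.
rewrite (ler_wpM2l c0)//.
by apply: lerD; rewrite ler_wpM2l.
Qed.

(** Some two of the four frequencies dominate the other two. The symbol being symmetric, the sorted
    case applies to that pair, and the six terms are nonnegative, so their sum bounds the right
    one. *)
Lemma energy_symbol k1 k2 k3 k4 : k1 + k2 + k3 + k4 = 0 ->
  `|symb p k1 k2 k3| *
    `|k1%:~R * wcut k1 + k2%:~R * wcut k2 + k3%:~R * wcut k3 + k4%:~R * wcut k4| <=
  energy_const * (Vpair k1 k2 k3 k4 + Vpair k1 k3 k2 k4 + Vpair k1 k4 k2 k3 +
                  Vpair k2 k3 k1 k4 + Vpair k2 k4 k1 k3 + Vpair k3 k4 k1 k2).
Proof.
move=> k0; have s0' := s0; have [p1 p2] := andP p12.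
have C0 : 0 <= energy_const.
  by rewrite /energy_const !mulr_ge0 ?powR_ge0//; lra.
pose top (a b c d : int) :=
  [/\ (`|c| <= `|a|)%N, (`|d| <= `|a|)%N, (`|c| <= `|b|)%N & (`|d| <= `|b|)%N].
have le6 (i : R) : (i <= energy_const * Vpair k1 k2 k3 k4 \/ i <= energy_const * Vpair k1 k3 k2 k4 \/
   i <= energy_const * Vpair k1 k4 k2 k3 \/ i <= energy_const * Vpair k2 k3 k1 k4 \/
   i <= energy_const * Vpair k2 k4 k1 k3 \/ i <= energy_const * Vpair k3 k4 k1 k2) ->
   i <= energy_const * (Vpair k1 k2 k3 k4 + Vpair k1 k3 k2 k4 + Vpair k1 k4 k2 k3 +
                  Vpair k2 k3 k1 k4 + Vpair k2 k4 k1 k3 + Vpair k3 k4 k1 k2).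
  rewrite !mulrDr.
  have := mulr_ge0 C0 (Vpair_ge0 k1 k2 k3 k4); have := mulr_ge0 C0 (Vpair_ge0 k1 k3 k2 k4).
  have := mulr_ge0 C0 (Vpair_ge0 k1 k4 k2 k3); have := mulr_ge0 C0 (Vpair_ge0 k2 k3 k1 k4).
  have := mulr_ge0 C0 (Vpair_ge0 k2 k4 k1 k3); have := mulr_ge0 C0 (Vpair_ge0 k3 k4 k1 k2).
  move: (_ * Vpair k1 k2 k3 k4) (_ * Vpair k1 k3 k2 k4) (_ * Vpair k1 k4 k2 k3)
    (_ * Vpair k2 k3 k1 k4) (_ * Vpair k2 k4 k1 k3) (_ * Vpair k3 k4 k1 k2) => a b c d f g.
  by clear; move=> *; lra.
apply: le6.
have sum_eq (a b c d a' b' c' d' : R) : a + b + c + d = a' + b' + c' + d' ->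
  `|a + b + c + d| = `|a' + b' + c' + d'| by move=> ->.
have cases : top k1 k2 k3 k4 \/ top k1 k3 k2 k4 \/ top k1 k4 k2 k3 \/
   top k2 k3 k1 k4 \/ top k2 k4 k1 k3 \/ top k3 k4 k1 k2.
  rewrite /top; clear; move: (absz k1) (absz k2) (absz k3) (absz k4) => a b c d.
  case: (leqP a b) => ?; case: (leqP a c) => ?; case: (leqP a d) => ?;
  case: (leqP b c) => ?; case: (leqP b d) => ?; case: (leqP c d) => ?;
  first [by left; split; lia | by right; left; split; lia | by do 2 right; left; split; lia
   | by do 3 right; left; split; lia | by do 4 right; left; split; lia | by do 5 right; split; lia].
have e13 : symb p k1 k2 k3 = symb p k1 k3 k2 by rewrite symb_swap23.
have e14 : symb p k1 k2 k3 = symb p k1 k4 k2 by rewrite (@symb_swap34 _ p _ _ _ k4)// symb_swap23.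
have e23 : symb p k1 k2 k3 = symb p k2 k3 k1 by rewrite symb_swap12 symb_swap23.
have e24 : symb p k1 k2 k3 = symb p k2 k4 k1.
  by rewrite (@symb_swap34 _ p _ _ _ k4)// symb_swap12 symb_swap23.
have e34 : symb p k1 k2 k3 = symb p k3 k4 k1.
  have k0' : k2 + k1 + k3 + k4 = 0 by clear -k0; lia.
  by rewrite (symb_swap12 p k1 k2 k3) (symb_swap14 p k0') (symb_swap23 p k4 k1 k3) (symb_swap12 p k4 k3 k1).
case: cases => [[]|[[]|[[]|[[]|[[]|[]]]]]] h1 h2 h3 h4.
- by left; apply: energy_symbol_sorted.
- right; left; rewrite e13; apply: le_trans _ (energy_symbol_sorted _ h1 h2 h3 h4); last by lia.
  by rewrite ler_wpM2l// (sum_eq _ _ _ _ (k1%:~R * wcut k1) (k3%:~R * wcut k3) (k2%:~R * wcut k2) (k4%:~R * wcut k4))//; ring.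
- do 2 right; left; rewrite e14; apply: le_trans _ (energy_symbol_sorted _ h1 h2 h3 h4); last by lia.
  by rewrite ler_wpM2l// (sum_eq _ _ _ _ (k1%:~R * wcut k1) (k4%:~R * wcut k4) (k2%:~R * wcut k2) (k3%:~R * wcut k3))//; ring.
- do 3 right; left; rewrite e23; apply: le_trans _ (energy_symbol_sorted _ h1 h2 h3 h4); last by lia.
  by rewrite ler_wpM2l// (sum_eq _ _ _ _ (k2%:~R * wcut k2) (k3%:~R * wcut k3) (k1%:~R * wcut k1) (k4%:~R * wcut k4))//; ring.
- do 4 right; left; rewrite e24; apply: le_trans _ (energy_symbol_sorted _ h1 h2 h3 h4); last by lia.
  by rewrite ler_wpM2l// (sum_eq _ _ _ _ (k2%:~R * wcut k2) (k4%:~R * wcut k4) (k1%:~R * wcut k1) (k3%:~R * wcut k3))//; ring.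
- do 5 right; rewrite e34; apply: le_trans _ (energy_symbol_sorted _ h1 h2 h3 h4); last by lia.
  by rewrite ler_wpM2l// (sum_eq _ _ _ _ (k3%:~R * wcut k3) (k4%:~R * wcut k4) (k1%:~R * wcut k1) (k2%:~R * wcut k2))//; ring.
Qed.

End EnergySymbol.

(** * Symmetrization over the four frequencies *)

Section Symmetrization.
Variable V : comPzRingType.

Lemma sum4_swap14 r1 r2 r3 r4 (F : int -> int -> int -> int -> V) :
  sum4 r1 r2 r3 r4 F = sum4 r4 r2 r3 r1 (fun k1 k2 k3 k4 => F k4 k2 k3 k1).
Proof.
by rewrite sum4_swap12 sum4_swap23 sum4_swap34 sum4_swap23 sum4_swap12.
Qed.

(** Renaming the summation variables moves g to any of the four positions while S stays the same.
    The factor 4 remains on the left because V is only a ring. *)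
Lemma sum4_symmetrize r (g : int -> V) (S : int -> int -> int -> int -> V) :
  (forall k1 k2 k3 k4, k1 + k2 + k3 + k4 = 0 -> S k1 k2 k3 k4 = S k2 k1 k3 k4) ->
  (forall k1 k2 k3 k4, k1 + k2 + k3 + k4 = 0 -> S k1 k2 k3 k4 = S k1 k3 k2 k4) ->
  (forall k1 k2 k3 k4, k1 + k2 + k3 + k4 = 0 -> S k1 k2 k3 k4 = S k1 k2 k4 k3) ->
  4%:R * sum4 r r r r (fun k1 k2 k3 k4 => g k4 * S k1 k2 k3 k4) =
  sum4 r r r r (fun k1 k2 k3 k4 => (g k1 + g k2 + g k3 + g k4) * S k1 k2 k3 k4).
Proof.
move=> s12 s23 s34.
have q3 : sum4 r r r r (fun k1 k2 k3 k4 => g k3 * S k1 k2 k3 k4) =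
    sum4 r r r r (fun k1 k2 k3 k4 => g k4 * S k1 k2 k3 k4).
  by rewrite sum4_swap34; apply: eq_sum4 => k1 k2 k3 k4 k0; rewrite -s34.
have q2 : sum4 r r r r (fun k1 k2 k3 k4 => g k2 * S k1 k2 k3 k4) =
    sum4 r r r r (fun k1 k2 k3 k4 => g k4 * S k1 k2 k3 k4).
  by rewrite sum4_swap23 -q3; apply: eq_sum4 => k1 k2 k3 k4 k0; rewrite -s23.
have q1 : sum4 r r r r (fun k1 k2 k3 k4 => g k1 * S k1 k2 k3 k4) =
    sum4 r r r r (fun k1 k2 k3 k4 => g k4 * S k1 k2 k3 k4).
  by rewrite sum4_swap12 -q2; apply: eq_sum4 => k1 k2 k3 k4 k0; rewrite -s12.
rewrite [RHS](@eq_sum4 _ _ _ _ _ _ (fun k1 k2 k3 k4 => g k1 * S k1 k2 k3 k4 +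
  g k2 * S k1 k2 k3 k4 + g k3 * S k1 k2 k3 k4 + g k4 * S k1 k2 k3 k4)); last first.
  by move=> k1 k2 k3 k4 _; ring.
by rewrite !sum4D q1 q2 q3; ring.
Qed.

(** Summation over the output frequency k makes k4 = - k a variable like the other three. *)
Lemma pair_sum4 r1 r2 r3 M (G : int -> V) (F : int -> int -> int -> V) :
  \sum_(k <- zs M) G k * sum4 r1 r2 r3 [:: - k] (fun k1 k2 k3 _ => F k1 k2 k3) =
  sum4 r1 r2 r3 (zs M) (fun k1 k2 k3 k4 => G (- k4) * F k1 k2 k3).
Proof.
rewrite -(perm_sum4 _ (perm_refl r1) (perm_refl r2) (perm_refl r3) (perm_opp_zs M)).
under eq_bigr do rewrite sum4Z.
rewrite /sum4.
rewrite exchange_big/=; apply: eq_bigr => k1 _.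
rewrite exchange_big/=; apply: eq_bigr => k2 _.
rewrite exchange_big/=; apply: eq_bigr => k3 _.
by rewrite (big_map -%R predT); apply: eq_bigr => k4 _; rewrite opprK big_seq1.
Qed.

End Symmetrization.

(** * The trilinear flux: bounds and energy estimates *)

Section Flux.
Variable R : realType.
Local Notation C := R[i].
Local Notation nc := (@ComplexField.Normc.normc R).
Local Notation Re := (@complex.Re R).
Variables (p s : R).
Hypotheses (p12 : 1 <= p <= 2) (ps : p + 2^-1 < s).
Implicit Types (a b d : int -> C) (k : int).

(** The Sobolev norm of the frequencies |k| <= N; the frequency 0 has weight 0 when s != 0.
    Membership of an infinite sequence in a ball is expressed by a bound on [hn M a] for all M. *)
Definition hn N a : R := Num.sqrt (\sum_(k <- zs N) wp (2 * s) k * nc (a k) ^+ 2).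

Lemma hn_ge0 N a : 0 <= hn N a. Proof. exact: sqrtr_ge0. Qed.

Lemma hn_sqr N a : hn N a ^+ 2 = \sum_(k <- zs N) wp (2 * s) k * nc (a k) ^+ 2.
Proof.
by rewrite sqr_sqrtr// sumr_ge0// => k _; rewrite mulr_ge0 ?wp_ge0 ?sqr_ge0.
Qed.

Lemma hn_sqr' N a : hn N a = Num.sqrt (\sum_(k <- zs N) (wp s k * nc (a k)) ^+ 2).
Proof. by congr Num.sqrt; apply: eq_bigr => k _; rewrite wp_sqr exprMn. Qed.

Let l1c := l1_const p s.

Local Hint Extern 0 (is_true (_ <= _)) => exact: hn_ge0 : core.

Lemma norm_le_wp k : `|k%:~R : R| <= wp p k.
Proof.
have [p1 p2] := andP p12; have [->|k0] := eqVneq k 0.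
  by rewrite normr0 wp_ge0.
by rewrite -(wp1 R); apply: wp_le.
Qed.

Lemma l1_hn N a : \sum_(k <- zs N) wp p k * nc (a k) <= l1c * hn N a.
Proof.
have [p1 p2] := andP p12.
by apply: l1_full; [exact: ps|rewrite gt_eqF//; lra].
Qed.

Lemma symb_wp23 k1 k2 k3 : `|symb p k1 k2 k3| <= 4 * p * wp p k2 * wp p k3.
Proof.
have [p1 p2] := andP p12.
(* For p = 1 the factor |k2|^(p-1) equals 1 at k2 = 0 and [symb_bound] is too weak there, but the
   symbol itself vanishes. *)
have [->|k20] := eqVneq k2 0.
  have -> : symb p k1 0 k3 = 0.
    rewrite /symb addr0 add0r wp0; last by rewrite gt_eqF//; lra.
    by ring.
  by rewrite normr0 !mulr_ge0 ?wp_ge0//; lra.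
apply: le_trans (symb_bound _ _ _ p12) _; apply: ler_pM.
- by rewrite mulr_ge0 ?wp_ge0//; lra.
- exact: normr_ge0.
- rewrite ler_wpM2l//; first by lra.
  by apply: wp_le => //; lra.
- exact: norm_le_wp.
Qed.

Lemma symb_wp13 k1 k2 k3 : `|symb p k1 k2 k3| <= 4 * p * wp p k1 * wp p k3.
Proof. by rewrite symb_swap12 symb_wp23. Qed.

Lemma symb_wp12 k1 k2 k3 : `|symb p k1 k2 k3| <= 4 * p * wp p k1 * wp p k2.
Proof. by rewrite symb_swap23 symb_wp13. Qed.

(* The polarized flux: its value at a, a, a is the k-th Fourier coefficient of
   f^2 |D|^p f - f |D|^p f^2 + |D|^p f^3 / 3 when a is supported in [-N, N]. *)
Definition flux3 N a b d k : C :=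
  sum4 (zs N) (zs N) (zs N) [:: - k]
    (fun k1 k2 k3 _ => (symb p k1 k2 k3 / 3)%:C%C * (a k1 * b k2 * d k3)).

Lemma pair_flux3 N M (G : int -> C) a b d :
  \sum_(k <- zs M) G k * flux3 N a b d k =
  sum4 (zs N) (zs N) (zs N) (zs M) (fun k1 k2 k3 k4 =>
    G (- k4) * ((symb p k1 k2 k3 / 3)%:C%C * (a k1 * b k2 * d k3))).
Proof. exact: pair_sum4. Qed.

Lemma flux3_swap12 N a b d k : flux3 N a b d k = flux3 N b a d k.
Proof.
rewrite /flux3 sum4_swap12; apply: eq_sum4 => k1 k2 k3 k4 _.
by rewrite symb_swap12 (mulrC (a k2)).
Qed.

Lemma flux3_swap23 N a b d k : flux3 N a b d k = flux3 N a d b k.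
Proof.
rewrite /flux3 sum4_swap23; apply: eq_sum4 => k1 k2 k3 k4 _.
by rewrite symb_swap23 mulrAC.
Qed.

Lemma flux3Bl N a a' b d k :
  flux3 N (fun j => a j - a' j) b d k = flux3 N a b d k - flux3 N a' b d k.
Proof.
rewrite /flux3 -[X in _ = _ - X]mul1r -mulNr sum4Z -sum4D; apply: eq_sum4 => k1 k2 k3 k4 _.
by ring.
Qed.

(** The identity a^3 - b^3 = (a - b)(a^2 + a b + b^2) for a symmetric trilinear form. *)
Lemma flux3_diff N a b k :
  flux3 N a a a k - flux3 N b b b k =
  flux3 N (fun j => a j - b j) a a k + flux3 N (fun j => a j - b j) b a k +
  flux3 N (fun j => a j - b j) b b k.
Proof.
rewrite !flux3Bl (flux3_swap12 _ b a) (flux3_swap23 _ b b a) (flux3_swap12 _ b a b).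
by rewrite (flux3_swap23 _ a b a); ring.
Qed.

Lemma le_flux3 N (A B D : int -> R) M (X : int -> R) (w : int -> R) :
  (forall k, 0 <= X k) -> (forall k, 0 <= A k) -> (forall k, 0 <= B k) ->
  (forall k, 0 <= D k) -> (forall k, 0 <= w k) ->
  sum4 (zs N) (zs N) (zs N) (zs M) (fun k1 k2 k3 k4 =>
    w k1 * A k1 * (wp p k2 * B k2) * (wp p k3 * D k3) * X k4) <=
  Num.sqrt (\sum_(k <- zs N) (w k * A k) ^+ 2) * Num.sqrt (\sum_(k <- zs M) X k ^+ 2) *
  (\sum_(k <- zs N) wp p k * B k) * (\sum_(k <- zs N) wp p k * D k).
Proof.
move=> X0 A0 B0 D0 w0.
apply: (@sum4_young R _ _ _ _ X (fun k => w k * A k) (fun k => wp p k * B k) (fun k => wp p k * D k)) => //; try exact: uniq_zs.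
- by move=> k; rewrite mulr_ge0.
- by move=> k; rewrite mulr_ge0 ?wp_ge0.
- by move=> k; rewrite mulr_ge0 ?wp_ge0.
Qed.

Definition tri_const : R := 4 * p * 3 `^ s * l1c ^+ 2.

Lemma tri_const_ge0 : 0 <= tri_const.
Proof.
have [p1 p2] := andP p12.
have l0 : 0 <= l1c by exact: l1_const_ge0.
by rewrite /tri_const !mulr_ge0 ?powR_ge0//; lra.
Qed.

(** One of the three inputs has at least a third of the output frequency and takes the weight |k|^s
    at the cost of 3^s; the symbol then puts p powers on each of the other two, which are summed in
    l^1. The duality with X brings the estimate into the form of [sum4_young]. *)
Lemma flux3_dual N M (X : int -> R) a b d : (forall k, 0 <= X k) ->
  \sum_(k <- zs M) X k * (wp s k * nc (flux3 N a b d k)) <=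
  tri_const * hn N a * hn N b * hn N d * Num.sqrt (\sum_(k <- zs M) X k ^+ 2).
Proof.
move=> X0; have [p1 p2] := andP p12; have s0 : 0 <= s by move: ps; lra.
have l0 : 0 <= l1c by exact: l1_const_ge0.
pose sX := Num.sqrt (\sum_(k <- zs M) X k ^+ 2); rewrite -/sX.
have sX0 : 0 <= sX by exact: sqrtr_ge0.
pose A k := nc (a k); pose B k := nc (b k); pose D k := nc (d k).
have h1 k : X k * (wp s k * nc (flux3 N a b d k)) <=
   (X k * wp s k) * sum4 (zs N) (zs N) (zs N) [:: - k]
    (fun k1 k2 k3 _ => `|symb p k1 k2 k3| / 3 * (A k1 * B k2 * D k3)).
  rewrite mulrA ler_wpM2l ?mulr_ge0 ?wp_ge0//.
  apply: le_trans (nc_sum4 _ _ _ _ _) _; apply: le_sum4 => k1 k2 k3 k4 _.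
  by rewrite !ncM nc_real normrM [`|3^-1|]ger0_norm.
apply: le_trans (ler_sum _ (fun k _ => h1 k)) _.
rewrite pair_sum4.
pose T (A B D : int -> R) := sum4 (zs N) (zs N) (zs N) (zs M) (fun k1 k2 k3 k4 =>
    wp s k1 * A k1 * (wp p k2 * B k2) * (wp p k3 * D k3) * X (- k4)).
have X2 : Num.sqrt (\sum_(k <- zs M) X (- k) ^+ 2) = sX by rewrite (big_zs_opp _ (fun k => X k ^+ 2)).
have T_le (a' b' d' : int -> C) : T (fun k => nc (a' k)) (fun k => nc (b' k)) (fun k => nc (d' k)) <=
    hn N a' * sX * (l1c * hn N b') * (l1c * hn N d').
  apply: le_trans (le_flux3 _ _ _ _ _ _ _) _; rewrite ?X2//.
  rewrite -hn_sqr'; apply: ler_pM; rewrite ?l1_hn ?mulr_ge0 ?hn_ge0 ?sumr_ge0//.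
  - by move=> k _; rewrite mulr_ge0 ?wp_ge0.
  - by move=> k _; rewrite mulr_ge0 ?wp_ge0.
  - by rewrite ler_wpM2l ?mulr_ge0 ?hn_ge0// l1_hn.
have T2 : sum4 (zs N) (zs N) (zs N) (zs M) (fun k1 k2 k3 k4 =>
    wp p k1 * A k1 * (wp s k2 * B k2) * (wp p k3 * D k3) * X (- k4)) = T B A D.
  by rewrite sum4_swap12; apply: eq_sum4 => *; ring.
have T3 : sum4 (zs N) (zs N) (zs N) (zs M) (fun k1 k2 k3 k4 =>
    wp p k1 * A k1 * (wp p k2 * B k2) * (wp s k3 * D k3) * X (- k4)) = T D A B.
  by rewrite sum4_swap23 sum4_swap12; apply: eq_sum4 => *; ring.
pose c0 := 4 * p / 3 * 3 `^ s.
have c00 : 0 <= c0 by rewrite !mulr_ge0 ?powR_ge0//; lra.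
have hp k1 k2 k3 k4 : k1 + k2 + k3 + k4 = 0 ->
  X (- k4) * wp s (- k4) * (`|symb p k1 k2 k3| / 3 * (A k1 * B k2 * D k3)) <=
  c0 * (wp s k1 * A k1 * (wp p k2 * B k2) * (wp p k3 * D k3) * X (- k4) +
   (wp p k1 * A k1 * (wp s k2 * B k2) * (wp p k3 * D k3) * X (- k4) +
    wp p k1 * A k1 * (wp p k2 * B k2) * (wp s k3 * D k3) * X (- k4))).
  move=> k0.
  have w4 : wp s (- k4) <= 3 `^ s * (wp s k1 + wp s k2 + wp s k3).
    have three y : (`|k4| <= 3 * `|y|)%N -> wp s (- k4) <= 3 `^ s * wp s y.
      move=> xy; rewrite wpN /wp -powRM// ge0_ler_powR ?nnegrE ?mulr_ge0//.
      have -> : 3 * `|y%:~R| = (3 * `|y|)%:~R :> R by rewrite intrM -intr_norm.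
      by rewrite -intr_norm ler_int; lia.
    have w0 k : 0 <= 3 `^ s * wp s k by rewrite mulr_ge0 ?powR_ge0 ?wp_ge0.
    rewrite !mulrDr.
    have [/three h|[/three h|/three h]] : ((`|k4| <= 3 * `|k1|) \/ (`|k4| <= 3 * `|k2|) \/
       (`|k4| <= 3 * `|k3|))%N by clear -k0; lia.
    - by apply: le_trans h _; rewrite -addrA lerDl addr_ge0.
    - by apply: le_trans h _; rewrite addrAC lerDr addr_ge0.
    - by apply: le_trans h _; rewrite lerDr addr_ge0.
  have s1 := symb_wp23 k1 k2 k3; have s2 := symb_wp13 k1 k2 k3; have s3 := symb_wp12 k1 k2 k3.
  pose Z := X (- k4) * (A k1 * B k2 * D k3).
  have Z0 : 0 <= Z by rewrite !mulr_ge0.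
  rewrite (_ : X _ * _ * _ = Z / 3 * (wp s (- k4) * `|symb p k1 k2 k3|)); last by rewrite /Z; ring.
  rewrite (_ : c0 * _ = Z / 3 * (3 `^ s * (wp s k1 * (4 * p * wp p k2 * wp p k3) +
    wp s k2 * (4 * p * wp p k1 * wp p k3) + wp s k3 * (4 * p * wp p k1 * wp p k2)))); last by rewrite /Z /c0; ring.
  rewrite ler_wpM2l ?divr_ge0//.
  apply: (@le_trans _ _ (3 `^ s * (wp s k1 + wp s k2 + wp s k3) * `|symb p k1 k2 k3|)).
    by rewrite ler_wpM2r.
  have h1' := ler_wpM2l (wp_ge0 s k1) s1; have h2' := ler_wpM2l (wp_ge0 s k2) s2.
  have h3' := ler_wpM2l (wp_ge0 s k3) s3.
  rewrite -[leLHS]mulrA ler_wpM2l ?powR_ge0//; apply: le_trans (lerD (lerD h1' h2') h3').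
  by apply: eq_ler; ring.
apply: (le_trans (@le_sum4 R (zs N) (zs N) (zs N) (zs M) _ _ hp)).
rewrite -sum4Z !sum4D T2 T3 -/(T A B D).
apply: (@le_trans _ _ (c0 * (3 * (hn N a * hn N b * hn N d * sX * l1c ^+ 2)))).
  rewrite ler_wpM2l//; have := T_le a b d; have := T_le b a d; have := T_le d a b.
  move=> t1 t2 t3; apply: le_trans (lerD t3 (lerD t2 t1)) _.
  by apply: eq_ler; ring.
by apply: eq_ler; rewrite /tri_const /c0; field.
Qed.

(** Duality with the weighted flux itself gives a bound of its squared norm by a multiple of its
    norm. *)
Lemma flux3_hn N M a b d :
  hn M (flux3 N a b d) <= tri_const * hn N a * hn N b * hn N d.
Proof.
apply: le_of_sqr_le; rewrite ?hn_ge0//.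
  by rewrite (mulr_ge0 (mulr_ge0 (mulr_ge0 tri_const_ge0 _) _) _).
rewrite [hn M _ ^+ 2]hn_sqr.
have := @flux3_dual N M (fun k => wp s k * nc (flux3 N a b d k)) a b d.
rewrite -hn_sqr' [in leRHS]mulrC => h; apply: le_trans _ (h _); last first.
  by move=> k; rewrite mulr_ge0 ?wp_ge0.
by apply: eq_ler; apply: eq_bigr => k _; rewrite wp_sqr; ring.
Qed.

(** For a factor known to be small only coefficient by coefficient: once k2 and k3 are chosen a
    single k1 is left, and the symbol puts its powers on k2 and k3. *)
Lemma flux3_sup N a b d k (e : R) : (forall j, nc (a j) <= e) ->
  nc (flux3 N a b d k) <= 4 * p * l1c ^+ 2 * hn N b * hn N d * e.
Proof.
move=> ae; have [p1 p2] := andP p12.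
have e0 : 0 <= e by apply: le_trans (ae 0).
pose B j := wp p j * nc (b j); pose D j := wp p j * nc (d j).
have B0 j : 0 <= B j by rewrite mulr_ge0.
have D0 j : 0 <= D j by rewrite mulr_ge0.
apply: le_trans (nc_sum4 _ _ _ _ _) _.
apply: (@le_trans _ _ (sum4 (zs N) (zs N) (zs N) [:: - k] (fun k1 k2 k3 _ => 4 * p * e * (B k2 * D k3)))).
  apply: le_sum4 => k1 k2 k3 k4 _; rewrite !ncM nc_real normrM [`|3^-1|]ger0_norm//.
  have h := symb_wp23 k1 k2 k3.
  apply: (@le_trans _ _ (4 * p * wp p k2 * wp p k3 * (e * nc (b k2) * nc (d k3)))).
    apply: ler_pM; rewrite ?mulr_ge0 ?ler_wpM2r ?normr_ge0//.
    apply: le_trans h; rewrite ler_piMr//; lra.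
  by apply: eq_ler; rewrite /B /D; ring.
rewrite -sum4Z; apply: (@le_trans _ _ (4 * p * e * ((l1c * hn N b) * (l1c * hn N d)))); last first.
  by apply: eq_ler; ring.
rewrite ler_wpM2l ?mulr_ge0//; first by lra.
apply: (@le_trans _ _ ((\sum_(k <- zs N) B k) * (\sum_(k <- zs N) D k))); last first.
  by apply: ler_pM; rewrite ?l1_hn ?sumr_ge0.
rewrite sum4_swap12 sum4_swap23 /sum4 big_distrlr/=; apply: ler_sum => k2 _; apply: ler_sum => k3 _.
under eq_bigr do rewrite big_seq1.
rewrite (@eq_bigr _ _ _ _ _ _ _ (fun k1 => B k2 * D k3 * (k2 + k3 + k1 + - k == 0)%:R)); last first.
  by move=> k1 _; case: ifP; rewrite ?mulr1 ?mulr0.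
rewrite -mulr_sumr ler_piMr ?mulr_ge0//.
by apply: (@sum_indic_le1 _ _ _ (k - k2 - k3) (fun k1 => k2 + k3 + k1 + - k == 0)); [exact: uniq_zs|move=> j /eqP; clear; lia].
Qed.

(** Hermitian symmetry, which characterizes the coefficients of real-valued functions. *)
Definition csym a := forall k, a (- k) = ((a k)^*)%C.

Lemma flux3_csym N a b d : csym a -> csym b -> csym d -> csym (flux3 N a b d).
Proof.
move=> ha hb hd k; rewrite /flux3 (_ : [:: - - k] = map -%R [:: - k])//.
rewrite -(perm_sum4 _ (perm_opp_zs N) (perm_opp_zs N) (perm_opp_zs N) (perm_refl _)) sum4_opp.
have cD : {morph (@conjc R) : x y / x + y} by move=> x y; rewrite rmorphD.
rewrite (sum4_additive _ _ _ _ _ (conjc0 R) cD).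
apply: eq_sum4 => k1 k2 k3 k4 _.
have cM : {morph (@conjc R) : x y / x * y} by move=> x y; rewrite rmorphM.
by rewrite symbN ha hb hd !cM conjc_real.
Qed.

(** Symmetrization puts the sum of the four ki w(ki) beside the symbol, and [energy_symbol] bounds
    the product. In each of its six terms the two dominant frequencies are summed in l^2 and the
    other two in l^1. *)
Lemma flux3_energy N a e : 0 <= e -> csym a ->
  nc (\sum_(k <- zs N) ((k%:~R * wcut s e k)%:C%C * (a k)^*%C) * flux3 N a a a k) <=
  energy_const p s * l1c ^+ 2 * hn N a ^+ 4.
Proof.
move=> e0 ha; have [p1 p2] := andP p12; have s0 : 0 <= s by move: ps; lra.
have l0 : 0 <= l1c by exact: l1_const_ge0.
have E0 : 0 <= energy_const p s.
  by rewrite /energy_const !mulr_ge0 ?powR_ge0//; lra.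
rewrite pair_flux3.
pose g k := (- (k%:~R * wcut s e k))%:C%C : C.
pose S k1 k2 k3 k4 := (symb p k1 k2 k3 / 3)%:C%C * (a k1 * a k2 * a k3 * a k4).
rewrite (@eq_sum4 _ _ _ _ _ _ (fun k1 k2 k3 k4 => g k4 * S k1 k2 k3 k4)); last first.
  move=> k1 k2 k3 k4 _; rewrite /g /S ha conjcK wcutN intrN mulNr; ring.
have c1 k1 k2 k3 k4 : k1 + k2 + k3 + k4 = 0 -> S k1 k2 k3 k4 = S k2 k1 k3 k4.
  by move=> k0; rewrite /S symb_swap12; congr (_ * _); ring.
have c2 k1 k2 k3 k4 : k1 + k2 + k3 + k4 = 0 -> S k1 k2 k3 k4 = S k1 k3 k2 k4.
  by move=> k0; rewrite /S symb_swap23; congr (_ * _); ring.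
have c3 k1 k2 k3 k4 : k1 + k2 + k3 + k4 = 0 -> S k1 k2 k3 k4 = S k1 k2 k4 k3.
  by move=> k0; rewrite /S (symb_swap34 p k0); congr (_ * _); ring.
have h4 := sum4_symmetrize (zs N) g c1 c2 c3.
set Q := sum4 _ _ _ _ _ in h4 *.
have -> : nc Q = 4^-1 * nc (4%:R * Q).
  rewrite ncM (_ : nc 4%:R = 4); last by rewrite -[4%:R](rmorph_nat (@real_complex_def R (Phant R))) nc_real ger0_norm.
  by rewrite mulrA mulVf ?mul1r.
rewrite h4.
pose A k := nc (a k).
have A0 k : 0 <= A k by exact: nc_ge0.
pose W x y z w := (wp s x * A x) * (wp s y * A y) * (wp p z * A z) * (wp p w * A w).
have hp k1 k2 k3 k4 : k1 + k2 + k3 + k4 = 0 ->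
   nc ((g k1 + g k2 + g k3 + g k4) * S k1 k2 k3 k4) <=
   energy_const p s * (2 / 3) * (W k1 k2 k3 k4 + (W k1 k3 k2 k4 + (W k1 k4 k2 k3 +
                  (W k2 k3 k1 k4 + (W k2 k4 k1 k3 + W k3 k4 k1 k2))))).
  move=> k0; rewrite ncM /S !ncM nc_real normrM [`|3^-1|]ger0_norm// -!/(A _).
  rewrite /g -!rmorphD nc_real -!opprD normrN.
  have h := energy_symbol p12 s0 e0 k0.
  have V_le x y z w : Vpair p s x y z w * (A x * A y * A z * A w) <= 2 * W x y z w.
    rewrite /Vpair.
    have hz := norm_le_wp z; have hw := norm_le_wp w.
    have -> : 2 * W x y z w = wp s x * wp s y * (wp p z * wp p w + wp p w * wp p z) * (A x * A y * A z * A w).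
      by rewrite /W; ring.
    rewrite ler_wpM2r ?mulr_ge0// ler_wpM2l ?mulr_ge0 ?wp_ge0//.
    by rewrite lerD// ler_wpM2l ?wp_ge0.
  set P := A k1 * A k2 * A k3 * A k4.
  have P0 : 0 <= P by rewrite !mulr_ge0.
  apply: (@le_trans _ _ (3^-1 * P * (energy_const p s *
    (Vpair p s k1 k2 k3 k4 + Vpair p s k1 k3 k2 k4 + Vpair p s k1 k4 k2 k3 +
     Vpair p s k2 k3 k1 k4 + Vpair p s k2 k4 k1 k3 + Vpair p s k3 k4 k1 k2)))).
    apply: le_trans (ler_wpM2l _ h); rewrite ?mulr_ge0//.
    by apply: eq_ler; ring.
  have := V_le k1 k2 k3 k4; have := V_le k1 k3 k2 k4; have := V_le k1 k4 k2 k3.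
  have := V_le k2 k3 k1 k4; have := V_le k2 k4 k1 k3; have := V_le k3 k4 k1 k2.
  rewrite (_ : A k3 * A k4 * A k1 * A k2 = P); last by rewrite /P; ring.
  rewrite (_ : A k2 * A k4 * A k1 * A k3 = P); last by rewrite /P; ring.
  rewrite (_ : A k2 * A k3 * A k1 * A k4 = P); last by rewrite /P; ring.
  rewrite (_ : A k1 * A k4 * A k2 * A k3 = P); last by rewrite /P; ring.
  rewrite (_ : A k1 * A k3 * A k2 * A k4 = P); last by rewrite /P; ring.
  rewrite -/P => v1 v2 v3 v4 v5 v6.
  have v := lerD v6 (lerD v5 (lerD v4 (lerD v3 (lerD v2 v1)))).
  have E3 : 0 <= energy_const p s / 3 by rewrite divr_ge0.
  apply: le_trans (le_trans _ (ler_wpM2l E3 v)) _.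
    by apply: eq_ler; ring.
  by apply: eq_ler; ring.
pose B := l1c ^+ 2 * hn N a ^+ 4.
have base : sum4 (zs N) (zs N) (zs N) (zs N) (fun k1 k2 k3 k4 => W k1 k4 k2 k3) <= B.
  rewrite (@eq_sum4 _ _ _ _ _ _ (fun k1 k2 k3 k4 => wp s k1 * A k1 * (wp p k2 * A k2) * (wp p k3 * A k3) * (wp s k4 * A k4))); last first.
    by move=> *; rewrite /W; ring.
  apply: le_trans (le_flux3 _ _ _ _ _ _ _) _ => //.
    by move=> k; rewrite mulr_ge0.
  rewrite -!hn_sqr'; apply: (@le_trans _ _ (hn N a * hn N a * (l1c * hn N a) * (l1c * hn N a))).
    have := l1_hn N a; have : 0 <= \sum_(k <- zs N) wp p k * A k.
      by rewrite sumr_ge0// => k _; rewrite mulr_ge0 ?wp_ge0.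
    rewrite -/A; move: (\sum_(k <- _) _) => z z0 zl.
    by rewrite !ler_pM ?mulr_ge0 ?hn_ge0.
  by apply: eq_ler; rewrite /B; ring.
(* The other five choices of the dominant pair reduce to [base] by permuting summation variables. *)
pose good F := sum4 (zs N) (zs N) (zs N) (zs N) F <= B.
have P12 F : good (fun k1 k2 k3 k4 => F k2 k1 k3 k4) -> good F by rewrite /good [in X in _ -> X]sum4_swap12.
have P23 F : good (fun k1 k2 k3 k4 => F k1 k3 k2 k4) -> good F by rewrite /good [in X in _ -> X]sum4_swap23.
have P34 F : good (fun k1 k2 k3 k4 => F k1 k2 k4 k3) -> good F by rewrite /good [in X in _ -> X]sum4_swap34.
have g14 : good (fun k1 k2 k3 k4 => W k1 k4 k2 k3) by exact: base.
have g13 : good (fun k1 k2 k3 k4 => W k1 k3 k2 k4) by apply: P34; exact: g14.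
have g12 : good (fun k1 k2 k3 k4 => W k1 k2 k3 k4) by apply: P23; exact: g13.
have g24 : good (fun k1 k2 k3 k4 => W k2 k4 k1 k3) by apply: P12; exact: g14.
have g23 : good (fun k1 k2 k3 k4 => W k2 k3 k1 k4) by apply: P12; exact: g13.
have g34 : good (fun k1 k2 k3 k4 => W k3 k4 k1 k2) by apply: P23; exact: g24.
have B0 : 0 <= B by rewrite mulr_ge0 ?exprn_ge0 ?hn_ge0.
(* The factors multiply to 1: 1/4 from the symmetrization, 2/3 from the two terms of [Vpair] and the
   1/3 of the flux, 6 from the pairs. *)
apply: (@le_trans _ _ (4^-1 * (energy_const p s * (2 / 3) * (6 * B)))).
  rewrite ler_wpM2l//; apply: le_trans (nc_sum4 _ _ _ _ _) _.
  apply: (le_trans (@le_sum4 R (zs N) (zs N) (zs N) (zs N) _ _ hp)); have E23 : 0 <= energy_const p s * (2 / 3) by rewrite (mulr_ge0 E0).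
  rewrite -sum4Z !sum4D (ler_wpM2l E23)//.
  have := lerD g12 (lerD g13 (lerD g14 (lerD g23 (lerD g24 g34)))).
  by move=> /le_trans; apply; apply: eq_ler; ring.
by rewrite -[leRHS]mulrA -/B; apply: eq_ler; field.
Qed.

(** The sequence w occupies the positions k1 and k4, in which the symbol is symmetric. Averaging the
    multiplier - k4 over both replaces it by half of k2 + k3, so that the derivative falls on b and
    d and not on w. *)
Lemma flux3_diff_energy N w b d : csym w ->
  nc (\sum_(k <- zs N) (k%:~R * (w k)^*%C) * flux3 N w b d k) <=
  4 * p * l1c ^+ 2 * hn N b * hn N d * (\sum_(k <- zs N) nc (w k) ^+ 2).
Proof.
move=> hw; have [p1 p2] := andP p12; have s0 : 0 <= s by move: ps; lra.
have l0 : 0 <= l1c by exact: l1_const_ge0.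
rewrite pair_flux3.
pose S k1 k2 k3 k4 := (symb p k1 k2 k3 / 3)%:C%C * (w k1 * b k2 * d k3 * w k4).
set Q := sum4 _ _ _ _ _.
have Q4 : Q = sum4 (zs N) (zs N) (zs N) (zs N) (fun k1 k2 k3 k4 => - k4%:~R * S k1 k2 k3 k4).
  by apply: eq_sum4 => k1 k2 k3 k4 _; rewrite hw conjcK intrN /S; ring.
have Q1 : Q = sum4 (zs N) (zs N) (zs N) (zs N) (fun k1 k2 k3 k4 => - k1%:~R * S k1 k2 k3 k4).
  rewrite Q4 sum4_swap14; apply: eq_sum4 => k1 k2 k3 k4 k0.
  by rewrite /S (symb_swap14 p k0); congr (_ * (_ * _)); ring.
have Q2 : Q = 2^-1 * sum4 (zs N) (zs N) (zs N) (zs N) (fun k1 k2 k3 k4 => (k2 + k3)%:~R * S k1 k2 k3 k4).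
  apply: (@mulfI _ 2); first by rewrite pnatr_eq0.
  rewrite mulrA mulfV ?mul1r ?pnatr_eq0// mulr_natl mulr2n {1}Q1 Q4 -sum4D; apply: eq_sum4 => k1 k2 k3 k4 k0.
  rewrite -mulrDl -!rmorphN -rmorphD/=; congr (_%:~R * _); clear -k0; lia.
rewrite Q2 ncM.
have n2 : nc 2^-1 = 2^-1.
  by rewrite -(rmorph_nat (@real_complex_def R (Phant R))) -fmorphV nc_real ger0_norm.
rewrite n2.
pose A k := nc (w k); pose B k := nc (b k); pose D k := nc (d k).
have A0 k : 0 <= A k by exact: nc_ge0.
have hp k1 k2 k3 k4 : k1 + k2 + k3 + k4 = 0 ->
   nc ((k2 + k3)%:~R * S k1 k2 k3 k4) <=
   (8 * p / 3) * (1 * A k1 * (wp p k2 * B k2) * (wp p k3 * D k3) * A k4).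
  move=> k0; rewrite ncM nc_int /S !ncM nc_real normrM [`|3^-1|]ger0_norm//.
  have q0 : 0 <= p - 1 by lra.
  have h2 := symb_bound k1 k2 k3 p12.
  have h3 : `|symb p k1 k2 k3| <= 4 * p * wp (p - 1) k3 * `|k2%:~R|.
    by rewrite symb_swap23; exact: symb_bound.
  have px k : wp p k = wp (p - 1) k * `|k%:~R| by rewrite -{1}(subrK 1 p) wpD1.
  have h : `|(k2 + k3)%:~R| * `|symb p k1 k2 k3| <= 8 * p * (wp p k2 * wp p k3).
    apply: (@le_trans _ _ (`|k2%:~R| * `|symb p k1 k2 k3| + `|k3%:~R| * `|symb p k1 k2 k3|)).
      by rewrite -mulrDl ler_wpM2r// intrD ler_normD.
    have := ler_wpM2l (normr_ge0 (k2%:~R : R)) h2; have := ler_wpM2l (normr_ge0 (k3%:~R : R)) h3.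
    move=> u v; apply: le_trans (lerD v u) _.
    have e1 := ler_wpM2l (wp_ge0 p k2) (norm_le_wp k3).
    have e2 := ler_wpM2l (wp_ge0 p k3) (norm_le_wp k2).
    have p4 : 0 <= 4 * p by lra.
    apply: le_trans (le_trans _ (ler_wpM2l p4 (lerD e1 e2))) _.
      by rewrite !px; apply: eq_ler; ring.
    by apply: eq_ler; ring.
  have P0 : 0 <= 3^-1 * (A k1 * B k2 * D k3 * A k4) by rewrite !mulr_ge0 ?nc_ge0.
  have := ler_wpM2l P0 h => u; apply: le_trans (le_trans _ u) _.
    by apply: eq_ler; rewrite /A /B /D; ring.
  by apply: eq_ler; ring.
have p83 : 0 <= 8 * p / 3 by lra.
apply: (@le_trans _ _ (2^-1 * (8 * p / 3 * ((\sum_(k <- zs N) A k ^+ 2) * (l1c * hn N b) * (l1c * hn N d))))).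
  rewrite ler_wpM2l//; apply: le_trans (nc_sum4 _ _ _ _ _) _.
  apply: (le_trans (@le_sum4 R (zs N) (zs N) (zs N) (zs N) _ _ hp)).
  rewrite -sum4Z ler_wpM2l//.
  apply: le_trans (@le_flux3 N A B D N A (fun=> 1) _ _ _ _ _) _ => //.
  under [X in Num.sqrt X * _ * _ * _]eq_bigr do rewrite mul1r.
  rewrite -expr2 sqr_sqrtr; last by rewrite sumr_ge0// => k _; rewrite sqr_ge0.
  have sA : 0 <= \sum_(k <- zs N) A k ^+ 2 by rewrite sumr_ge0// => k _; rewrite sqr_ge0.
  rewrite ler_pM ?mulr_ge0 ?sumr_ge0 ?l1_hn// ?ler_wpM2l ?l1_hn//;
    by move=> k _; rewrite mulr_ge0 ?wp_ge0 ?nc_ge0.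
rewrite [X in X <= _](_ : _ = 4 / 3 * p * l1c ^+ 2 * hn N b * hn N d * \sum_(k <- zs N) nc (w k) ^+ 2); last by rewrite /A; field.
rewrite !ler_wpM2r ?hn_ge0 ?sqr_ge0 ?sumr_ge0//; try lra.
by move=> k _; rewrite sqr_ge0.
Qed.

End Flux.

#[global] Hint Extern 0 (is_true (_ <= _)) => exact: hn_ge0 : core.

(** * The Galerkin system and its Euler scheme *)

Section GalerkinField.
Variable R : realType.
Local Notation C := R[i].
Local Notation nc := (@ComplexField.Normc.normc R).
Local Notation Re := (@complex.Re R).
Variables (p s b c : R).
Hypotheses (p12 : 1 <= p <= 2) (ps : p + 2^-1 < s).
Implicit Types (a : int -> C) (k : int).

(* Here p = 3 - alpha, b = b_alpha and c = c_alpha / 2; X stands for the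
   coefficients of the flux. *)
Definition vfield (X Y : int -> C) k : C :=
  - ('i%C * k%:~R) * (c%:C%C * X k + (b * wp (p - 2) k)%:C%C * Y k).

Definition fld N a : int -> C := vfield (flux3 p N a a a) a.

Lemma fld0 N a : fld N a 0 = 0.
Proof. by rewrite /fld /vfield mulr0 oppr0 mul0r. Qed.

Lemma fld_csym N a : csym a -> csym (fld N a).
Proof.
move=> ha k; rewrite /fld /vfield (flux3_csym _ _ ha ha ha) ha wpN intrN.
by rewrite !(conjN, conjM, conjD, conjc_real, conj_int, conj_i); ring.
Qed.

Lemma vfield0 X Y : vfield X Y 0 = 0.
Proof. by rewrite /vfield !(mulr0, oppr0, mul0r). Qed.

(** The factor k accounts for the loss from s to s - 1; the linear multiplier satisfies |k|^(p-2) <=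
    1 as p <= 2. *)
Lemma vfield_hn M X Y :
  hn (s - 1) M (vfield X Y) ^+ 2 <= 2 * (c ^+ 2 * hn s M X ^+ 2 + b ^+ 2 * hn s M Y ^+ 2).
Proof.
have [p1 p2] := andP p12.
rewrite !hn_sqr !mulr_sumr -big_split/= mulr_sumr; apply: ler_sum => k _.
have [->|k0] := eqVneq k 0.
  rewrite vfield0 nc0 expr0n mulr0 mulr_ge0// addr_ge0// mulr_ge0 ?sqr_ge0//.
    by rewrite mulr_ge0 ?sqr_ge0.
  by rewrite mulr_ge0 ?sqr_ge0.
rewrite /vfield ncM ncN ncM nc_i mul1r nc_int exprMn [leLHS]mulrA.
have -> : wp (2 * (s - 1)) k * `|k%:~R| ^+ 2 = wp (2 * s) k :> R.
  rewrite !wp_sqr -exprMn; congr (_ ^+ 2).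
  by rewrite -[X in _ * X]wp1 -wpD// subrK.
rewrite [leRHS](_ : _ = wp (2 * s) k * (2 * (c ^+ 2 * nc (X k) ^+ 2 + b ^+ 2 * nc (Y k) ^+ 2))); last by ring.
rewrite ler_wpM2l//; apply: le_trans (nc_sqrD_le _ _) _.
rewrite ler_wpM2l// !ncM !nc_real !exprMn !real_normK ?num_real// lerD2l.
rewrite ler_wpM2r ?sqr_ge0// exprMn ler_piMr ?sqr_ge0// exprn_ile1//.
by apply: wp_le1 => //; lra.
Qed.

Lemma fld_hn N M a :
  hn (s - 1) M (fld N a) ^+ 2 <=
  2 * (c ^+ 2 * hn s M (flux3 p N a a a) ^+ 2 + b ^+ 2 * hn s M a ^+ 2).
Proof. exact: vfield_hn. Qed.

Definition fld_const (K : R) : R :=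
  Num.sqrt (2 * (c ^+ 2 * (tri_const p s * K ^+ 3) ^+ 2 + b ^+ 2 * K ^+ 2)).

Lemma fld_const_ge0 K : 0 <= fld_const K. Proof. exact: sqrtr_ge0. Qed.

Lemma fld_hn_le N M a K : (forall M, hn s M a <= K) ->
  hn (s - 1) M (fld N a) <= fld_const K.
Proof.
move=> aK; have K0 : 0 <= K by apply: le_trans (aK 0).
apply: le_sqrt; apply: le_trans (fld_hn _ _ _) _.
rewrite ler_wpM2l// lerD// ler_wpM2l ?sqr_ge0// ler_sqr ?nnegrE//; last first.
  by rewrite mulr_ge0 ?tri_const_ge0 ?exprn_ge0.
apply: le_trans (flux3_hn p12 ps _ _ _ _ _) _.
have h3 : hn s N a ^+ 3 <= K ^+ 3 by rewrite lerXn2r ?nnegrE.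
have t0 : 0 <= tri_const p s by apply: tri_const_ge0.
apply: le_trans _ (ler_wpM2l t0 h3).
by apply: eq_ler; ring.
Qed.

Lemma nc_le_hn (t : R) M a k K : (`|k| <= M)%N -> k != 0 -> 0 <= t ->
  hn t M a <= K -> nc (a k) <= K.
Proof.
move=> kM k0 t0; apply: le_trans; apply: le_sqrt.
rewrite (bigD1_seq k) ?mem_zs ?uniq_zs//=.
apply: (@le_trans _ _ (wp (2 * t) k * nc (a k) ^+ 2)); last first.
  by rewrite lerDl sumr_ge0// => j _; rewrite mulr_ge0 ?sqr_ge0.
rewrite ler_peMl ?sqr_ge0//.
by apply: wp_ge1 => //; rewrite mulr_ge0.
Qed.

Lemma fld_sup N a K k : (forall M, hn s M a <= K) -> nc (fld N a k) <= fld_const K.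
Proof.
move=> aK; have [->|k0] := eqVneq k 0; first by rewrite fld0 nc0 fld_const_ge0.
have [p1 p2] := andP p12; have s1 : 0 <= s - 1 by move: ps; lra.
by apply: (nc_le_hn (leqnn _) k0 s1); apply: fld_hn_le.
Qed.

Definition lip_const (K : R) : R :=
  `|c| * (12 * p * l1_const p s ^+ 2 * K ^+ 2) + `|b|.

Lemma lip_const_ge0 K : 0 <= lip_const K.
Proof.
have [p1 p2] := andP p12.
have l0 : 0 <= l1_const p s by exact: l1_const_ge0.
rewrite /lip_const addr_ge0// mulr_ge0// mulr_ge0 ?sqr_ge0//.
by rewrite mulr_ge0 ?sqr_ge0//; lra.
Qed.

(** Lipschitz in the sup norm of the coefficients, with a constant proportional to |k| but
    independent of N; this is what a limit at fixed k requires. The 12 in [lip_const] is 3 times 4,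
    for the three terms of [flux3_diff]. *)
Lemma fld_lip N a a' K k e : (forall j, nc (a j - a' j) <= e) ->
  hn s N a <= K -> hn s N a' <= K ->
  nc (fld N a k - fld N a' k) <= `|k%:~R| * lip_const K * e.
Proof.
move=> ae aK aK'; have [p1 p2] := andP p12.
have e0 : 0 <= e by apply: le_trans (ae 0).
have K0 : 0 <= K by apply: le_trans aK.
have l0 : 0 <= l1_const p s by exact: l1_const_ge0.
have [->|k0] := eqVneq k 0; first by rewrite !fld0 subrr nc0 normr0 !mul0r.
rewrite /fld /vfield -mulrBr ncM ncN ncM nc_i mul1r nc_int -mulrA ler_wpM2l//.
rewrite (_ : _ - _ = c%:C%C * (flux3 p N a a a k - flux3 p N a' a' a' k) +
   (b * wp (p - 2) k)%:C%C * (a k - a' k)); last by ring.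
apply: le_trans (nc_leD _ _) _; rewrite !ncM !nc_real mulrDl; apply: lerD.
  rewrite -mulrA ler_wpM2l// flux3_diff.
  have f3 x y : hn s N x <= K -> hn s N y <= K ->
      nc (flux3 p N (fun j => a j - a' j) x y k) <= 4 * p * l1_const p s ^+ 2 * K ^+ 2 * e.
    move=> xK yK; apply: le_trans (flux3_sup p12 ps _ _ _ _ ae) _.
    rewrite ler_wpM2r// -mulrA expr2 ler_wpM2l ?ler_pM//.
    by rewrite mulr_ge0 ?sqr_ge0//; lra.
  apply: le_trans (nc_leD _ _) _; apply: le_trans (lerD (nc_leD _ _) (lexx _)) _.
  apply: le_trans (lerD (lerD (f3 _ _ aK aK) (f3 _ _ aK' aK)) (f3 _ _ aK' aK')) _.
  by apply: eq_ler; ring.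
apply: ler_pM => //; rewrite normrM ler_piMr// ger0_norm//.
by apply: wp_le1 => //; lra.
Qed.

Definition en e N a : R := \sum_(k <- zs N) wcut s e k * nc (a k) ^+ 2.

Lemma en0 N a : en 0 N a = hn s N a ^+ 2.
Proof.
rewrite hn_sqr; apply: eq_bigr => k _; congr (_ * _).
rewrite /wcut /cutoff mul0r subr0 (_ : Num.max _ _ = 1) ?mulr1//.
by apply/max_idPr.
Qed.

(** An Euler step followed by the projection to |k| <= N, since the flux of a truncated sequence
    reaches the frequency 3 N. *)
Definition gstep N (h : R) a k : C :=
  if (`|k| <= N)%N then a k + h%:C%C * fld N a k else 0.

Definition en_const : R := 2 * `|c| * energy_const p s * l1_const p s ^+ 2.

Lemma en_const_ge0 : 0 <= en_const.
Proof.
have [p1 p2] := andP p12; have s0 : 0 <= s by move: ps; lra.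
by rewrite /en_const /energy_const !mulr_ge0 ?powR_ge0 ?l1_const_ge0//; lra.
Qed.

(** In the expansion of |a + h F|^2 the term of order h is bounded by [flux3_energy], uniformly in N
    and e. The term in h^2 lacks cancellation: it is bounded by the norm of index s - 1, at the
    price of N^2 for the missing derivative. *)
Lemma en_step e N h a K : 0 <= e -> 0 <= h -> csym a -> (forall M, hn s M a <= K) ->
  `|en e N (gstep N h a) - en e N a| <=
  h * (en_const * K ^+ 4) + h ^+ 2 * (N%:R ^+ 2 * fld_const K ^+ 2).
Proof.
move=> e0 h0 ha aK; have [p1 p2] := andP p12; have s0 : 0 <= s by move: ps; lra.
have K0 : 0 <= K by apply: le_trans (aK 0).
have ReD : {morph Re : x y / x + y} by move=> [x1 x2] [y1 y2].
have ReR (x : R) (z : C) : Re (x%:C%C * z) = x * Re z by case: z => u v /=; rewrite mul0r subr0.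
have -> : en e N (gstep N h a) - en e N a =
   h * (2 * \sum_(k <- zs N) wcut s e k * Re ((a k)^*%C * fld N a k)) +
   h ^+ 2 * \sum_(k <- zs N) wcut s e k * nc (fld N a k) ^+ 2.
  rewrite /en -sumrB !mulr_sumr -big_split/=; apply: eq_big_seq => k.
  rewrite mem_zs /gstep => ->; rewrite nc_sqrD ncM nc_real mulrCA ReR exprMn real_normK ?num_real//.
  by ring.
apply: le_trans (ler_normD _ _) _; apply: lerD.
  rewrite normrM ger0_norm// ler_wpM2l//.
  pose Z := \sum_(k <- zs N) ((k%:~R * wcut s e k)%:C%C * (a k)^*%C) * flux3 p N a a a k.
  have -> : \sum_(k <- zs N) wcut s e k * Re ((a k)^*%C * fld N a k) = Re (- 'i%C * c%:C%C * Z).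
    rewrite /Z mulr_sumr (big_morph Re ReD (erefl _)); apply: eq_bigr => k _.
    rewrite -ReR.
    (* The linear term contributes i times a real number, hence nothing to the real part. *)
    have -> : (wcut s e k)%:C%C * ((a k)^*%C * fld N a k) =
       - 'i%C * c%:C%C * ((k%:~R * wcut s e k)%:C%C * (a k)^*%C * flux3 p N a a a k) +
       (- 'i%C) * (k%:~R * wcut s e k * b * wp (p - 2) k * nc (a k) ^+ 2)%:C%C.
      rewrite /fld /vfield -[k%:~R in LHS]rc_int.
      have := ReM_conj (a k); move: (nc (a k) ^+ 2) => n2 cE.
      by rewrite !rcM -cE; ring.
    rewrite ReD [X in _ + X](_ : _ = 0) ?addr0//.
    by rewrite mulrC ReR /= oppr0 mulr0.
  rewrite normrM ger0_norm//; apply: le_trans (ler_wpM2l _ (Re_le_nc _)) _ => //.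
  rewrite !ncM ncN nc_i mul1r nc_real /en_const.
  have zz := flux3_energy p12 ps N e0 ha.
  have EC0 : 0 <= energy_const p s by rewrite /energy_const !mulr_ge0 ?powR_ge0//; lra.
  have K4 : hn s N a ^+ 4 <= K ^+ 4 by rewrite lerXn2r ?nnegrE.
  have L0 : 0 <= energy_const p s * l1_const p s ^+ 2 by rewrite mulr_ge0 ?sqr_ge0.
  have zK := le_trans zz (ler_wpM2l L0 K4).
  have c0 : 0 <= 2 * `|c| by rewrite mulr_ge0.
  apply: le_trans (le_trans _ (ler_wpM2l c0 zK)) _.
    by rewrite mulrA.
  by apply: eq_ler; ring.
rewrite ger0_norm; last first.
  rewrite mulr_ge0 ?sqr_ge0// sumr_ge0// => k _; rewrite mulr_ge0 ?sqr_ge0 ?wcut_ge0//.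
rewrite ler_wpM2l ?sqr_ge0//.
apply: (@le_trans _ _ (N%:R ^+ 2 * hn (s - 1) N (fld N a) ^+ 2)); last first.
  by rewrite ler_wpM2l ?sqr_ge0// ler_sqr ?nnegrE ?fld_const_ge0// fld_hn_le.
rewrite hn_sqr mulr_sumr; rewrite [leLHS]big_seq [leRHS]big_seq; apply: ler_sum => k kN; rewrite mulrA ler_wpM2r ?sqr_ge0//.
apply: le_trans (wcut_le s e0 k) _.
have [->|k0] := eqVneq k 0.
  have s1 : 0 < 2 * s by move: ps; lra.
  by rewrite wp0 ?gt_eqF// mulr_ge0 ?sqr_ge0.
rewrite !wp_sqr -exprMn ler_sqr ?nnegrE ?mulr_ge0//.
have -> : wp s k = `|k%:~R| * wp (s - 1) k by rewrite -(wp1 R) -wpD// addrC subrK.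
rewrite ler_wpM2r//.
by move: kN; rewrite mem_zs => kN; rewrite -intr_norm -natr_absz ler_nat.
Qed.

End GalerkinField.

(** * The Euler scheme on a time interval independent of the truncation *)

Section EulerScheme.
Variable R : realType.
Local Notation C := R[i].
Local Notation nc := (@ComplexField.Normc.normc R).
Variables (p s b c : R).
Hypotheses (p12 : 1 <= p <= 2) (ps : p + 2^-1 < s).
Implicit Types (a : int -> C) (k : int) (N M n m : nat).

Definition low N a k : C := if (`|k| <= N)%N then a k else 0.

Definition supp N a := forall k, (N < `|k|)%N -> a k = 0.

Lemma supp_low N a : supp N (low N a).
Proof. by move=> k kN; rewrite /low leqNgt kN. Qed.

Lemma csym_low N a : csym a -> csym (low N a).
Proof. by move=> ha k; rewrite /low abszN; case: ifP; rewrite ?ha ?conjc0. Qed.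

Lemma hn_homo (t : R) N M a : (N <= M)%N -> hn t N a <= hn t M a.
Proof.
move=> NM; apply: ler_wsqrtr; apply: ler_zs => // k.
by rewrite mulr_ge0 ?sqr_ge0.
Qed.

Lemma hn_supp (t : R) N M a : supp N a -> hn t M a <= hn t N a.
Proof.
move=> sa; have [MN|NM] := leqP M N; first exact: hn_homo.
rewrite /hn (zs_split _ (ltnW NM)) [X in _ + X]big1 ?addr0// => k kN.
by rewrite (sa _ kN) nc0 expr0n mulr0.
Qed.

Lemma hn_low (t : R) N M a : hn t M (low N a) <= hn t M a.
Proof.
apply: ler_wsqrtr; apply: ler_sum => k _; rewrite ler_wpM2l// /low.
by case: ifP => // _; rewrite nc0 expr0n sqr_ge0.
Qed.

Variables (a0 : int -> C) (E0 : R).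
Hypotheses (a0_sym : csym a0) (a00 : a0 0 = 0) (E0_ge0 : 0 <= E0).
Hypothesis a0_bound : forall M, hn s M a0 ^+ 2 <= E0.

(** From E0 the energy may gain E0 + 1, and at the growth rate [rate] this takes the time
    [lifespan]. The 1 in E0 + 1 keeps the lifespan positive for zero data; the 1 in [rate] pays for
    the quadratic errors of the Euler steps. *)
Definition ebound : R := Num.sqrt (2 * E0 + 1).
Local Notation K := ebound.
Local Notation V := (fld_const p s b c K).

Lemma ebound_ge0 : 0 <= K. Proof. exact: sqrtr_ge0. Qed.

Definition rate : R := en_const p s c * K ^+ 4 + 1.

Lemma rate_gt0 : 0 < rate.
Proof.
rewrite ltr_wpDl//; have e0 : 0 <= en_const p s c by apply: en_const_ge0.
by rewrite mulr_ge0// exprn_ge0 ?ebound_ge0.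
Qed.

Definition lifespan : R := (E0 + 1) / rate.

Lemma lifespan_gt0 : 0 < lifespan.
Proof. by rewrite divr_gt0 ?rate_gt0// ltr_wpDl. Qed.

(* So small that the quadratic errors of the Euler steps add up to at most 1
   per unit of time. *)
Definition hstep N : R := ((N.+1%:R) ^+ 2 * (V ^+ 2 + 1))^-1.

Lemma hstep_gt0 N : 0 < hstep N.
Proof. by rewrite invr_gt0 mulr_gt0 ?exprn_gt0// ltr_wpDl// sqr_ge0. Qed.

Lemma hstep_small N : hstep N * (N%:R ^+ 2 * V ^+ 2) <= 1.
Proof.
rewrite mulrC ler_pdivrMr; last by rewrite mulr_gt0 ?exprn_gt0// ltr_wpDl// sqr_ge0.
rewrite mul1r ler_pM ?sqr_ge0//; last by rewrite lerDl.
by rewrite lerXn2r ?nnegrE// ler_nat.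
Qed.

Lemma hstep_le N : hstep N <= N.+1%:R^-1.
Proof.
rewrite lef_pV2 ?posrE ?mulr_gt0 ?exprn_gt0//; last by rewrite ltr_wpDl// sqr_ge0.
apply: (@le_trans _ _ (N.+1%:R ^+ 2)); first by rewrite expr2 ler_peMl// ler1n.
by rewrite ler_peMr ?sqr_ge0// lerDr sqr_ge0.
Qed.

Definition eul N n : int -> C := iter n (gstep p b c N (hstep N)) (low N a0).

Lemma eul_supp N n : supp N (eul N n).
Proof.
elim: n => [|n IH]; first exact: supp_low.
by move=> k kN; rewrite /eul iterS /gstep leqNgt kN.
Qed.

Lemma eul_csym N n : csym (eul N n).
Proof.
elim: n => [|n IH]; first exact: csym_low.
move=> k; rewrite /eul !iterS /gstep -/(eul N n) abszN; case: ifP => _; last by rewrite conjc0.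
by rewrite IH (fld_csym p b c N IH) conjD (conjM _ (fld _ _ _ _ _ _)) conjc_real.
Qed.

Lemma eul_at0 N n : eul N n 0 = 0.
Proof.
elim: n => [|n IH]; first by rewrite /eul/= /low/= a00.
by rewrite /eul iterS -/(eul N n) /gstep IH fld0 mulr0 addr0.
Qed.

Lemma eul_step_en N n e : 0 <= e -> (forall M, hn s M (eul N n) <= K) ->
  `|en s e N (eul N n.+1) - en s e N (eul N n)| <= hstep N * rate.
Proof.
move=> e0 nK; rewrite /eul iterS -/(eul N n).
apply: le_trans (en_step b c p12 ps N e0 (ltW (hstep_gt0 N)) (@eul_csym N n) nK) _.
rewrite mulrDr mulr1 lerD2l expr2 -mulrA.
by rewrite ler_piMr ?hstep_small// ltW// hstep_gt0.
Qed.

(** A bootstrap on n: within the lifespan, the energy bound at step n keeps the norm below the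
    constant K with which the next increment was estimated. *)
Lemma eul_bound N n M : n%:R * hstep N <= lifespan -> hn s M (eul N n) <= K.
Proof.
move=> nT; apply: le_trans (hn_supp _ _ (@eul_supp N n)) _; apply: le_sqrt.
suff {M nT} : forall n, n%:R * hstep N <= lifespan ->
    hn s N (eul N n) ^+ 2 <= E0 + n%:R * hstep N * rate.
  move=> /(_ _ nT) /le_trans; apply.
  have : n%:R * hstep N * rate <= E0 + 1 by rewrite -ler_pdivlMr ?rate_gt0.
  by lra.
elim=> [_|{}n IH nT].
  rewrite mul0r mul0r addr0 /eul/=; apply: le_trans (a0_bound N).
  by rewrite ler_sqr ?nnegrE// hn_low.
have nT' : n%:R * hstep N <= lifespan.
  by apply: le_trans nT; rewrite ler_wpM2r ?ler_nat// ltW// hstep_gt0.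
have h := IH nT'.
have hK M : hn s M (eul N n) <= K.
  apply: le_trans (hn_supp _ _ (@eul_supp N n)) _; apply: le_sqrt; apply: (le_trans h).
  have : n%:R * hstep N * rate <= E0 + 1 by rewrite -ler_pdivlMr ?rate_gt0.
  by lra.
have := eul_step_en (lexx 0) hK; rewrite !en0 => /(le_trans (ler_norm _)).
by rewrite -(natr1 n) !mulrDl mul1r; lra.
Qed.

Lemma eul_en_lip N n m e : 0 <= e -> (n + m)%:R * hstep N <= lifespan ->
  `|en s e N (eul N (n + m)) - en s e N (eul N n)| <= m%:R * hstep N * rate.
Proof.
move=> e0; elim: m => [|m IH] h; first by rewrite addn0 subrr normr0 !mul0r.
have h' : (n + m)%:R * hstep N <= lifespan.
  by apply: le_trans h; rewrite ler_wpM2r ?ler_nat ?leq_add2l// ltW// hstep_gt0.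
have hK M : hn s M (eul N (n + m)) <= K by apply: eul_bound.
have h1 := eul_step_en e0 hK; have h2 := IH h'.
rewrite addnS -(natr1 m) !mulrDl mul1r.
by apply: le_trans (ler_distD (en s e N (eul N (n + m))) _ _) _; lra.
Qed.

Lemma eul_lip N n m k : (n + m)%:R * hstep N <= lifespan ->
  nc (eul N (n + m) k - eul N n k) <= m%:R * hstep N * V.
Proof.
elim: m => [|m IH] h; first by rewrite addn0 subrr nc0 !mul0r.
have h' : (n + m)%:R * hstep N <= lifespan.
  by apply: le_trans h; rewrite ler_wpM2r ?ler_nat ?leq_add2l// ltW// hstep_gt0.
have hK M : hn s M (eul N (n + m)) <= K by apply: eul_bound.
have h2 := IH h'.
have V0 : 0 <= V by apply: fld_const_ge0.
have H0 := ltW (hstep_gt0 N).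
rewrite addnS -(natr1 m) !mulrDl mul1r.
have [kN|kN] := leqP `|k| N; last first.
  by rewrite !eul_supp// subrr nc0 addr_ge0 ?mulr_ge0.
rewrite {1}/eul iterS -/(eul N (n + m)) /gstep kN addrAC.
apply: le_trans (nc_leD _ _) _; apply: lerD => //.
rewrite ncM nc_real (ger0_norm H0) ler_wpM2l//.
exact: fld_sup.
Qed.

(** After m steps the coefficients have moved by at most m h V, so by [fld_lip] the field differs
    from its value at step n by a multiple of m h. Each step adds h times this, whence the square,
    with constants independent of N. *)
Lemma eul_taylor N n m k : (n + m)%:R * hstep N <= lifespan -> (`|k| <= N)%N ->
  nc (eul N (n + m) k - eul N n k - (m%:R * hstep N)%:C%C * fld p b c N (eul N n) k) <=
  (m%:R * hstep N) ^+ 2 * (`|k%:~R| * lip_const p s b c K * V).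
Proof.
move=> + kN; have V0 : 0 <= V by apply: fld_const_ge0.
have L0 : 0 <= lip_const p s b c K by apply: lip_const_ge0.
have H0 := ltW (hstep_gt0 N).
elim: m => [|m IH] h.
  by rewrite addn0 subrr sub0r !(@mul0r R) expr0n (@mul0r R) mul0r ncN nc0.
have h' : (n + m)%:R * hstep N <= lifespan.
  by apply: le_trans h; rewrite ler_wpM2r ?ler_nat ?leq_add2l// ltW// hstep_gt0.
have hK M : hn s M (eul N (n + m)) <= K by apply: eul_bound.
have hK' M : hn s M (eul N n) <= K.
  by apply: eul_bound; apply: le_trans h'; rewrite ler_wpM2r ?ler_nat ?leq_addr.
have h2 := IH h'.
have h3 : nc (fld p b c N (eul N (n + m)) k - fld p b c N (eul N n) k) <=
    `|k%:~R| * lip_const p s b c K * (m%:R * hstep N * V).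
  apply: fld_lip => //; first by move=> j; exact: eul_lip.
rewrite addnS {1}/eul iterS -/(eul N (n + m)) /gstep kN.
rewrite (_ : _ - _ - _ = eul N (n + m) k - eul N n k - (m%:R * hstep N)%:C%C * fld p b c N (eul N n) k +
   (hstep N)%:C%C * (fld p b c N (eul N (n + m)) k - fld p b c N (eul N n) k)); last first.
  by rewrite -(natr1 m) [(_ + 1) * _]mulrDl mul1r rcD; ring.
apply: le_trans (nc_leD _ _) _.
rewrite ncM nc_real (ger0_norm H0).
apply: le_trans (lerD h2 (ler_wpM2l H0 h3)) _.
rewrite -(natr1 m); have m0 : 0 <= m%:R :> R by [].
have Z0 : 0 <= `|k%:~R| * lip_const p s b c K * V by rewrite !mulr_ge0.
rewrite [leLHS](_ : _ = ((m%:R * hstep N) ^+ 2 + hstep N * (m%:R * hstep N)) *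
   (`|k%:~R| * lip_const p s b c K * V)); last by ring.
rewrite ler_wpM2r//.
move: (hstep N) (m%:R) H0 m0 => x y x0 y0; nra.
Qed.

(** The iterates as a step function of real time; passing from a time to the grid costs at most one
    step. *)
Definition gal N (t : R) : int -> C := eul N (Num.truncn (t / hstep N)).

Lemma gal_index N t : 0 <= t ->
  (Num.truncn (t / hstep N))%:R * hstep N <= t < (Num.truncn (t / hstep N))%:R * hstep N + hstep N.
Proof.
move=> t0; have H := hstep_gt0 N.
have := truncn_itv (divr_ge0 t0 (ltW H)).
by rewrite ler_pdivlMr// ltr_pdivrMr// -natr1 mulrDl mul1r.
Qed.

Lemma gal_bound N t M : 0 <= t <= lifespan -> hn s M (gal N t) <= K.
Proof.
move=> /andP[t0 tT]; apply: eul_bound; apply: le_trans tT.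
by have /andP[] := gal_index N t0.
Qed.

Lemma gal0 N : gal N 0 = low N a0.
Proof. by rewrite /gal mul0r truncn0. Qed.

Lemma gal_split N t t' : 0 <= t -> t <= t' -> exists m,
  Num.truncn (t' / hstep N) = (Num.truncn (t / hstep N) + m)%N /\
  `|m%:R * hstep N - (t' - t)| <= hstep N.
Proof.
move=> t0 tt'; have H := hstep_gt0 N; have t'0 := le_trans t0 tt'.
exists (Num.truncn (t' / hstep N) - Num.truncn (t / hstep N))%N.
have nn : (Num.truncn (t / hstep N) <= Num.truncn (t' / hstep N))%N.
  by apply: le_truncn; rewrite ler_pM2r// invr_gt0.
split; first by rewrite subnKC.
rewrite natrB// mulrBl ler_norml.
have /andP[] := gal_index N t0; have /andP[] := gal_index N t'0.
move: (_%:R * hstep N) (_%:R * hstep N) => u v; lra.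
Qed.

Lemma gal_taylor N t t' k : 0 <= t -> t <= t' -> t' <= lifespan -> (`|k| <= N)%N ->
  nc (gal N t' k - gal N t k - (t' - t)%:C%C * fld p b c N (gal N t) k) <=
  (t' - t + hstep N) ^+ 2 * (`|k%:~R| * lip_const p s b c K * V) + hstep N * V.
Proof.
move=> t0 tt' t'T kN; have [m [e hm]] := gal_split N t0 tt'.
have V0 : 0 <= V by apply: fld_const_ge0.
have L0 : 0 <= lip_const p s b c K by apply: lip_const_ge0.
have H0 := ltW (hstep_gt0 N).
have nT : (Num.truncn (t / hstep N) + m)%:R * hstep N <= lifespan.
  rewrite -e; apply: le_trans t'T.
  by have /andP[] := gal_index N (le_trans t0 tt').
have h := eul_taylor nT kN; rewrite -e -/(gal N t') -/(gal N t) in h.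
rewrite (_ : _ - _ - _ = gal N t' k - gal N t k - (m%:R * hstep N)%:C%C * fld p b c N (gal N t) k +
   (m%:R * hstep N - (t' - t))%:C%C * fld p b c N (gal N t) k); last first.
  by rewrite -[_%:R * _ - _]addrC rcD; ring.
apply: le_trans (nc_leD _ _) _; apply: lerD.
  apply: le_trans h _; rewrite ler_wpM2r ?mulr_ge0// lerXn2r ?nnegrE ?mulr_ge0//.
    by rewrite addr_ge0// subr_ge0.
  by move: hm; rewrite ler_norml => /andP[]; lra.
rewrite ncM nc_real ler_pM//; apply: fld_sup => // M.
by apply: gal_bound; rewrite t0 (le_trans tt').
Qed.

Lemma gal_en_lip N t t' e : 0 <= e -> 0 <= t -> t <= t' -> t' <= lifespan ->
  `|en s e N (gal N t') - en s e N (gal N t)| <= (t' - t + hstep N) * rate.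
Proof.
move=> e0 t0 tt' t'T; have [m [e' hm]] := gal_split N t0 tt'.
have nT : (Num.truncn (t / hstep N) + m)%:R * hstep N <= lifespan.
  rewrite -e'; apply: le_trans t'T.
  by have /andP[] := gal_index N (le_trans t0 tt').
have h := eul_en_lip e0 nT; rewrite -e' -/(gal N t') -/(gal N t) in h.
apply: le_trans h _; rewrite ler_wpM2r ?(ltW rate_gt0)//.
by move: hm; rewrite ler_norml => /andP[]; lra.
Qed.

End EulerScheme.

(** * Fourier series *)

Section CircleIntegral.
Variable R : realType.
Local Notation C := R[i].
Local Notation nc := (@ComplexField.Normc.normc R).
Local Notation Re := (@complex.Re R).
Local Notation Im := (@complex.Im R).
Local Notation mu := (@lebesgue_measure R).
Local Notation I := (`[0, 2 * pi]%classic : set (measurableTypeR R)).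
Local Notation J f := (\int[mu]_(x in I) f x).
Implicit Types (f g : R -> R) (h : R -> C) (k : int).

Lemma pi2_gt0 : 0 < 2 * pi :> R. Proof. by rewrite mulr_gt0 ?pi_gt0. Qed.

Lemma mI : measurable I. Proof. exact: measurable_itv. Qed.

Lemma muI : mu I = (2 * pi)%:E.
Proof. by rewrite lebesgue_measure_itv/= lte_fin pi2_gt0 -EFinB subr0. Qed.

Definition intg f := mu.-integrable I (EFin \o f).

Lemma intg_measurable f : intg f -> measurable_fun I f.
Proof. by move=> /integrableP[/measurable_EFinP]. Qed.

Lemma intgD f g : intg f -> intg g -> intg (fun x => f x + g x).
Proof. by move=> hf hg; have := integrableD mI hf hg. Qed.

Lemma intgZ (r : R) f : intg f -> intg (fun x => r * f x).
Proof. by move=> hf; have := integrableZl mI r hf. Qed.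

Lemma intgN f : intg f -> intg (fun x => - f x).
Proof.
by move=> /(intgZ (-1)); rewrite (_ : (fun x => -1 * f x) = (fun x => - f x))//; apply/funext => x; rewrite mulN1r.
Qed.

Lemma intgB f g : intg f -> intg g -> intg (fun x => f x - g x).
Proof. by move=> hf /intgN; exact: intgD. Qed.

Lemma intg_bounded f (B : R) : measurable_fun I f -> (forall x, I x -> `|f x| <= B) -> intg f.
Proof.
move=> mf fB; apply: (measurable_bounded_integrable mI _ mf).
  by change (mu I < +oo)%E; rewrite muI ltry.
exists B; split; rewrite ?num_real// => z Bz x Ix.
by apply: le_trans (fB x Ix) _; exact: ltW.
Qed.

Lemma intgMl f g (B : R) : intg f -> measurable_fun I g -> (forall x, I x -> `|g x| <= B) ->
  intg (fun x => f x * g x).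
Proof.
move=> hf mg gB.
have gb : [bounded g x | x in I].
  exists B; split; rewrite ?num_real// => z Bz x Ix.
  by apply: le_trans (gB x Ix) _; exact: ltW.
exact: (integrableMl mI hf mg gb).
Qed.

Lemma measurable_continuous g : continuous g -> measurable_fun I g.
Proof. by move=> cg; apply: measurable_funTS; exact: continuous_measurable_fun. Qed.

Lemma intg_continuous g : {within I, continuous g} -> intg g.
Proof.
move=> cg; apply: continuous_compact_integrable => //.
exact: segment_compact.
Qed.

Lemma continuous_within_bounded g : {within I, continuous g} ->
  exists B, forall x, I x -> `|g x| <= B.
Proof.
move=> cg; have := compact_bounded (continuous_compact cg (@segment_compact R 0 (2 * pi))).
move=> [B [_ hB]]; exists (B + 1) => x Ix; apply: hB; first by rewrite ltrDl.
by exists x.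
Qed.

Lemma Rint_le f (e : R) : intg f -> (forall x, I x -> `|f x| <= e) -> `|J f| <= 2 * pi * e.
Proof.
move=> hf fe; apply: le_trans (le_normr_Rintegral mI hf) _.
have -> : 2 * pi * e = J (fun=> e).
  by rewrite (Rintegral_cst _ mI); change (2 * pi * e = e * fine (mu I)); rewrite muI mulrC.
apply: (le_Rintegral mI) => //; first exact: (integrable_norm hf).
by apply: (@intg_bounded _ `|e|).
Qed.

Definition cint h := intg (Re \o h) /\ intg (Im \o h).

Definition cJ h : C := cRintegral I h.

Lemma cintD h h' : cint h -> cint h' -> cint (fun x => h x + h' x).
Proof.
move=> [h1 h2] [h1' h2']; split.
  rewrite (_ : _ \o _ = fun x => Re (h x) + Re (h' x)); first exact: intgD.
  by apply/funext => x /=; case: (h x) (h' x) => ? ? [].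
rewrite (_ : _ \o _ = fun x => Im (h x) + Im (h' x)); first exact: intgD.
by apply/funext => x /=; case: (h x) (h' x) => ? ? [].
Qed.

Lemma cJD h h' : cint h -> cint h' -> cJ (fun x => h x + h' x) = cJ h + cJ h'.
Proof.
move=> [h1 h2] [h1' h2']; rewrite /cJ /cRintegral; simpc; congr Complex.
  by rewrite -(RintegralD mI h1 h1'); apply: eq_Rintegral => x _ /=; case: (h x) (h' x) => ? ? [].
by rewrite -(RintegralD mI h2 h2'); apply: eq_Rintegral => x _ /=; case: (h x) (h' x) => ? ? [].
Qed.

Lemma cintZ (z : C) h : cint h -> cint (fun x => z * h x).
Proof.
move=> [h1 h2]; split.
  rewrite (_ : _ \o _ = fun x => Re z * Re (h x) - Im z * Im (h x)).
    by apply: intgB; exact: intgZ.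
  by apply/funext => x /=; case: (h x) z => ? ? [].
rewrite (_ : _ \o _ = fun x => Re z * Im (h x) + Im z * Re (h x)).
  by apply: intgD; exact: intgZ.
by apply/funext => x /=; case: (h x) z => ? ? [].
Qed.

Lemma cJZ (z : C) h : cint h -> cJ (fun x => z * h x) = z * cJ h.
Proof.
move=> [h1 h2]; rewrite /cJ /cRintegral; case: z => u v; simpc; congr Complex.
  rewrite -(RintegralZl u mI h1) -(RintegralZl v mI h2).
  rewrite -(RintegralB mI (intgZ u h1) (intgZ v h2)).
  by apply: eq_Rintegral => x _ /=; case: (h x).
rewrite -(RintegralZl v mI h1) -(RintegralZl u mI h2).
rewrite -(RintegralD mI (intgZ u h2) (intgZ v h1)).
by apply: eq_Rintegral => x _ /=; case: (h x).
Qed.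

Lemma cint0 : cint (fun=> 0).
Proof. have i0 : intg (fun=> 0).
  by apply: (@intg_bounded _ 0) => [|x _]; [exact: measurable_cst|rewrite normr0].
by split. Qed.

Lemma cJ0 : cJ (fun=> 0) = 0.
Proof. by rewrite /cJ /cRintegral /= (Rintegral_cst _ mI) mul0r. Qed.

Lemma cint_sum (T : Type) (r : seq T) (z : T -> C) (h : T -> R -> C) :
  (forall j, cint (h j)) -> cint (fun x => \sum_(j <- r) z j * h j x).
Proof.
move=> hi; elim: r => [|j r IH].
  rewrite (_ : (fun x => _) = fun=> 0); first exact: cint0.
  by apply/funext => x; rewrite big_nil.
rewrite (_ : (fun x => _) = fun x => z j * h j x + \sum_(j <- r) z j * h j x).
  by apply: cintD => //; exact: cintZ.
by apply/funext => x; rewrite big_cons.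
Qed.

Lemma cJ_sum (T : Type) (r : seq T) (z : T -> C) (h : T -> R -> C) :
  (forall j, cint (h j)) ->
  cJ (fun x => \sum_(j <- r) z j * h j x) = \sum_(j <- r) z j * cJ (h j).
Proof.
move=> hi; elim: r => [|j r IH].
  rewrite (_ : (fun x => _) = fun=> 0) ?cJ0 ?big_nil//.
  by apply/funext => x; rewrite big_nil.
rewrite (_ : (fun x => _) = fun x => z j * h j x + \sum_(j <- r) z j * h j x); last first.
  by apply/funext => x; rewrite big_cons.
by rewrite cJD ?cJZ ?IH ?big_cons//; [exact: cintZ|exact: cint_sum].
Qed.

Lemma cexpD (x y : R) : cexp (x + y) = cexp x * cexp y.
Proof. by rewrite /cexp cosD sinD; simpc; congr Complex; rewrite addrC. Qed.

Lemma cexpN (x : R) : cexp (- x) = (cexp x)^*%C.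
Proof. by rewrite /cexp cosN sinN. Qed.

Lemma cexp0 : cexp 0 = 1 :> C.
Proof. by rewrite /cexp cos0 sin0. Qed.

Lemma nc_cexp (x : R) : nc (cexp x) = 1.
Proof. by rewrite /= cos2Dsin2 sqrtr1. Qed.

Lemma cexp_int2pi k : cexp (k%:~R * (2 * pi)) = 1 :> C.
Proof.
have nat_case (n : nat) : cexp (n%:R * (2 * pi)) = 1 :> C.
  elim: n => [|n IH]; first by rewrite mul0r cexp0.
  rewrite -natr1 mulrDl cexpD IH mul1r mul1r /cexp.
  by rewrite mulr_natl cos2pi sin2pi.
case: k => n; first exact: nat_case.
by rewrite NegzE intrN mulNr cexpN (nat_case n.+1) conjc1.
Qed.

Lemma continuous_cos_lin k : continuous (fun x : R => cos (k%:~R * x)).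
Proof. by move=> x; apply: continuous_comp; [exact: mulrl_continuous|exact: continuous_cos]. Qed.

Lemma continuous_sin_lin k : continuous (fun x : R => sin (k%:~R * x)).
Proof. by move=> x; apply: continuous_comp; [exact: mulrl_continuous|exact: continuous_sin]. Qed.

Lemma derivable_LRcontinuous f (u v : R) : (forall x, derivable f x 1) ->
  derivable_oo_LRcontinuous f u v.
Proof.
move=> df; have cf x : {for x, continuous f}.
  by apply: differentiable_continuous; exact/derivable1_diffP.
by split=> [x _||]; [exact: df|exact: cvg_at_right_filter (cf u)|exact: cvg_at_left_filter (cf v)].
Qed.

Lemma cint_cexp k : cint (fun x => cexp (k%:~R * x)).
Proof.
split; apply: intg_continuous; apply: continuous_subspaceT.
  exact: continuous_cos_lin.
exact: continuous_sin_lin.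
Qed.

Lemma cJ_cexp k : cJ (fun x => cexp (k%:~R * x)) = if k == 0 then (2 * pi)%:C%C else 0.
Proof.
rewrite /cJ /cRintegral; case: eqVneq => [->|k0].
  congr Complex.
    under eq_Rintegral do rewrite mulr0z mul0r cexp0.
    by rewrite (Rintegral_cst _ mI); change (1 * fine (mu I) = 2 * pi); rewrite muI mul1r.
  under eq_Rintegral do rewrite mulr0z mul0r cexp0.
  by rewrite (Rintegral_cst _ mI) mul0r.
have kR : (k%:~R : R) != 0 by rewrite intr_eq0.
have e2 := cexp_int2pi k; case: e2 => c2 s2.
have lin (x : R) : is_derive x 1 (fun y => k%:~R * y) k%:~R.
  rewrite (_ : (fun y => _) = (k%:~R : R) \*: (id : R -> R))//.
  by apply: is_derive_eq; rewrite /GRing.scale/= mulr1.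
congr Complex.
- have dF (x : R) : is_derive x 1 (fun y => (k%:~R)^-1 * sin (k%:~R * y)) (cos (k%:~R * x)).
    have d := is_derive1_comp (is_derive_sin (k%:~R * x)) (lin x).
    have dd := @is_deriveZ _ _ _ _ (k%:~R)^-1 x 1 _ d.
    by apply: (is_derive_eq dd); rewrite /GRing.scale/= mulrCA mulVf ?mulr1.
  rewrite /Rintegral (@continuous_FTC2 _ _ (fun y => (k%:~R)^-1 * sin (k%:~R * y)) _ _ pi2_gt0).
  + by rewrite s2 mulr0 mulr0 sin0 mulr0 -EFinB subrr.
  + by apply: continuous_subspaceT; exact: continuous_cos_lin.
  + by apply: derivable_LRcontinuous => x; exact: ex_derive.
  + by move=> x _; rewrite derive1E; apply: derive_val.
- have dF (x : R) : is_derive x 1 (fun y => - (k%:~R)^-1 * cos (k%:~R * y)) (sin (k%:~R * x)).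
    have d := is_derive1_comp (is_derive_cos (k%:~R * x)) (lin x).
    have dd := @is_deriveZ _ _ _ _ (- (k%:~R)^-1) x 1 _ d; apply: (is_derive_eq dd).
    by rewrite /GRing.scale/= mulrC mulrN -mulrA mulfV ?mulr1 ?opprK.
  rewrite /Rintegral (@continuous_FTC2 _ _ (fun y => - (k%:~R)^-1 * cos (k%:~R * y)) _ _ pi2_gt0).
  + by rewrite c2 mulr0 cos0 -EFinB subrr.
  + by apply: continuous_subspaceT; exact: continuous_sin_lin.
  + by apply: derivable_LRcontinuous => x; exact: ex_derive.
  + by move=> x _; rewrite derive1E; apply: derive_val.
Qed.

Lemma intg_cos f k : intg f -> intg (fun x => f x * cos (k%:~R * x)).
Proof.
move=> hf; apply: (@intgMl _ _ 1) => //; first exact: measurable_continuous (@continuous_cos_lin k).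
by move=> x _; rewrite ler_norml cos_geN1 cos_le1.
Qed.

Lemma intg_sin f k : intg f -> intg (fun x => f x * sin (k%:~R * x)).
Proof.
move=> hf; apply: (@intgMl _ _ 1) => //; first exact: measurable_continuous (@continuous_sin_lin k).
by move=> x _; rewrite ler_norml sin_geN1 sin_le1.
Qed.

Lemma cint_fourier f k : intg f -> cint (fun x => (f x)%:C%C * cexp (- (k%:~R * x))).
Proof.
move=> hf; split.
  rewrite (_ : _ \o _ = fun x => f x * cos (k%:~R * x)); first exact: intg_cos.
  by apply/funext => x /=; rewrite cosN mul0r subr0.
rewrite (_ : _ \o _ = fun x => - (f x * sin (k%:~R * x))); first by apply: intgN; exact: intg_sin.
by apply/funext => x /=; rewrite sinN mul0r addr0 mulrN.
Qed.

Lemma fourierE f k : intg f -> fourier f k =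
  ((2 * pi)^-1)%:C%C * (J (fun x => f x * cos (k%:~R * x)) +i*
   - J (fun x => f x * sin (k%:~R * x)))%C.
Proof.
move=> hf; rewrite /fourier /cRintegral; congr (_ * _); congr Complex.
  by apply: eq_Rintegral => x _; rewrite /= cosN mul0r subr0.
have := RintegralZl (-1) mI (intg_sin k hf); rewrite mulN1r => <-.
by apply: eq_Rintegral => x _; rewrite /= sinN mul0r addr0 mulrN mulN1r.
Qed.

Lemma fourierD f g k : intg f -> intg g ->
  fourier (fun x => f x + g x) k = fourier f k + fourier g k.
Proof.
move=> hf hg; rewrite /fourier -mulrDr; congr (_ * _).
rewrite -[RHS](cJD (cint_fourier k hf) (cint_fourier k hg)); congr cRintegral.
by apply/funext => x; rewrite rcD mulrDl.
Qed.

Lemma fourierZ (r : R) f k : intg f -> fourier (fun x => r * f x) k = r%:C%C * fourier f k.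
Proof.
move=> hf; rewrite /fourier mulrCA; congr (_ * _).
rewrite -[RHS](cJZ _ (cint_fourier k hf)); congr cRintegral.
by apply/funext => x; rewrite rcM mulrA.
Qed.

Lemma fourierB f g k : intg f -> intg g ->
  fourier (fun x => f x - g x) k = fourier f k - fourier g k.
Proof.
move=> hf hg; rewrite -[- fourier g k]mulN1r (_ : -1 = (-1 : R)%:C%C); last by simpc.
rewrite -fourierZ// -fourierD//; last exact: intgZ.
by rewrite (_ : (fun x => f x + -1 * g x) = (fun x => f x - g x))//; apply/funext => x; rewrite mulN1r.
Qed.

Lemma fourier_csym f : intg f -> csym (fourier f).
Proof.
move=> hf k; rewrite !fourierE// conjM conjc_real; congr (_ * _) => /=; congr Complex.
  by apply: eq_Rintegral => x _; rewrite intrN mulNr cosN.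
congr (- _); have := RintegralZl (-1) mI (intg_sin k hf); rewrite mulN1r => <-.
by apply: eq_Rintegral => x _; rewrite intrN mulNr sinN; ring.
Qed.

(** The real and imaginary parts are bounded separately, whence the 2. *)
Lemma fourier_dist f g k (e : R) : intg f -> intg g ->
  (forall x, I x -> `|f x - g x| <= e) -> nc (fourier f k - fourier g k) <= 2 * e.
Proof.
move=> hf hg fg; rewrite -fourierB//.
have hfg := intgB hf hg; rewrite (fourierE _ hfg) ncM nc_real.
have p0 := pi2_gt0; rewrite (ger0_norm (_ : 0 <= (2 * pi)^-1)); last by rewrite invr_ge0 ltW.
rewrite [leLHS]mulrC ler_pdivrMr//.
apply: le_trans (nc_leReIm _) _; rewrite /= normrN.
have h1 : `|J (fun x => (f x - g x) * cos (k%:~R * x))| <= 2 * pi * e.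
  apply: Rint_le; first exact: intg_cos.
  move=> x Ix; rewrite normrM -[e]mulr1 ler_pM//; first exact: fg.
  by rewrite ler_norml cos_geN1 cos_le1.
have h2 : `|J (fun x => (f x - g x) * sin (k%:~R * x))| <= 2 * pi * e.
  apply: Rint_le; first exact: intg_sin.
  move=> x Ix; rewrite normrM -[e]mulr1 ler_pM//; first exact: fg.
  by rewrite ler_norml sin_geN1 sin_le1.
by apply: le_trans (lerD h1 h2) _; apply: eq_ler; ring.
Qed.

(** A real trigonometric polynomial as a family of waves in which frequencies may repeat; a product
    is then indexed by pairs, without collecting equal frequencies. *)
Definition trigp (T : Type) (r : seq T) (c : T -> C) (m : T -> int) f :=
  forall x, (f x)%:C%C = \sum_(j <- r) c j * cexp ((m j)%:~R * x).

Lemma trigp_intg T (r : seq T) c m f : trigp r c m f -> intg f.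
Proof.
move=> hf; have [h1 _] : cint (fun x => \sum_(j <- r) c j * cexp ((m j)%:~R * x)).
  by apply: cint_sum => j; exact: cint_cexp.
rewrite (_ : f = Re \o (fun x => \sum_(j <- r) c j * cexp ((m j)%:~R * x)))//.
by apply/funext => x /=; rewrite -hf.
Qed.

Lemma fourier_trigp T (r : seq T) c m f k : trigp r c m f ->
  fourier f k = \sum_(j <- r) if m j == k then c j else 0.
Proof.
move=> hf; rewrite /fourier.
have -> : cRintegral I (fun x => (f x)%:C%C * cexp (- (k%:~R * x))) =
    cJ (fun x => \sum_(j <- r) c j * cexp ((m j - k)%:~R * x)).
  congr cRintegral; apply/funext => x; rewrite hf mulr_suml; apply: eq_bigr => j _.
  by rewrite -mulrA -cexpD rmorphB/= mulrBl.
rewrite (@cJ_sum _ r c (fun j x => cexp ((m j - k)%:~R * x))); last by move=> j; exact: cint_cexp.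
rewrite mulr_sumr; apply: eq_bigr => j _; rewrite cJ_cexp subr_eq0.
case: eqP => _; last by rewrite !mulr0.
by rewrite mulrCA -rcM mulVf ?mulr1// gt_eqF// pi2_gt0.
Qed.

End CircleIntegral.
#[global] Arguments mI {R}.

(** * A periodic integrable function with zero coefficients vanishes almost everywhere *)

Section FourierUniqueness.
Variable R : realType.
Local Notation C := R[i].
Local Notation mu := (@lebesgue_measure R).
Local Notation I := (`[0, 2 * pi]%classic : set (measurableTypeR R)).
Local Notation J f := (\int[mu]_(x in I) f x).
Implicit Types (f g h : R -> R) (k : int).

Definition trig_poly h := exists r : seq (C * int), trigp r fst snd h.

Lemma trig_poly_cst (z : R) : trig_poly (fun=> z).
Proof. by exists [:: (z%:C%C, 0)] => x; rewrite big_seq1/= mul0r cexp0 mulr1. Qed.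

Lemma trig_polyD g h : trig_poly g -> trig_poly h -> trig_poly (fun x => g x + h x).
Proof. by move=> [r hr] [r' hr']; exists (r ++ r') => x; rewrite big_cat/= rcD hr hr'. Qed.

Lemma trig_polyM g h : trig_poly g -> trig_poly h -> trig_poly (fun x => g x * h x).
Proof.
move=> [r hr] [r' hr']; exists [seq (u.1 * v.1, u.2 + v.2) | u <- r, v <- r'] => x.
rewrite big_allpairs_dep/= rcM hr hr' big_distrlr/=; apply: eq_bigr => u _; apply: eq_bigr => v _.
by rewrite rmorphD mulrDl cexpD; ring.
Qed.

Lemma trig_polyX h n : trig_poly h -> trig_poly (fun x => h x ^+ n).
Proof.
move=> hh; elim: n => [|n IH]; first exact: trig_poly_cst.
rewrite (_ : (fun x => _) = fun x => h x * h x ^+ n); first exact: trig_polyM.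
by apply/funext => x; rewrite exprS.
Qed.

Lemma trig_poly_cos (c : R) : trig_poly (fun x => cos (x - c)).
Proof.
exists [:: ((2^-1)%:C%C * cexp (- c), 1); ((2^-1)%:C%C * cexp c, -1)] => x.
rewrite !big_cons big_nil addr0/= mulr1z mul1r mulrN1z mulN1r -!mulrA -!cexpD.
rewrite [- c + x]addrC -(opprB x c) cexpN -mulrDr /cexp.
apply/eqP; rewrite eq_complex; apply/andP; split; apply/eqP => /=; by field.
Qed.

Lemma trig_poly_orth f h : intg f -> (forall k, fourier f k = 0) -> trig_poly h ->
  J (fun x => f x * h x) = 0.
Proof.
move=> hf f0 [r hr].
have hi (j : C * int) : cint (fun x => (f x)%:C%C * cexp (j.2%:~R * x)).
  have := cint_fourier (- j.2) hf.
  by under eq_fun do rewrite intrN mulNr opprK.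
have : cJ (fun x => \sum_(j <- r) j.1 * ((f x)%:C%C * cexp (j.2%:~R * x))) = 0.
  rewrite (@cJ_sum _ _ r fst (fun j x => (f x)%:C%C * cexp (j.2%:~R * x)))// big1// => j _.
  have := f0 (- j.2); rewrite /fourier => /eqP; rewrite mulf_eq0 => /orP[/eqP|/eqP].
    by move/complexI/eqP; rewrite invr_eq0 gt_eqF// pi2_gt0.
  rewrite (_ : (fun x => _) = fun x => (f x)%:C%C * cexp (j.2%:~R * x)); last first.
    by apply/funext => x; rewrite intrN mulNr opprK.
  by rewrite /cJ => ->; rewrite mulr0.
move=> e; transitivity (complex.Re (0 : C)) => //; rewrite -e /cJ /=; apply: eq_Rintegral => x _.
rewrite (_ : \sum_(_ <- _) _ = (f x * h x)%:C%C)//.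
by rewrite rcM hr mulr_sumr; apply: eq_bigr => j _; rewrite mulrCA.
Qed.

Lemma bernoulli (u : R) m : 0 <= u <= 1 -> 1 - m%:R * u <= (1 - u) ^+ m.
Proof.
move=> /andP[u0 u1]; elim: m => [|m IH]; first by rewrite mul0r subr0.
rewrite exprS; apply: (@le_trans _ _ ((1 - u) * (1 - m%:R * u))).
  rewrite -natr1; have : 0 <= m%:R * u ^+ 2 by rewrite mulr_ge0 ?sqr_ge0.
  by rewrite expr2; lra.
by rewrite ler_wpM2l// subr_ge0.
Qed.

Lemma bernoulli_inv (u : R) m : 0 <= u <= 1 -> (1 - u) ^+ m * (1 + m%:R * u) <= 1.
Proof.
move=> /andP[u0 u1]; have u1' : 0 <= 1 - u by rewrite subr_ge0.
have h : 1 + m%:R * u <= (1 + u) ^+ m.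
  elim: m => [|m IH]; first by rewrite mul0r addr0.
  rewrite exprS; apply: (@le_trans _ _ ((1 + u) * (1 + m%:R * u))).
    rewrite -natr1; have : 0 <= m%:R * u ^+ 2 by rewrite mulr_ge0 ?sqr_ge0.
    by rewrite expr2; lra.
  by rewrite ler_wpM2l// addr_ge0.
apply: le_trans (ler_wpM2l (exprn_ge0 m u1') h) _.
rewrite -exprMn (_ : (1 - u) * (1 + u) = 1 - u ^+ 2); last by ring.
by rewrite exprn_ile1// ?gerBl ?sqr_ge0// subr_ge0 exprn_ile1.
Qed.

(* Polynomials approximating the indicator of [y < 1 / q], as in the
   Brosowski-Deutsch proof of the Stone-Weierstrass theorem. *)
Definition step_poly (q n : nat) (y : R) : R := (1 - y ^+ n) ^+ (q ^ n).

Lemma step_poly_itv q n y : 0 <= y <= 1 -> 0 <= step_poly q n y <= 1.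
Proof.
move=> /andP[y0 y1]; have := exprn_ge0 n y0; have := exprn_ile1 n y0 y1 => h1 h0.
by rewrite exprn_ge0 ?subr_ge0//= exprn_ile1 ?subr_ge0// gerBl.
Qed.

(** Bernoulli's inequality bounds the polynomial below by 1 - (q y)^n. *)
Lemma step_poly_lt q y : 0 <= y -> q%:R * y < 1 -> y <= 1 ->
  step_poly q n y @[n --> \oo] --> (1 : R).
Proof.
move=> y0 qy y1.
have c : (q%:R * y) ^+ n @[n --> \oo] --> (0 : R).
  by apply: cvg_expr; rewrite ger0_norm// mulr_ge0.
apply: (@squeeze_cvgr _ _ _ _ (fun n => 1 - (q%:R * y) ^+ n) (fun=> 1)).
- near=> n; have /andP[_ ->] := @step_poly_itv q n y (introT andP (conj y0 y1)).
  rewrite andbT exprMn -natrX; apply: bernoulli.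
  by rewrite exprn_ge0// exprn_ile1.
- by rewrite -[X in _ --> X]subr0; apply: cvgB => //; exact: cvg_cst.
- exact: cvg_cst.
Unshelve. all: by end_near. Qed.

(** The inverse form of Bernoulli's inequality bounds the polynomial above by (q y)^(-n). *)
Lemma step_poly_gt q y : 1 < q%:R * y -> 0 <= y <= 1 ->
  step_poly q n y @[n --> \oo] --> (0 : R).
Proof.
move=> qy y01; have /andP[y0 y1] := y01.
have qy0 : 0 < q%:R * y by apply: lt_trans qy.
have c : ((q%:R * y)^-1) ^+ n @[n --> \oo] --> (0 : R).
  by apply: cvg_expr; rewrite ger0_norm ?invr_ge0 ?(ltW qy0)// invf_lt1.
apply: (@squeeze_cvgr _ _ _ _ (fun=> 0) (fun n => ((q%:R * y)^-1) ^+ n)) => //.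
- near=> n; have /andP[-> _] := step_poly_itv q n y01 => /=.
  have := @bernoulli_inv (y ^+ n) (q ^ n).
  rewrite exprn_ge0// exprn_ile1// => /(_ isT); rewrite natrX -exprMn -/(step_poly q n y) => h.
  have z0 : 0 < (q%:R * y) ^+ n by rewrite exprn_gt0.
  rewrite exprVn -[leRHS]mul1r ler_pdivlMr//; apply: le_trans h.
  have /andP[g0 _] := step_poly_itv q n y01.
  by rewrite ler_wpM2l// lerDr.
- exact: cvg_cst.
Unshelve. all: by end_near. Qed.

(** The arc is a sublevel set of 1 - cos (x - c); the step polynomials are composed with a multiple
    y of this function. The end points of the arc, where q y = 1, are left out. *)
Lemma arc_indicator (c d : R) : 0 < d -> 0 < c - d -> c + d < 2 * pi ->
  exists g : nat -> R -> R,
  [/\ forall n, trig_poly (g n), forall n x, 0 <= g n x <= 1 &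
   forall x, 0 <= x <= 2 * pi -> x != c - d -> x != c + d ->
     g n x @[n --> \oo] --> ((if c - d < x < c + d then 1 else 0) : R)].
Proof.
move=> d0 cd0 cd2; have dpi : d <= pi by lra.
have cosd : cos d < 1.
  by rewrite -cos0 ltr_cos// in_itv/= ?lexx ?pi_ge0// (ltW d0).
have e0 : 0 < 1 - cos d by rewrite subr_gt0.
(* The choice of q and l makes y take its values in [0, 1], with q y < 1 exactly when cos (x - c) >
   cos d. *)
pose q := (Num.truncn (2 / (1 - cos d))).+1.
have q0 : 0 < q%:R :> R by rewrite ltr0n.
have qd : 2 <= q%:R * (1 - cos d).
  by rewrite -ler_pdivrMr// ltW// truncnS_gt.
pose l := (q%:R * (1 - cos d))^-1.
have ld0 : 0 < q%:R * (1 - cos d) by rewrite mulr_gt0.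
have l0 : 0 < l by rewrite invr_gt0.
have l2 : l * 2 <= 1 by rewrite mulrC ler_pdivrMr// mul1r.
pose y x := l * (1 - cos (x - c)).
have y01 x : 0 <= y x <= 1.
  have c1 := cos_le1 (x - c); have c2 := cos_geN1 (x - c).
  rewrite mulr_ge0 ?subr_ge0 ?(ltW l0)//=; apply: le_trans l2.
  by rewrite ler_wpM2l ?(ltW l0)//; lra.
have qy x : q%:R * y x = (1 - cos (x - c)) / (1 - cos d).
  rewrite /y /l invfM mulrA mulrA mulfV ?gt_eqF// mul1r mulrC//.
exists (fun n x => step_poly q n (y x)); split.
- move=> n; rewrite /step_poly.
  apply: (@trig_polyX (fun x => 1 - y x ^+ n)).
  have ty : trig_poly y.
    rewrite (_ : y = fun x => l + (- l) * cos (x - c)); last first.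
      by apply/funext => x; rewrite /y; ring.
    by apply: trig_polyD; [exact: trig_poly_cst|apply: trig_polyM; [exact: trig_poly_cst|exact: trig_poly_cos]].
  rewrite (_ : (fun x => _) = fun x => 1 + -1 * y x ^+ n); last first.
    by apply/funext => x; rewrite mulN1r.
  by apply: trig_polyD; [exact: trig_poly_cst|apply: trig_polyM; [exact: trig_poly_cst|exact: trig_polyX]].
- by move=> n x; exact: step_poly_itv.
- move=> x /andP[x0 x2] xl xr.
  have cosN' : cos (x - c) = cos `|x - c|.
    by case: (ger0P (x - c)) => // _; rewrite cosN.
  have /andP[y0 y1] := y01 x.
  have pi0 := pi_gt0 R.
  case: ifPn => [/andP[h1 h2]|hx].
    apply: step_poly_lt => //; rewrite qy ltr_pdivrMr// mul1r ltrD2l ltrN2 cosN'.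
    have hd : `|x - c| < d by rewrite ltr_norml; apply/andP; split; lra.
    by rewrite ltr_cos// in_itv/= ?normr_ge0 ?(ltW d0)//= ltW// (lt_le_trans hd).
  have hd : d < `|x - c|.
    rewrite ltNge; apply: contra hx; rewrite ler_norml => /andP[h1 h2].
    by rewrite !lt_neqAle xr [_ == x]eq_sym xl/=; apply/andP; split; lra.
  apply: step_poly_gt => //; rewrite qy ltr_pdivlMr// mul1r ltrD2l ltrN2 cosN'.
  have hd2 : `|x - c| < 2 * pi - d by rewrite ltr_norml; apply/andP; split; lra.
  have [hpi|hpi] := leP `|x - c| pi.
    by rewrite ltr_cos// in_itv/= ?normr_ge0 ?(ltW d0).
  (* Beyond the distance pi the angle is folded back to 2 pi - |x - c|, which still exceeds d
     because the arc lies inside ]0, 2 pi[. *)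
  have -> : cos `|x - c| = cos (2 * pi - `|x - c|).
    by rewrite mulr_natl cosB cos2pi sin2pi mul1r mul0r addr0.
  rewrite ltr_cos ?in_itv/=; first lra.
  - by apply/andP; split; lra.
  - by apply/andP; split; lra.
Qed.

(** Dominated convergence along [arc_indicator], with |f| as the bound; the points a and b form a
    negligible set. *)
Lemma orth_itv f (a b : R) : intg f -> (forall k, fourier f k = 0) ->
  0 < a -> a < b -> b < 2 * pi -> J (fun x => f x * \1_(`]a, b[%classic) x) = 0.
Proof.
move=> hf f0 a0 ab b2; pose c := (a + b) / 2; pose d := (b - a) / 2.
have ca : c - d = a by rewrite /c /d; field.
have cb : c + d = b by rewrite /c /d; field.
have d0 : 0 < d by rewrite divr_gt0// subr_gt0.
have [g [tg g01 gc]] : exists g : nat -> R -> R,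
  [/\ forall n, trig_poly (g n), forall n x, 0 <= g n x <= 1 &
   forall x, 0 <= x <= 2 * pi -> x != a -> x != b ->
     g n x @[n --> \oo] --> ((if a < x < b then 1 else 0) : R)].
  by have := @arc_indicator c d d0; rewrite ca cb => /(_ a0 b2).
have mf := intg_measurable hf.
have gi n : intg (g n) by have [r hr] := tg n; exact: trigp_intg hr.
have gb n x : `|g n x| <= 1 by have /andP[g0 g1] := g01 n x; rewrite ger0_norm.
have fgi n : intg (fun x => f x * g n x).
  by apply: (@intgMl _ _ _ 1 hf) => // ; exact: intg_measurable.
have m1 : measurable_fun I (\1_(`]a, b[%classic) : R -> R).
  by apply: measurable_funTS; apply: measurable_indic; exact: measurable_itv.
have f1i : intg (fun x => f x * \1_(`]a, b[%classic) x).
  apply: (@intgMl _ _ _ 1 hf) => // x _.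
  by rewrite indicE; case: (_ \in _); rewrite ?normr1 ?normr0.
have [||||| _ _ ] := @dominated_convergence _ _ R mu I mI (fun n x => (f x * g n x)%:E)
  (fun x => (f x * \1_(`]a, b[%classic) x)%:E) (fun x => `|f x|%:E).
- by move=> n; apply/measurable_EFinP; exact: intg_measurable.
- by apply/measurable_EFinP; exact: intg_measurable.
- have ng z : mu.-negligible ([set z] : set (measurableTypeR R)).
    by exists [set z]; split; [exact: measurable_set1|exact: lebesgue_measure_set1|].
  apply: negligibleS (negligibleU (ng a) (ng b)).
  + move=> x /= hx; apply: contrapT => /not_orP[/eqP xa /eqP xb]; apply: hx => Ix.
    apply: cvg_EFin; first by near=> n.
    have h : f x * g n x @[n --> \oo] --> f x * ((if a < x < b then 1 else 0) : R).
      apply: cvgM; first exact: cvg_cst.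
      by apply: gc => //; move: Ix; rewrite /= in_itv.
    rewrite indicE (_ : (x \in _) = (a < x < b)); last by apply/idP/idP; rewrite inE/= in_itv/=.
    by case: ifP h => _ h; exact: h.
- exact: (integrable_norm hf).
- by apply/aeW => x n _; rewrite lee_fin normrM ler_piMr.
move=> hc; rewrite /Rintegral.
rewrite (_ : (\int[mu]_(x in I) _)%E = 0%E)//.
apply/esym; apply: (cvg_unique _ _ hc); first exact: ereal_hausdorff.
rewrite (_ : [sequence _]_n = cst 0%E); first exact: cvg_cst.
apply/funext => n /=; have := trig_poly_orth hf f0 (tg n); rewrite /Rintegral => e.
by rewrite -[LHS]fineK ?e//; exact: (integrable_fin_num mI (fgi n)).
Unshelve. all: by end_near. Qed.

(** The image of Lebesgue measure by a translation gives intervals their length, and a measure with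
    this property is unique. *)
Lemma shift_measure (c : R) (A : set (measurableTypeR R)) : measurable A ->
  mu ((fun x => x + c) @^-1` A) = mu A.
Proof.
move=> mA; have mc : measurable_fun setT ((fun x => x + c) : measurableTypeR R -> measurableTypeR R).
  by apply: continuous_measurable_fun => x; apply: cvgD; [exact: cvg_id|exact: cvg_cst].
have := @lebesgue_measure_unique R (measure_function_pushforward__canonical__measure_function_Measure mu mc).
move=> /(_ _ _ mA) h; apply/esym; apply: h => _ [[u v] _ <-] /=.
rewrite /pushforward (_ : _ @^-1` _ = `]u - c, v - c]%classic); last first.
  by apply/seteqP; split=> x /=; rewrite !in_itv/= => /andP[h1 h2]; apply/andP; split; lra.
by rewrite !lebesgue_measure_itv/= !lte_fin ltrD2r -!EFinB (_ : v - c - (u - c) = v - u)//; ring.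
Qed.

Lemma negligible_shift (c : R) (A : set (measurableTypeR R)) :
  mu.-negligible A -> mu.-negligible ((fun x => x + c) @^-1` A).
Proof.
move=> [B [mB B0 AB]]; exists ((fun x => x + c) @^-1` B); split.
- have mc : measurable_fun setT ((fun x => x + c) : measurableTypeR R -> measurableTypeR R).
    by apply: continuous_measurable_fun => x; apply: cvgD; [exact: cvg_id|exact: cvg_cst].
  by rewrite -[X in measurable X]setTI; exact: mc.
- by rewrite -B0; exact: shift_measure.
- by move=> x; exact: AB.
Qed.

Lemma periodic_int f k x : periodic f (2 * pi) -> f (x + k%:~R * (2 * pi)) = f x.
Proof.
move=> pf; case: k => n.
  have -> : (n : int)%:~R * (2 * pi) = (2 * pi) *+ n :> R by rewrite -[RHS]mulr_natl.
  exact: periodicn.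
rewrite NegzE intrN mulNr.
have := periodicn pf n.+1 (x - n.+1%:R * (2 * pi)).
by rewrite -[2 * pi *+ n.+1]mulr_natl -[n.+1%:~R]/(n.+1%:R : R) subrK => ->.
Qed.

(** The exceptional set is covered by countably many translates of its part in one period, the end
    point 0 being added to that part. *)
Lemma ae_periodic f : periodic f (2 * pi) ->
  {ae mu, forall x, 0 < x < 2 * pi -> f x = 0} -> {ae mu, forall x, f x = 0}.
Proof.
move=> pf ae0.
pose N0 : set (measurableTypeR R) := [set x | ~ (0 < x < 2 * pi -> f x = 0)] `|` [set 0].
have nN0 : mu.-negligible N0.
  apply: negligibleU; first exact: ae0.
  by exists [set 0]; split; [exact: measurable_set1|exact: lebesgue_measure_set1|].
have nN k : mu.-negligible ((fun x => x + k%:~R * (2 * pi)) @^-1` N0).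
  exact: negligible_shift.
have := @negligible_bigcup _ _ _ mu (fun n : nat =>
   ((fun x => x + (n%:Z)%:~R * (2 * pi)) @^-1` N0) `|` ((fun x => x + (- n%:Z)%:~R * (2 * pi)) @^-1` N0)).
move=> /(_ (fun n => negligibleU (nN n) (nN (- n%:Z)))); apply: negligibleS => x /= fx.
have p0 := pi2_gt0 R.
pose m := Num.floor (x / (2 * pi)).
have /andP[m1 m2] := floor_itv (x / (2 * pi)).
have y0 : 0 <= x + (- m)%:~R * (2 * pi).
  by rewrite intrN mulNr subr_ge0 -ler_pdivlMr.
have y2 : x + (- m)%:~R * (2 * pi) < 2 * pi.
  by move: m2; rewrite ltr_pdivrMr// intrD mulrDl mul1r intrN mulNr; lra.
have N0y : N0 (x + (- m)%:~R * (2 * pi)).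
  move: y0; rewrite le_eqVlt => /predU1P[<-|y0]; first by right.
  by left => /= h; apply: fx; rewrite -(periodic_int (- m) x pf) h// y0.
exists (absz m) => //; have [m0|m0] := leP 0 m.
  by right; rewrite /= gez0_abs.
by left; rewrite /= ltz0_abs.
Qed.

(* The integral of f over any arc is a limit of integrals of f against
   trigonometric polynomials, so the primitive of f is constant. *)
Lemma fourier_eq0 f : periodic f (2 * pi) -> intg f -> (forall k, fourier f k = 0) ->
  {ae mu, forall x, f x = 0}.
Proof.
move=> pf hf f0; apply: ae_periodic => //.
(* The extension by 0 is integrable on the line, so its primitive can start at -oo. *)
pose g := f \_ I.
have gi : mu.-integrable setT (EFin \o g).
  by rewrite /g -restrict_EFin -integrable_mkcond//; exact: mI.
have giy (y : R) : mu.-integrable `]-oo, y] (EFin \o g).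
  by apply: integrableS gi => //; exact: measurable_itv.
have lg : locally_integrable [set: R] g by apply: open_integrable_locally => //; exact: openT.
pose F := fun x => \int[mu]_(t in `]-oo, x]) g t.
have Fc (a b : R) : 0 < a -> a < b -> b < 2 * pi -> F b = F a.
  move=> a0 ab b2; apply/eqP; rewrite -subr_eq0 /F.
  rewrite (@Rintegral_itvB _ g -oo%O (BRight b) a (giy b))//; last by rewrite bnd_simp ltW.
  rewrite -Rintegral_itv_bndo_bndc; last first.
    by apply: (integrableS measurableT _ _ gi) => //; exact: measurable_itv.
  rewrite -(orth_itv hf f0 a0 ab b2) Rintegral_mkcond [X in _ == X]Rintegral_mkcond.
  apply/eqP; congr Rintegral; apply/funext => x; rewrite /g !patchE indicE.
  case: ifPn => [xab|]; last by rewrite mulr0; case: ifP.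
  by rewrite mulr1.
have := FTC1Ny giy lg; apply: filterS; first exact: (ae_filter_ringOfSetsType mu).
move=> x [_ dF] /andP[x0 x2].
have gx : g x = f x by rewrite /g patchE mem_set//= in_itv/= !ltW.
rewrite -gx -dF derive1E -[RHS](@derive_cst R R R (F x) x 1).
apply: (@near_eq_derive R R R).
near=> y; have y0 : 0 < y by near: y; exact: lt_nbhsr.
have y2 : y < 2 * pi by near: y; exact: lt_nbhsl.
by have [xy|yx|->] := ltgtP x y; [exact: Fc|apply/esym; exact: Fc|].
Unshelve. all: by end_near. Qed.

End FourierUniqueness.

(** * Limits of coefficient sequences *)

Section CoefficientLimits.
Variable R : realType.
Local Notation C := R[i].
Local Notation nc := (@ComplexField.Normc.normc R).
Local Notation Re := (@complex.Re R).
Implicit Types (a b : int -> C) (d : nat -> R).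

(* Convergence of complex numbers along a filter, stated with the modulus
   because [R[i]] carries no topology here. *)
Definition ccvg (T : Type) (F : set_system T) (u : T -> C) (l : C) :=
  forall e : R, 0 < e -> \forall n \near F, nc (u n - l) <= e.

(** A modulus of absolute summability: one d shared by a family of sequences makes their Fourier
    series converge uniformly, uniformly in the family. Even at M = 0 the frequency 0 is left out,
    so a 0 enters sup bounds separately. *)
Definition ctail d a :=
  forall M N : nat, \sum_(k <- zs N | (M < `|k|)%N) nc (a k) <= d M.

Section Filter.
Context (T : Type) (F : set_system T).
Context {FF : ProperFilter F}.

Lemma ccvg_cst (l : C) : ccvg F (fun=> l) l.
Proof. by move=> e e0; apply: nearW => n; rewrite subrr nc0 ltW. Qed.

Lemma ccvgD (u v : T -> C) (l m : C) : ccvg F u l -> ccvg F v m ->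
  ccvg F (fun n => u n + v n) (l + m).
Proof.
move=> ul vm e e0; have e2 : 0 < e / 2 by rewrite divr_gt0.
apply: filterS2 (ul _ e2) (vm _ e2) => n h1 h2.
rewrite opprD addrACA; apply: le_trans (nc_leD _ _) _; lra.
Qed.

Lemma ccvgZ (z : C) (u : T -> C) (l : C) : ccvg F u l -> ccvg F (fun n => z * u n) (z * l).
Proof.
move=> ul e e0; have z0 := nc_ge0 z.
have e1 : 0 < e / (nc z + 1) by rewrite divr_gt0// ltr_pwDr.
apply: filterS (ul _ e1) => n h.
rewrite -mulrBr ncM; apply: le_trans (ler_wpM2l z0 h) _.
rewrite mulrCA -[leRHS]mulr1; apply: ler_wpM2l; first exact: ltW.
by rewrite ler_pdivrMr ?mul1r ?lerDl ?ltr_pwDr.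
Qed.

Lemma ccvg_le (u : T -> C) (l : C) (B : R) : ccvg F u l ->
  (\forall n \near F, nc (u n) <= B) -> nc l <= B.
Proof.
move=> ul uB; apply/ler_addgt0Pr => e e0.
have [n [h1 h2]] := filter_ex (filterI (ul _ e0) uB).
rewrite -[l](subrK (u n)) ; apply: le_trans (nc_leD _ _) _.
by rewrite addrC ncB; exact: lerD.
Qed.

Lemma ccvg_unique (u : T -> C) (l m : C) : ccvg F u l -> ccvg F u m -> l = m.
Proof.
move=> ul um; apply/eqP; rewrite -subr_eq0; apply/eqP; apply: nc_eq0; apply/eqP.
rewrite eq_le nc_ge0 andbT; apply/ler_addgt0Pr => e e0; rewrite add0r.
have e2 : 0 < e / 2 by rewrite divr_gt0.
have [n [h1 h2]] := filter_ex (filterI (ul _ e2) (um _ e2)).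
rewrite -[l](subrK (u n)) -addrA; apply: le_trans (nc_leD _ _) _; rewrite ncB; lra.
Qed.

Lemma ccvg_csym (u : T -> int -> C) a : (forall n, csym (u n)) ->
  (forall k, ccvg F (u^~ k) (a k)) -> csym a.
Proof.
move=> cu ua k; apply: (ccvg_unique (ua (- k))) => e e0; apply: filterS (ua k e e0) => n.
by rewrite cu -conjN -conjD nc_conj.
Qed.

Lemma near_sum_small (r : seq int) (u : T -> int -> R) (e : R) :
  (forall k (e : R), 0 < e -> \forall n \near F, u n k <= e) -> 0 < e ->
  \forall n \near F, \sum_(k <- r) u n k <= e.
Proof.
move=> ul; elim: r e => [|k r ih] e e0.
  by apply: nearW => n; rewrite big_nil ltW.
have e2 : 0 < e / 2 by rewrite divr_gt0.
apply: filterS2 (ul k _ e2) (ih _ e2) => n h1 h2; rewrite big_cons; lra.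
Qed.

Lemma ccvg_sum_cvg (r : seq int) (P : pred int) (w : int -> R) (q : nat)
    (u : T -> int -> C) (l : int -> C) : (forall k, ccvg F (u^~ k) (l k)) ->
  \sum_(k <- r | P k) w k * nc (u n k) ^+ q @[n --> F] --> \sum_(k <- r | P k) w k * nc (l k) ^+ q.
Proof.
move=> ul.
have cn k : w k * nc (u n k) ^+ q @[n --> F] --> w k * nc (l k) ^+ q.
  apply: cvgMr; apply: (@cvg_comp _ _ _ (fun n => nc (u n k)) (fun x => x ^+ q) F (nbhs (nc (l k)))); last exact: exprn_continuous.
  apply/cvgrPdist_le => e e0.
  apply: filterS (ul k _ e0) => n; apply: le_trans.
  have h1 := nc_leD (u n k - l k) (l k); have h2 := nc_leD (l k - u n k) (u n k).
  rewrite subrK in h1; rewrite subrK [X in _ <= X + _]ncB in h2.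
  by rewrite ler_norml; apply/andP; split; lra.
elim: r => [|k r ih].
  by under eq_fun do rewrite big_nil; rewrite big_nil; exact: cvg_cst.
under eq_fun do rewrite big_cons; rewrite big_cons; case: ifP => _ //.
by apply: cvgD ih.
Qed.

Lemma ccvg_sum_le (r : seq int) (P : pred int) (w : int -> R) (q : nat)
    (u : T -> int -> C) (l : int -> C) (B : R) :
  (forall k, ccvg F (u^~ k) (l k)) ->
  (\forall n \near F, \sum_(k <- r | P k) w k * nc (u n k) ^+ q <= B) ->
  \sum_(k <- r | P k) w k * nc (l k) ^+ q <= B.
Proof.
move=> ul uB; have cs := ccvg_sum_cvg (r := r) (P := P) (w := w) (q := q) ul.
apply/ler_addgt0Pr => e e0; move/cvgrPdist_le: cs => /(_ e e0) cs.
have [n [h1 h2]] := filter_ex (filterI cs uB).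
by move: h1; rewrite /= ler_norml => /andP[_ h1]; lra.
Qed.

End Filter.

Lemma ccvg_low a k : ccvg \oo (fun n => low n a k) (a k).
Proof.
move=> e e0; near=> n; rewrite /low ifT ?subrr ?nc0 ?ltW//.
by near: n; exact: nbhs_infty_ge.
Unshelve. all: by end_near. Qed.

End CoefficientLimits.

(** * Functions with absolutely summable coefficients *)

Section Synthesis.
Variable R : realType.
Local Notation C := R[i].
Local Notation nc := (@ComplexField.Normc.normc R).
Local Notation Re := (@complex.Re R).
Local Notation mu := (@lebesgue_measure R).
Implicit Types (a b : int -> C) (d : nat -> R).

Definition psum a (N : nat) (x : R) : R :=
  Re (\sum_(k <- zs N) a k * cexp (k%:~R * x)).

(** The sum of the Fourier series as a function defined everywhere. [limn] has an arbitrary value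
    where there is no limit; the definition is meaningful under [ctail] with a modulus tending to
    0. *)
Definition synth a (x : R) : R := limn (fun N => psum a N x).

Lemma psum_tail d a M N x : ctail d a -> (M <= N)%N -> `|psum a N x - psum a M x| <= d M.
Proof.
move=> da MN; rewrite /psum.
have zsC : \sum_(k <- zs N) a k * cexp (k%:~R * x) = \sum_(k <- zs M) a k * cexp (k%:~R * x)
   + \sum_(k <- zs N | (M < `|k|)%N) a k * cexp (k%:~R * x).
  rewrite (bigID (fun k => (`|k| <= M)%N))/=; congr (_ + _); last first.
    by apply: eq_bigl => k; rewrite ltnNge.
  rewrite -big_filter; apply: perm_big; apply: uniq_perm; rewrite ?filter_uniq ?uniq_zs//.
  move=> k; rewrite mem_filter !mem_zs; apply: andb_idr => h; exact: leq_trans h MN.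
rewrite zsC raddfD/= addrC addKr.
apply: le_trans (Re_le_nc _) _; apply: le_trans _ (da M N).
rewrite -!(big_filter (zs N)); apply: le_trans (nc_sum _ _) _; apply: ler_sum => k _.
by rewrite ncM nc_cexp mulr1.
Qed.

Lemma psum_cvg d a x : d @ \oo --> 0 -> ctail d a -> psum a N x @[N --> \oo] --> synth a x.
Proof.
move=> d0 da; apply: cauchy_cvg; apply: cauchy_exP => e e0.
move/cvgrPdist_lt: d0 => /(_ e e0) [M _ dM].
exists (psum a M x); exists M => // n /= Mn.
rewrite /ball/= distrC; apply: le_lt_trans (psum_tail x da Mn) _.
by have := dM M (leqnn M); rewrite /= sub0r normrN; apply: le_lt_trans; exact: ler_norm.
Qed.

Lemma synth_dist d a M x : d @ \oo --> 0 -> ctail d a -> `|synth a x - psum a M x| <= d M.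
Proof.
move=> d0 da; have /cvgrPdist_le h := @psum_cvg d a x d0 da.
apply/ler_addgt0Pr => e e0.
have [n [/= h1 h2]] := filter_ex (filterI (h e e0) (nbhs_infty_ge M)).
have := psum_tail x da h2; move: h1; rewrite !ler_norml => /andP[h1 h3] /andP[h4 h5].
by apply/andP; split; lra.
Qed.

Lemma synth_supp N a x : supp N a -> synth a x = psum a N x.
Proof.
move=> sa; apply: (@cvg_lim R) => //; apply: cvg_near_cst; exists N => // n /= Nn.
rewrite /psum; congr Re; elim: n Nn => [|n ih]; first by rewrite leqn0 => /eqP ->.
rewrite leq_eqVlt => /predU1P[<-//|Nn].
by rewrite (big_zsS _ xpredT) ih// sa ?sa ?abszN// !mul0r !add0r.
Qed.

Lemma psum_periodic a N : periodic (psum a N) (2 * pi).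
Proof.
move=> x; rewrite /psum; congr Re; apply: eq_bigr => k _.
by rewrite mulrDr cexpD cexp_int2pi mulr1.
Qed.

Lemma synth_periodic a : periodic (synth a) (2 * pi).
Proof. by move=> x; rewrite /synth; congr (lim _); under eq_fun do rewrite psum_periodic. Qed.

Lemma psum_trigp a N : csym a -> trigp (zs N) a id (psum a N).
Proof.
move=> ca x; rewrite /psum; set z := \sum_(k <- _) _.
suff : z^*%C = z by case: (z) => u v /= [] /eqP; rewrite eqNr => /eqP ->.
rewrite rmorph_sum/= /z -big_zs_opp; apply: eq_bigr => k _.
by rewrite conjM -cexpN ca conjcK intrN mulNr opprK.
Qed.

Lemma psum_intg a N : csym a -> intg (psum a N).
Proof. by move=> ca; apply: trigp_intg; exact: psum_trigp. Qed.

Lemma psum_continuous a N : continuous (psum a N).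
Proof.
rewrite (_ : psum a N = fun x => \sum_(k <- zs N) (Re (a k) * cos (k%:~R * x) - complex.Im (a k) * sin (k%:~R * x))).
  elim: (zs N) => [|k r ih].
    by under eq_fun do rewrite big_nil; exact: cst_continuous.
  under eq_fun do rewrite big_cons; move=> x; apply: cvgD; last exact: ih.
  by apply: cvgB; apply: cvgMr; [exact: continuous_cos_lin|exact: continuous_sin_lin].
apply/funext => x; rewrite /psum raddf_sum; apply: eq_bigr => k _.
by case: (a k).
Qed.

Lemma psum0_le a x : `|psum a 0 x| <= nc (a 0).
Proof.
apply: le_trans (Re_le_nc _) _; rewrite (_ : \sum_(k <- zs 0) _ = a 0 * cexp 0).
  by rewrite ncM nc_cexp mulr1.
Transparent zs. by rewrite big_cons big_nil mul0r addr0. Opaque zs.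
Qed.

Section Tail.
Variables (d : nat -> R) (a : int -> C).
Hypotheses (d0 : d @ \oo --> 0) (da : ctail d a).

Lemma synth_le x : `|synth a x| <= d 0%N + nc (a 0).
Proof.
have := synth_dist 0 x d0 da; have := psum0_le a x; rewrite !ler_norml => /andP[h1 h2] /andP[h3 h4].
by apply/andP; split; lra.
Qed.

Lemma synth_measurable (D : set (measurableTypeR R)) : measurable D -> measurable_fun D (synth a).
Proof.
move=> mD; apply: (@measurable_fun_cvg _ _ _ _ (fun N x => psum a N x)).
  by move=> N; apply: measurable_funTS; apply: continuous_measurable_fun; exact: psum_continuous.
by move=> x _; exact: psum_cvg d0 da.
Qed.

Lemma synth_intg : intg (synth a).
Proof. apply: (@intg_bounded _ _ (d 0%N + nc (a 0))) => [|x _]; [exact: synth_measurable mI|exact: synth_le]. Qed.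

Lemma synth_periodicL1 : periodicL1 (synth a).
Proof. split; [exact: synth_periodic|exact: synth_intg]. Qed.

Lemma fourier_psum N k : csym a -> (`|k| <= N)%N -> fourier (psum a N) k = a k.
Proof.
move=> ca kN; rewrite (fourier_trigp k (psum_trigp N ca)) -big_mkcond -big_filter.
rewrite (perm_big [:: k]) ?big_seq1//=; apply: uniq_perm; rewrite ?filter_uniq ?uniq_zs//.
by move=> j; rewrite mem_filter mem_seq1 mem_zs; case: eqP => // ->.
Qed.

Lemma fourier_synth k : csym a -> fourier (synth a) k = a k.
Proof.
move=> ca; apply/eqP; rewrite -subr_eq0; apply/eqP; apply: nc_eq0; apply/eqP.
rewrite eq_le nc_ge0 andbT; apply/ler_addgt0Pr => e e0; rewrite add0r.
have e2 : 0 < e / 2 by rewrite divr_gt0.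
move/cvgrPdist_le: d0 => /(_ _ e2) dn.
have [N [/= h1 h2]] := filter_ex (filterI dn (nbhs_infty_ge `|k|)).
rewrite -(fourier_psum ca h2).
apply: le_trans (fourier_dist k synth_intg (psum_intg N ca) (fun x _ => synth_dist N x d0 da)) _.
by move: h1; rewrite sub0r normrN => h1; have := le_trans (ler_norm _) h1; lra.
Qed.

End Tail.

(** The common modulus controls the frequencies above M for all members of the family at once, and
    finitely many coefficients remain. *)
Lemma synth_unif (T : Type) (F : set_system T) (FF : ProperFilter F) d (u : T -> int -> C) a :
  d @ \oo --> 0 -> (forall n, ctail d (u n)) -> ctail d a -> (forall k, ccvg F (u^~ k) (a k)) ->
  forall e : R, 0 < e -> \forall n \near F, forall x, `|synth (u n) x - synth a x| <= e.
Proof.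
move=> d0 du da ua e e0; have e3 : 0 < e / 3 by rewrite divr_gt0.
move/cvgrPdist_le: (d0) => /(_ _ e3) [M _ dM].
have {}dM : d M <= e / 3.
  by have := dM M (leqnn M); rewrite /= sub0r normrN; apply: le_trans; exact: ler_norm.
have := @near_sum_small _ _ F FF (zs M) (fun n k => nc (u n k - a k)) (e / 3) ua e3.
apply: filterS => n h x.
have h0 : `|psum (u n) M x - psum a M x| <= e / 3.
  rewrite /psum -raddfB/= -sumrB; apply: le_trans (Re_le_nc _) _.
  apply: le_trans (nc_sum _ _) _; apply: le_trans h; apply: ler_sum => k _.
  by rewrite -mulrBl ncM nc_cexp mulr1.
have h1 := synth_dist M x d0 (du n); have h2 := synth_dist M x d0 da.
move: h0 h1 h2; rewrite !ler_norml => /andP[? ?] /andP[? ?] /andP[? ?].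
by apply/andP; split; lra.
Qed.

Lemma synth_fourier d f : periodicL1 f -> d @ \oo --> 0 -> ctail d (fourier f) ->
  {ae mu, forall x, f x = synth (fourier f) x}.
Proof.
move=> [pf hf] d0 df; have hs := synth_intg d0 df.
have := @fourier_eq0 R (fun x => f x - synth (fourier f) x).
move=> /(_ _ (intgB hf hs)); case=> [x||A [mA A0 hA]].
- by rewrite pf synth_periodic.
- by move=> k; rewrite fourierB// (fourier_synth d0 df) ?subrr//; exact: fourier_csym.
- by exists A; split => // x h; apply: hA => /= /eqP; rewrite subr_eq0 => /eqP.
Qed.

Lemma fourier_lim (T : Type) (F : set_system T) (FF : ProperFilter F) (g : T -> R -> R) f k :
  (forall n, intg (g n)) -> intg f ->
  (forall e : R, 0 < e -> \forall n \near F, forall x, `|g n x - f x| <= e) ->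
  ccvg F (fun n => fourier (g n) k) (fourier f k).
Proof.
move=> hg hf gf e e0; have e2 : 0 < e / 2 by rewrite divr_gt0.
apply: filterS (gf _ e2) => n h.
by apply: le_trans (fourier_dist k (hg n) hf (fun x _ => h x)) _; lra.
Qed.

End Synthesis.

(** * The flux of a Sobolev function *)

Section TrigonometricProducts.
Variables (R : realType) (p : R).
Hypothesis p_gt0 : 0 < p.
Local Notation C := R[i].
Local Notation nc := (@ComplexField.Normc.normc R).
Local Notation Re := (@complex.Re R).
Implicit Types (f g : R -> R) (d : nat -> R).

(* The weight of the Banach algebra in which the products are estimated. *)
Definition wt (k : int) : R := 1 + wp p k.

Lemma wt_ge1 k : 1 <= wt k. Proof. by rewrite lerDl wp_ge0. Qed.

Lemma wt_ge0 k : 0 <= wt k. Proof. exact: le_trans (wt_ge1 k). Qed.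

Lemma wtD x y : wt (x + y) <= 2 `^ p * (wt x * wt y).
Proof.
have p0 := ltW p_gt0; have := @wp_add R p x y p0.
have := wp_ge0 p x; have := wp_ge0 p y; have : 1 <= 2 `^ p :> R.
  by rewrite -[leLHS](powRr0 2); apply: ler_powR; rewrite ?ler1n.
rewrite /wt; set A := wp p x; set B := wp p y; set D := 2 `^ p => hD hB hA h.
have : 0 <= D * (A * B) by rewrite !mulr_ge0//; lra.
have : D * ((1 + A) * (1 + B)) = D + D * (A + B) + D * (A * B) by ring.
lra.
Qed.

(** D bounds the weighted l^1 norm of a family of waves and d its tails. Tails are tracked along
    with norms because a limit of products needs a modulus common to all truncations. *)
Definition wrep d (D : R) (T : Type) (r : seq T) (c : T -> C) (m : T -> int) :=
  (forall M : nat, \sum_(j <- r | (M < `|m j|)%N) wt (m j) * nc (c j) <= d M) /\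
  \sum_(j <- r) wt (m j) * nc (c j) <= D.

Definition wmul d (D : R) d' (D' : R) (M : nat) : R :=
  2 `^ p * (d M./2 * D' + D * d' M./2).

Lemma wmul_cvg d D d' D' : d @ \oo --> 0 -> d' @ \oo --> 0 -> wmul d D d' D' @ \oo --> 0.
Proof.
move=> hd hd'; have h2 : half @ \oo --> \oo.
  apply/cvgnyPge => A; exists A.*2 => // n /= An.
  by rewrite -[A]doubleK; exact: half_leq.
rewrite -(mulr0 (2 `^ p)); apply: cvgMr.
rewrite -[X in _ --> X]addr0 -[X in _ --> X + _](mul0r D') -[X in _ --> _ + X](mulr0 D).
by apply: cvgD; [apply: cvgMl|apply: cvgMr]; exact: (cvg_comp _ _ h2).
Qed.

(** By [wtD] the weight is submultiplicative up to the factor 2^p. For the tail, a sum of two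
    frequencies above M has one of them above M./2, which explains [wmul]. *)
Lemma wrep_mul d D d' D' (T T' : Type) (r : seq T) (r' : seq T') c c' m m' :
  wrep d D r c m -> wrep d' D' r' c' m' ->
  wrep (wmul d D d' D') (2 `^ p * (D * D')) [seq (i, j) | i <- r, j <- r']
    (fun z => c z.1 * c' z.2) (fun z => m z.1 + m' z.2).
Proof.
move=> [h1 h2] [h1' h2'].
have q0 : 0 <= 2 `^ p :> R by exact: powR_ge0.
have t0 j : 0 <= wt (m j) * nc (c j) by rewrite mulr_ge0 ?wt_ge0 ?nc_ge0.
have t0' j : 0 <= wt (m' j) * nc (c' j) by rewrite mulr_ge0 ?wt_ge0 ?nc_ge0.
have S0 (P : pred T) : 0 <= \sum_(j <- r | P j) wt (m j) * nc (c j) by exact: sumr_ge0.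
have S0' (P : pred T') : 0 <= \sum_(j <- r' | P j) wt (m' j) * nc (c' j) by exact: sumr_ge0.
have b i j : wt (m i + m' j) * nc (c i * c' j) <=
    2 `^ p * ((wt (m i) * nc (c i)) * (wt (m' j) * nc (c' j))).
  rewrite ncM; apply: le_trans (ler_wpM2r _ (wtD _ _)) _; first by rewrite mulr_ge0 ?nc_ge0.
  by apply: eq_ler; ring.
split => [M|]; last first.
  rewrite big_allpairs/=; apply: (@le_trans _ _ (2 `^ p * ((\sum_(j <- r) wt (m j) * nc (c j)) *
     (\sum_(j <- r') wt (m' j) * nc (c' j))))); last first.
    by apply: ler_wpM2l => //; apply: ler_pM.
  rewrite mulr_suml mulr_sumr; apply: ler_sum => i1 _.
  by rewrite mulr_sumr mulr_sumr; apply: ler_sum => j1 _; exact: b.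
rewrite big_mkcond big_allpairs/= /wmul.
pose X i := if (M./2 < `|m i|)%N then wt (m i) * nc (c i) else 0.
pose Y j := if (M./2 < `|m' j|)%N then wt (m' j) * nc (c' j) else 0.
have X0 i1 : 0 <= X i1 by rewrite /X; case: ifP.
have Y0 j1 : 0 <= Y j1 by rewrite /Y; case: ifP.
apply: (@le_trans _ _ (\sum_(i <- r) \sum_(j <- r')
    (2 `^ p * (X i * (wt (m' j) * nc (c' j)) + wt (m i) * nc (c i) * Y j)))).
  apply: ler_sum => i1 _; apply: ler_sum => j1 _; case: ifP => [hM|_]; last first.
    by rewrite mulr_ge0// addr_ge0// mulr_ge0.
  apply: le_trans (b _ _) _; apply: ler_wpM2l => //.
  have [hi|hi] := boolP (M./2 < `|m i1|)%N.
    by rewrite /X hi lerDl mulr_ge0.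
  have hj : (M./2 < `|m' j1|)%N by clear -hM hi; lia.
  by rewrite /Y hj lerDr mulr_ge0.
under eq_bigr do rewrite -mulr_sumr big_split/= -mulr_sumr -mulr_sumr.
rewrite -mulr_sumr big_split/= -!mulr_suml; apply: ler_wpM2l => //.
by apply: lerD; apply: ler_pM => //; rewrite ?sumr_ge0//; rewrite /X /Y -big_mkcond.
Qed.

Lemma trigp_mul (T T' : Type) (r : seq T) (r' : seq T') c c' m m' f g :
  trigp r c m f -> trigp r' c' m' g ->
  trigp [seq (i, j) | i <- r, j <- r']
    (fun z => c z.1 * c' z.2) (fun z => m z.1 + m' z.2) (fun x => f x * g x).
Proof.
move=> hf hg x; rewrite big_allpairs/= rcM hf hg mulr_suml; apply: eq_bigr => i1 _.
rewrite mulr_sumr; apply: eq_bigr => j1 _.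
by rewrite intrD mulrDl cexpD mulrACA.
Qed.

(** Collecting the waves of equal frequency into one coefficient can only decrease the weighted
    norm. *)
Lemma fourier_wtail d D (T : Type) (r : seq T) c m f : trigp r c m f -> wrep d D r c m ->
  forall M N : nat, \sum_(k <- zs N | (M < `|k|)%N) wt k * nc (fourier f k) <= d M.
Proof.
move=> hf [hd _] M N; apply: le_trans (hd M).
under eq_bigr do rewrite (fourier_trigp _ hf).
apply: (@le_trans _ _ (\sum_(k <- zs N | (M < `|k|)%N) \sum_(j <- r)
    (wt (m j) * nc (c j)) * ((m j == k) && (M < `|m j|)%N)%:R)).
  apply: ler_sum => k Mk; apply: le_trans (ler_wpM2l (wt_ge0 _) (nc_sum _ _)) _.
  rewrite mulr_sumr; apply: ler_sum => j _; case: eqP => [->|_].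
    by rewrite Mk mulr1.
  by rewrite nc0 mulr0/= mulr0.
rewrite exchange_big/= [leRHS]big_mkcond; apply: ler_sum => j _.
rewrite -mulr_sumr; case: ifP => h; last first.
  by rewrite big1 ?mulr0// => k _; rewrite andbF.
rewrite -[leRHS]mulr1; apply: ler_wpM2l; first by rewrite mulr_ge0 ?wt_ge0 ?nc_ge0.
rewrite big_mkcond; apply: le_trans (sum_indic_le1 R (x := m j) (P := fun k => m j == k) (uniq_zs N) _).
  by apply: ler_sum => k _; case: ifP => _; rewrite ?andbT// ler0n.
by move=> k /eqP.
Qed.

Definition wcoef d (a : int -> C) :=
  forall M N : nat, \sum_(k <- zs N | (M < `|k|)%N) wt k * nc (a k) <= d M.

Definition mult (a : int -> C) (k : int) : C := (wp p k)%:C%C * a k.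

Definition absd f : R -> R := synth (mult (fourier f)).

Lemma wcoef_ctail d a : wcoef d a -> ctail d a.
Proof.
move=> h M N; apply: le_trans (h M N); apply: ler_sum => k _.
by rewrite ler_peMl ?nc_ge0 ?wt_ge1.
Qed.

Lemma wcoef_mult d a : wcoef d a -> ctail d (mult a).
Proof.
move=> h M N; apply: le_trans (h M N); apply: ler_sum => k _.
by rewrite ncM nc_real ger0_norm ?wp_ge0// ler_wpM2r ?nc_ge0// lerDr.
Qed.

Lemma csym_mult a : csym a -> csym (mult a).
Proof. by move=> h k; rewrite /mult wpN h conjM conjc_real. Qed.

Lemma mult0 a : mult a 0 = 0.
Proof. by rewrite /mult wp0 ?mul0r// gt_eqF. Qed.

Lemma wcoef_lim (T : Type) (F : set_system T) (FF : ProperFilter F) d (u : T -> int -> C) a :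
  (forall n, wcoef d (u n)) -> (forall k, ccvg F (u^~ k) (a k)) -> wcoef d a.
Proof.
move=> du ua M N; have := @ccvg_sum_le _ _ F _ (zs N) (fun k => (M < `|k|)%N) wt 1 u a (d M) ua.
under eq_bigr do rewrite expr1; apply; apply: nearW => n.
by under eq_bigr do rewrite expr1; exact: du.
Qed.

Lemma absd_is_absD d f : periodicL1 f -> d @ \oo --> 0 -> wcoef d (fourier f) ->
  is_absD p f (absd f).
Proof.
move=> pf d0 df; have [_ hf] := pf; have dm := wcoef_mult df.
have cm : csym (mult (fourier f)) by apply: csym_mult; exact: fourier_csym.
split => //.
- exact: synth_periodicL1 d0 dm.
- by move=> p0; have := lt_le_trans p_gt0 p0; rewrite ltxx.
- by rewrite (fourier_synth d0 dm)// mult0.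
- by move=> k k0; rewrite (fourier_synth d0 dm).
Qed.

(** The coefficients have finite support, so [absd] is a finite sum and the formula holds at every
    point, not only almost everywhere. *)
Lemma trigp_absd (T : eqType) (r : seq T) c m f : trigp r c m f ->
  trigp r (fun j => (wp p (m j))%:C%C * c j) m (absd f).
Proof.
move=> hf; have hi := trigp_intg hf.
have [N rN] : exists N : nat, {in r, forall j, `|m j| <= N}%N.
  elim: r {hf} => [|j r [N ih]]; first by exists 0%N.
  exists (maxn `|m j| N) => l; rewrite in_cons => /predU1P[->|/ih h]; first exact: leq_maxl.
  exact: leq_trans h (leq_maxr _ _).
have sf : supp N (mult (fourier f)).
  move=> k Nk; rewrite /mult (fourier_trigp k hf) big1_seq ?mulr0// => j /= jr.
  by case: eqP => // e; move: Nk; rewrite -e ltnNge rN.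
move=> x; rewrite /absd (synth_supp _ sf).
rewrite (psum_trigp N (csym_mult (fourier_csym hi))).
under eq_bigr do rewrite /mult (fourier_trigp _ hf) mulr_sumr mulr_suml.
rewrite exchange_big/= big_seq [RHS]big_seq; apply: eq_bigr => j jr.
rewrite (bigD1_seq (m j)) ?uniq_zs ?mem_zs ?rN//= eqxx big1 ?addr0// => k kj.
by rewrite eq_sym (negbTE kj) mulr0 mul0r.
Qed.

End TrigonometricProducts.

Section UniformConvergence.
Context (R : realType) (T : Type) (F : set_system T).
Context {FF : ProperFilter F}.
Implicit Types (u v : T -> R -> R) (f g : R -> R).

Definition ucvg u f := forall e : R, 0 < e -> \forall n \near F, forall x, `|u n x - f x| <= e.

Lemma ucvgD u v f g : ucvg u f -> ucvg v g -> ucvg (fun n x => u n x + v n x) (fun x => f x + g x).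
Proof.
move=> uf vg e e0; have e2 : 0 < e / 2 by rewrite divr_gt0.
apply: filterS2 (uf _ e2) (vg _ e2) => n h1 h2 x.
rewrite opprD addrACA; apply: le_trans (ler_normD _ _) _; have := h1 x; have := h2 x; lra.
Qed.

Lemma ucvgM u v f g (A B : R) : ucvg u f -> ucvg v g ->
  (forall x, `|f x| <= A) -> (forall x, `|g x| <= B) ->
  ucvg (fun n x => u n x * v n x) (fun x => f x * g x).
Proof.
move=> uf vg fA gB e e0.
have A0 : 0 <= A by exact: le_trans (fA 0).
have B0 : 0 <= B by exact: le_trans (gB 0).
pose D := A + B + 1; pose h := Num.min 1 (e / D).
have D0 : 0 < D by rewrite /D; lra.
have h0 : 0 < h by rewrite lt_min ltr01 divr_gt0.
have h1 : h <= 1 by rewrite ge_min lexx.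
have hD : h * D <= e by rewrite -ler_pdivlMr// ge_min lexx orbT.
apply: filterS2 (uf _ h0) (vg _ h0) => n k1 k2 x.
have -> : u n x * v n x - f x * g x =
    (u n x - f x) * (v n x - g x) + f x * (v n x - g x) + (u n x - f x) * g x by ring.
apply: le_trans (ler_normD _ _) _; apply: le_trans (lerD (ler_normD _ _) (lexx _)) _.
rewrite !normrM.
have m1 : `|u n x - f x| * `|v n x - g x| <= h * 1.
  by apply: ler_pM => //; exact: le_trans (k2 x) h1.
have m2 : `|f x| * `|v n x - g x| <= A * h by apply: ler_pM.
have m3 : `|u n x - f x| * `|g x| <= h * B by apply: ler_pM.
apply: le_trans (lerD (lerD m1 m2) m3) _; apply: le_trans hD.
by apply: eq_ler; rewrite /D; ring.
Qed.

Lemma ucvgZ (z : R) u f : ucvg u f -> ucvg (fun n x => z * u n x) (fun x => z * f x).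
Proof.
move=> uf e e0; have z1 : 0 < `|z| + 1 by rewrite ltr_pwDr.
have e1 : 0 < e / (`|z| + 1) by rewrite divr_gt0.
apply: filterS (uf _ e1) => n h x; rewrite -mulrBr normrM.
apply: le_trans (ler_wpM2l (normr_ge0 z) (h x)) _.
rewrite mulrCA -[leRHS]mulr1; apply: ler_wpM2l; first exact: ltW.
by rewrite ler_pdivrMr// mul1r lerDl.
Qed.

Lemma ucvgN u f : ucvg u f -> ucvg (fun n x => - u n x) (fun x => - f x).
Proof. by move=> uf e e0; apply: filterS (uf _ e0) => n h x; rewrite -opprD normrN. Qed.

End UniformConvergence.

Section CoefficientDecay.
Variables (R : realType) (p s : R).
Hypotheses (p_gt0 : 0 < p) (ps : p + 2^-1 < s).
Local Notation C := R[i].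
Local Notation nc := (@ComplexField.Normc.normc R).
Implicit Types (a : int -> C).

(** The modulus common to a ball of radius K; the 2 comes from [wt_le]. The value at 0 is separate
    because [tau] vanishes there, by the convention for powers of 0, and bounds nothing. *)
Definition dec1 (K : R) (M : nat) : R := if M is 0%N then 2 * l1_const p s * K else 2 * tau p s M * K.

Lemma dec1_cvg K : 0 <= K -> dec1 K @ \oo --> 0.
Proof.
move=> K0; apply/cvgrPdist_le => e e0.
have e1 : 0 < e / (2 * (K + 1)) by rewrite divr_gt0// mulr_gt0// ltr_pwDr.
have [M M0 hM] := tau_small ps e1; exists M => // n /= Mn.
have n0 : (0 < n)%N := leq_trans M0 Mn.
case: n n0 Mn => // n _ Mn; rewrite /dec1 sub0r normrN ger0_norm; last first.
  by rewrite !mulr_ge0// tau_ge0.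
have := hM _ Mn; rewrite ler_pdivlMr; last by rewrite mulr_gt0// ltr_pwDr.
have := tau_ge0 p s n.+1; nra.
Qed.

Lemma wt_le k : k != 0 -> wt p k <= 2 * wp p k.
Proof. by move=> k0; have := wp_ge1 k0 (ltW p_gt0); rewrite /wt; lra. Qed.

Lemma wcoef_hn a K : (forall M, hn s M a <= K) -> wcoef p (dec1 K) a.
Proof.
move=> aK M N.
apply: (@le_trans _ _ (2 * \sum_(k <- zs N | (M < `|k|)%N) wp p k * nc (a k))).
  rewrite mulr_sumr; apply: ler_sum => k Mk; rewrite mulrA ler_wpM2r ?nc_ge0//.
  by apply: wt_le; case: k Mk => [[]|].
have K0 : 0 <= K := le_trans (hn_ge0 s 0 a) (aK 0%N).
case: M => [|M] /=; rewrite -mulrA; apply: ler_wpM2l => //.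
  apply: le_trans (ler_wpM2l (l1_const_ge0 p s) (aK N)).
  apply: le_trans (l1_full ps N (fun k => nc (a k)) _); last by rewrite gt_eqF.
  rewrite [leRHS](bigID (fun k => (0 < `|k|)%N))/= lerDl sumr_ge0// => k _.
  by rewrite mulr_ge0 ?wp_ge0 ?nc_ge0.
apply: le_trans (l1_tail ps N (fun k => nc (a k)) (ltn0Sn M)) _.
apply: ler_wpM2l; first exact: tau_ge0.
apply: le_trans (aK N); rewrite /hn ler_wsqrtr//.
rewrite [leRHS](bigID (fun k => (M.+1 < `|k|)%N))/= lerDl sumr_ge0// => k _.
by rewrite mulr_ge0 ?wp_ge0 ?sqr_ge0.
Qed.

End CoefficientDecay.

(** * The flux as a function, and its limit along truncations *)

Section FluxLimit.
Variables (R : realType) (p s : R).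
Hypotheses (p12 : 1 <= p <= 2) (ps : p + 2^-1 < s).
Local Notation C := R[i].
Local Notation nc := (@ComplexField.Normc.normc R).
Implicit Types (a b : int -> C) (f : R -> R).

Let p_gt0 : 0 < p. Proof. by have [h _] := andP p12; exact: lt_le_trans h. Qed.
Definition flux f (x : R) : R :=
  f x ^+ 2 * absd p f x - f x * absd p (fun x => f x ^+ 2) x + 3^-1 * absd p (fun x => f x ^+ 3) x.

Lemma fourier_comb (z : R) f1 f2 f3 k : intg f1 -> intg f2 -> intg f3 ->
  fourier (fun x => f1 x - f2 x + z * f3 x) k =
  fourier f1 k - fourier f2 k + z%:C%C * fourier f3 k.
Proof.
move=> h1 h2 h3.
by rewrite (fourierD _ (intgB h1 h2) (intgZ z h3)) (fourierB _ h1 h2) (fourierZ _ _ h3).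
Qed.

(** The three products have the symbols |k3|^p, |k2 + k3|^p and |k1 + k2 + k3|^p / 3. Against the
    symmetric product of coefficients the first two may be averaged over permutations of the
    frequencies, which yields one third of [symb]. *)
Lemma flux_trigp N a f k : trigp (zs N) a id f ->
  intg (flux f) /\ fourier (flux f) k = flux3 p N a a a k.
Proof.
move=> hf; pose c2 (z : int * int) := a z.1 * a z.2.
pose r2 := [seq (i, j) | i <- zs N, j <- zs N].
have h2 : trigp r2 c2 (fun z => z.1 + z.2) (fun x => f x * f x) := trigp_mul hf hf.
have h3 := trigp_mul hf h2.
have L1 := trigp_absd p hf; have L2 := trigp_absd p h2; have L3 := trigp_absd p h3.
have g1 := trigp_mul hf (trigp_mul hf L1); have g2 := trigp_mul hf L2.
have ef : flux f = fun x => f x * (f x * absd p f x) - f x * absd p (fun x => f x * f x) x +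
    3^-1 * absd p (fun x => f x * (f x * f x)) x.
  have s2 : (fun x => f x ^+ 2) = (fun x => f x * f x) by apply/funext => x; exact: expr2.
  have s3 : (fun x => f x ^+ 3) = (fun x => f x * (f x * f x)) by apply/funext => x; exact: exprS.
  by apply/funext => x; rewrite /flux s2 s3 expr2 mulrA.
rewrite ef; split.
  exact: (intgD (intgB (trigp_intg g1) (trigp_intg g2)) (intgZ _ (trigp_intg L3))).
rewrite (fourier_comb _ _ (trigp_intg g1) (trigp_intg g2) (trigp_intg L3)).
rewrite (fourier_trigp _ g1) (fourier_trigp _ g2) (fourier_trigp _ L3).
pose A k1 k2 k3 := a k1 * (a k2 * a k3).
pose Sm (G : int -> int -> int -> R) : C := sum4 (zs N) (zs N) (zs N) [:: - k]
  (fun k1 k2 k3 _ => (G k1 k2 k3)%:C%C * A k1 k2 k3).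
have SmE (G : int -> int -> int -> R) :
   \sum_(k1 <- zs N) \sum_(k2 <- zs N) \sum_(k3 <- zs N)
      (if k1 + (k2 + k3) == k then (G k1 k2 k3)%:C%C * A k1 k2 k3 else 0) = Sm G.
  rewrite /Sm /sum4; apply: eq_bigr => k1 _; apply: eq_bigr => k2 _; apply: eq_bigr => k3 _.
  by rewrite big_seq1 addrA subr_eq0.
have SmD G H : Sm (fun k1 k2 k3 => G k1 k2 k3 + H k1 k2 k3) = Sm G + Sm H.
  by rewrite /Sm -sum4D; apply: eq_sum4 => *; rewrite rcD mulrDl.
have SmZ (z : R) G : Sm (fun k1 k2 k3 => z * G k1 k2 k3) = z%:C%C * Sm G.
  rewrite /Sm sum4Z; apply: eq_sum4 => k1 k2 k3 k4 _; by rewrite rcM -mulrA.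
have Sm12 G : Sm G = Sm (fun k1 k2 k3 => G k2 k1 k3).
  by rewrite /Sm sum4_swap12; apply: eq_sum4 => *; rewrite /A; congr (_ * _); ring.
have Sm23 G : Sm G = Sm (fun k1 k2 k3 => G k1 k3 k2).
  by rewrite /Sm sum4_swap23; apply: eq_sum4 => *; rewrite /A; congr (_ * _); ring.
have -> : flux3 p N a a a k = Sm (fun k1 k2 k3 => symb p k1 k2 k3 / 3).
  by apply: eq_sum4 => k1 k2 k3 k4 _; congr (_ * _); rewrite /A mulrA.
have T1 : \sum_(j <- [seq (i, j) | i <- zs N, j <- [seq (i, j) | i <- zs N, j <- zs N]])
   (if j.1 + (j.2.1 + j.2.2) == k then a j.1 * (a j.2.1 * ((wp p j.2.2)%:C%C * a j.2.2)) else 0) =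
   Sm (fun _ _ k3 => wp p k3).
  rewrite big_allpairs; under eq_bigr do rewrite big_allpairs; rewrite -SmE.
  apply: eq_bigr => k1 _; apply: eq_bigr => k2 _; apply: eq_bigr => k3 _ /=.
  by rewrite /A; case: ifP => // _; ring.
have T2 : \sum_(j <- [seq (i, j) | i <- zs N, j <- r2])
   (if j.1 + (j.2.1 + j.2.2) == k then a j.1 * ((wp p (j.2.1 + j.2.2))%:C%C * c2 j.2) else 0) =
   Sm (fun _ k2 k3 => wp p (k2 + k3)).
  rewrite big_allpairs; under eq_bigr do rewrite big_allpairs; rewrite -SmE.
  apply: eq_bigr => k1 _; apply: eq_bigr => k2 _; apply: eq_bigr => k3 _ /=.
  by rewrite /A /c2; case: ifP => // _; ring.
have T3 : \sum_(j <- [seq (i, j) | i <- zs N, j <- r2])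
   (if j.1 + (j.2.1 + j.2.2) == k then (wp p (j.1 + (j.2.1 + j.2.2)))%:C%C * (a j.1 * c2 j.2) else 0) =
   Sm (fun k1 k2 k3 => wp p (k1 + (k2 + k3))).
  rewrite big_allpairs; under eq_bigr do rewrite big_allpairs; rewrite -SmE.
  by apply: eq_bigr => k1 _; apply: eq_bigr => k2 _; apply: eq_bigr => k3 _ /=.
rewrite [X in X - _ + _]T1 [X in _ - X + _]T2 [X in _ + _ * X]T3 -SmZ.
have -> : Sm (fun k1 k2 k3 => symb p k1 k2 k3 / 3) =
   (3^-1)%:C%C * (Sm (fun k1 _ _ => wp p k1) + Sm (fun _ k2 _ => wp p k2) + Sm (fun _ _ k3 => wp p k3)
   - (Sm (fun k1 k2 _ => wp p (k1 + k2)) + Sm (fun k1 _ k3 => wp p (k1 + k3))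
     + Sm (fun _ k2 k3 => wp p (k2 + k3)))) + Sm (fun k1 k2 k3 => 3^-1 * wp p (k1 + (k2 + k3))).
  rewrite -!SmD -mulN1r (_ : -1 = (-1 : R)%:C%C); last by simpc.
  rewrite -SmZ -SmD -SmZ -SmD; apply: eq_sum4 => *; rewrite /symb; congr (_%:C%C * _).
  by rewrite addrA; ring.
have e1 : Sm (fun _ k2 _ => wp p k2) = Sm (fun _ _ k3 => wp p k3) by rewrite Sm23.
have e2 : Sm (fun k1 _ _ => wp p k1) = Sm (fun _ _ k3 => wp p k3) by rewrite Sm12 e1.
have e3 : Sm (fun k1 _ k3 => wp p (k1 + k3)) = Sm (fun _ k2 k3 => wp p (k2 + k3)) by rewrite Sm12.
have e4 : Sm (fun k1 k2 _ => wp p (k1 + k2)) = Sm (fun _ k2 k3 => wp p (k2 + k3)) by rewrite Sm23 e3.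
rewrite e1 e2 e3 e4; congr (_ + _).
set X := Sm _; set Y := Sm _.
have h3' : (3^-1)%:C%C * (1 + 1 + 1) = 1 :> C.
  have -> : 1 + 1 + 1 = (1 + 1 + 1 : R)%:C%C :> C by rewrite !rcD.
  by rewrite -rcM (_ : 3^-1 * (1 + 1 + 1) = 1)//; field.
rewrite (_ : _ * _ = (3^-1)%:C%C * (1 + 1 + 1) * (X - Y)); last by ring.
by rewrite h3' mul1r.
Qed.

Lemma wrep_hn N a K : (forall M, hn s M a <= K) -> a 0 = 0 ->
  wrep p (dec1 p s K) (dec1 p s K 0) (zs N) a id.
Proof.
move=> aK a00; split=> [M|]; first exact: (wcoef_hn p_gt0 ps).
apply: le_trans (wcoef_hn p_gt0 ps aK 0 N).
rewrite (bigID (fun k => (0 < `|k|)%N))/= gerDl big1// => k.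
by rewrite lt0n negbK absz_eq0 => /eqP ->; rewrite a00 nc0 mulr0.
Qed.

Definition dec2 K := wmul p (dec1 p s K) (dec1 p s K 0) (dec1 p s K) (dec1 p s K 0).
Definition dec3 K := wmul p (dec1 p s K) (dec1 p s K 0) (dec2 K) (2 `^ p * (dec1 p s K 0 * dec1 p s K 0)).

Lemma dec2_cvg K : 0 <= K -> dec2 K @ \oo --> 0.
Proof. by move=> K0; apply: wmul_cvg; exact: (dec1_cvg ps). Qed.

Lemma dec3_cvg K : 0 <= K -> dec3 K @ \oo --> 0.
Proof. by move=> K0; apply: wmul_cvg; [exact: (dec1_cvg ps)|exact: dec2_cvg]. Qed.

Lemma trigp_decay N a f K : trigp (zs N) a id f -> (forall M, hn s M a <= K) -> a 0 = 0 ->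
  wcoef p (dec2 K) (fourier (fun x => f x ^+ 2)) /\
  wcoef p (dec3 K) (fourier (fun x => f x ^+ 3)).
Proof.
move=> hf aK a00; have w1 := wrep_hn N aK a00.
have s2 : (fun x => f x ^+ 2) = (fun x => f x * f x) by apply/funext => x; exact: expr2.
have s3 : (fun x => f x ^+ 3) = (fun x => f x * (f x * f x)) by apply/funext => x; exact: exprS.
have h2 := trigp_mul hf hf; have h3 := trigp_mul hf h2.
have w2 := wrep_mul p_gt0 w1 w1; have w3 := wrep_mul p_gt0 w1 w2.
rewrite s2 s3; split => M N'; [exact: (fourier_wtail h2 w2)|exact: (fourier_wtail h3 w3)].
Qed.

Section Limit.
Context (T : Type) (F : set_system T).
Context {FF : ProperFilter F}.
Variables (u : T -> int -> C) (N : T -> nat) (a : int -> C) (K : R).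
Hypotheses (u_supp : forall n, supp (N n) (u n)) (u_sym : forall n, csym (u n)).
Hypotheses (u0 : forall n, u n 0 = 0) (uK : forall n M, hn s M (u n) <= K).
Hypothesis ua : forall k, ccvg F (u^~ k) (a k).

Let K0 : 0 <= K.
Proof. have [n _] := filter_ex (@filterT _ F _); exact: le_trans (hn_ge0 s 0 _) (uK n 0). Qed.

Let a_decay : wcoef p (dec1 p s K) a.
Proof. by apply: (@wcoef_lim _ _ _ F _ _ u) => // n; exact: (wcoef_hn p_gt0 ps). Qed.

Let f := synth a.
Let fu n := synth (u n).

Let fu_trigp n : trigp (zs (N n)) (u n) id (fu n).
Proof.
rewrite (_ : fu n = psum (u n) (N n)); first exact: psum_trigp.
by apply/funext => x; exact: synth_supp.
Qed.

Let fu_f : ucvg F fu f.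
Proof.
apply: (synth_unif _ (dec1_cvg ps K0)) ua; last exact: wcoef_ctail a_decay.
by move=> n; apply: wcoef_ctail (wcoef_hn p_gt0 ps (uK n)).
Qed.

Let B := dec1 p s K 0 + nc (a 0).
Let f_le x : `|f x| <= B.
Proof. exact: synth_le (dec1_cvg ps K0) (wcoef_ctail a_decay) x. Qed.

Let f_measurable : measurable_fun (`[0, 2 * pi]%classic : set (measurableTypeR R)) f.
Proof. exact: synth_measurable (dec1_cvg ps K0) (wcoef_ctail a_decay) _ mI. Qed.

Let pow_cvg m : ucvg F (fun n x => fu n x ^+ m) (fun x => f x ^+ m).
Proof.
elim: m => [|m ih].
  by move=> e e0; apply: nearW => n x; rewrite subrr normr0 ltW.
rewrite (_ : (fun n x => _) = fun n x => fu n x * fu n x ^+ m); last first.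
  by apply/funext => n; apply/funext => x; rewrite exprS.
rewrite (_ : (fun x => _) = fun x => f x * f x ^+ m); last by apply/funext => x; rewrite exprS.
apply: (ucvgM fu_f ih f_le) => x; rewrite normrX; apply: lerXn2r (f_le x); rewrite ?nnegrE//.
exact: le_trans (f_le 0).
Qed.

Let pow_periodicL1 m : periodicL1 (fun x => f x ^+ m).
Proof.
split; first by move=> x; rewrite /f synth_periodic.
apply: (@intg_bounded _ _ (B ^+ m)) => [|x _].
  exact: measurable_funX.
rewrite normrX; apply: lerXn2r (f_le x); rewrite ?nnegrE//; exact: le_trans (f_le 0).
Qed.

Let fu_intg m n : intg (fun x => fu n x ^+ m).
Proof.
have -> : fu n = psum (u n) (N n) by apply/funext => y; exact: synth_supp.
apply: intg_continuous; apply: continuous_subspaceT => x.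
apply: (@cvg_comp _ _ _ (psum (u n) (N n)) (fun y => y ^+ m) (nbhs x) (nbhs (psum (u n) (N n) x))).
  exact: psum_continuous.
exact: exprn_continuous.
Qed.

Let pow_coef m k : ccvg F (fun n => fourier (fun x => fu n x ^+ m) k) (fourier (fun x => f x ^+ m) k).
Proof. by apply: fourier_lim; [move=> n; exact: fu_intg|case: (pow_periodicL1 m)|exact: pow_cvg]. Qed.

(** A modulus common to all truncations passes to the limit of the coefficients, and with it |D|^p
    of the m-th powers converges uniformly. *)
Let absd_facts m : (exists2 d : nat -> R, d @ \oo --> 0 & (forall n, wcoef p d (fourier (fun x => fu n x ^+ m)))) ->
  exists2 d : nat -> R, d @ \oo --> 0 & [/\ wcoef p d (fourier (fun x => f x ^+ m)),
    is_absD p (fun x => f x ^+ m) (absd p (fun x => f x ^+ m)),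
    forall x, `|absd p (fun x => f x ^+ m) x| <= d 0%N &
    ucvg F (fun n => absd p (fun x => fu n x ^+ m)) (absd p (fun x => f x ^+ m))].
Proof.
move=> [d d0 dn]; exists d => //.
have df : wcoef p d (fourier (fun x => f x ^+ m)).
  by apply: (@wcoef_lim _ _ _ F _ _ (fun n => fourier (fun x => fu n x ^+ m))); last exact: pow_coef.
split => //.
- exact: absd_is_absD (pow_periodicL1 m) d0 df.
- move=> x; apply: le_trans (synth_le d0 (wcoef_mult df) x) _.
  by rewrite mult0// nc0 addr0.
- apply: (@synth_unif _ _ F FF d _ _ d0 (fun n => wcoef_mult (dn n)) (wcoef_mult df)) => k.
  by apply: ccvgZ; exact: pow_coef.
Qed.

Let decay_u m : (0 < m <= 3)%N ->
  exists2 d : nat -> R, d @ \oo --> 0 & (forall n, wcoef p d (fourier (fun x => fu n x ^+ m))).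
Proof.
case: m => [//|[|[|[|//]]]] _.
- exists (dec1 p s K); first exact: (dec1_cvg ps).
  move=> n; rewrite (_ : fourier _ = u n); first exact: (wcoef_hn p_gt0 ps).
  apply/funext => k; rewrite -[LHS]/(fourier (fu n) k).
  exact: (fourier_synth (dec1_cvg ps K0) (wcoef_ctail (wcoef_hn p_gt0 ps (uK n))) _ (u_sym n)).
- exists (dec2 K); first exact: dec2_cvg.
  by move=> n; have [] := trigp_decay (fu_trigp n) (uK n) (u0 n).
- exists (dec3 K); first exact: dec3_cvg.
  by move=> n; have [] := trigp_decay (fu_trigp n) (uK n) (u0 n).
Qed.

Lemma pow_absD m : (0 < m <= 3)%N -> is_absD p (fun x => synth a x ^+ m) (absd p (fun x => synth a x ^+ m)).
Proof. by move=> hm; have [d _ []] := absd_facts (decay_u hm). Qed.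

Let flux_ucvg : ucvg F (fun n => flux (fu n)) (flux f).
Proof.
have [d1 _ [_ _ A1 U1]] := absd_facts (@decay_u 1 isT).
have [d2 _ [_ _ A2 U2]] := absd_facts (@decay_u 2 isT).
have [d3 _ [_ _ _ U3]] := absd_facts (@decay_u 3 isT).
apply: ucvgD; last exact: ucvgZ U3.
have f2B x : `|f x ^+ 2| <= B ^+ 2.
  by rewrite normrX; apply: lerXn2r (f_le x); rewrite ?nnegrE//; exact: le_trans (f_le 0).
apply: ucvgD; first exact: (ucvgM (@pow_cvg 2) U1 f2B A1).
exact: ucvgN (ucvgM fu_f U2 f_le A2).
Qed.

Lemma flux_periodicL1 : periodicL1 (flux (synth a)).
Proof.
have [d1 _ [_ [_ [q1 i1] _ _ _] A1 _]] := absd_facts (@decay_u 1 isT).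
have [d2 _ [_ [_ [q2 i2] _ _ _] A2 _]] := absd_facts (@decay_u 2 isT).
have [d3 _ [_ [_ [q3 i3] _ _ _] A3 _]] := absd_facts (@decay_u 3 isT).
have [p2 j2] := pow_periodicL1 2; have [p1 j1] := pow_periodicL1 1.
split; first by move=> x; rewrite /flux p2 q1 q2 q3 [synth a _]p1.
apply: intgD; last exact: intgZ i3.
apply: intgB.
  apply: (intgMl j2 (intg_measurable i1)) => x _; exact: A1.
apply: (intgMl j1 (intg_measurable i2)) => x _; exact: A2.
Qed.

(** The left side consists of the exact coefficients of the fluxes of trigonometric polynomials,
    which converge uniformly to the flux of the limit. *)
Lemma flux_ccvg k : ccvg F (fun n => flux3 p (N n) (u n) (u n) (u n) k) (fourier (flux (synth a)) k).
Proof.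
have [_ hf] := flux_periodicL1.
have h n : flux3 p (N n) (u n) (u n) (u n) k = fourier (flux (fu n)) k.
  by have [] := flux_trigp k (fu_trigp n).
rewrite (_ : (fun n => _) = fun n => fourier (flux (fu n)) k); last exact/funext.
apply: (@fourier_lim _ _ F FF (fun n => flux (fu n)) (flux f) k _ hf flux_ucvg).
by move=> n; have [] := flux_trigp k (fu_trigp n).
Qed.

End Limit.

End FluxLimit.

(** * Sobolev functions and weak derivatives *)

Section SobolevNorm.
Variables (R : realType) (s : R).
Implicit Types (f g : R -> R).

Lemma energy_ge f M : fourier f 0 = 0 -> ((hn s M (fourier f) ^+ 2)%:E <= Hdot_energy s f)%E.
Proof.
move=> f0; apply: esum_ge; exists [set` [seq k <- zs M | k != 0]].
  split; first exact: finite_seq.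
  by move=> k; rewrite /= mem_filter => /andP[].
rewrite -fsbig_seq ?filter_uniq ?uniq_zs// sumEFin lee_fin hn_sqr big_filter.
rewrite (bigID (fun k => k != 0)) gerDl big1// => k; rewrite negbK => /eqP ->.
by rewrite f0 nc0 expr0n mulr0.
Qed.

Lemma energy_le f (B : R) : (forall M, hn s M (fourier f) ^+ 2 <= B) -> (Hdot_energy s f <= B%:E)%E.
Proof.
move=> fB; apply: ge_ereal_sup => _ [A [/finite_seqP[r ->] rA] <-].
have -> : [set` r] = [set` undup r] by apply/seteqP; split=> k /=; rewrite mem_undup.
rewrite -fsbig_seq ?undup_uniq// sumEFin lee_fin.
have [N rN] : exists N : nat, {in r, forall k, `|k| <= N}%N.
  elim: r {rA} => [|j r [N ih]]; first by exists 0%N.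
  exists (maxn `|j| N) => l; rewrite in_cons => /predU1P[->|/ih h]; first exact: leq_maxl.
  exact: leq_trans h (leq_maxr _ _).
apply: le_trans (fB N); rewrite hn_sqr [leRHS](bigID (mem r)) -[leLHS]addr0; apply: lerD; last first.
  by apply: sumr_ge0 => k _; rewrite mulr_ge0 ?wp_ge0 ?sqr_ge0.
rewrite -big_filter (perm_big [seq k <- zs N | k \in r])//; apply: uniq_perm.
- exact: undup_uniq.
- by rewrite filter_uniq ?uniq_zs.
- by move=> k; rewrite mem_undup mem_filter mem_zs andbC; apply/esym/andb_idl => /rN.
Qed.

Lemma Hdot_hn f M : Hdot s f -> hn s M (fourier f) <= Hdot_norm s f.
Proof.
move=> [_ f0 fE]; apply: le_sqrt; have h := energy_ge M f0.
rewrite -lee_fin fineK// ge0_fin_numE//; apply: le_trans h.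
by rewrite lee_fin sqr_ge0.
Qed.

Lemma Hdot_intro f (K : R) : periodicL1 f -> fourier f 0 = 0 ->
  (forall M, hn s M (fourier f) <= K) -> Hdot s f /\ Hdot_norm s f <= K.
Proof.
move=> pf f0 fK; have K0 := le_trans (hn_ge0 s 0 _) (fK 0%N).
have h : (Hdot_energy s f <= (K ^+ 2)%:E)%E.
  by apply: energy_le => M; apply: lerXn2r (fK M); rewrite ?nnegrE// hn_ge0.
have h0 := energy_ge 0 f0.
have hfin : (Hdot_energy s f < +oo)%E := le_lt_trans h (ltry _).
split=> //; rewrite /Hdot_norm -[leRHS](ger0_norm K0) -sqrtr_sqr ler_wsqrtr//.
rewrite -lee_fin fineK// ge0_fin_numE//; apply: le_trans h0.
by rewrite lee_fin sqr_ge0.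
Qed.

Lemma Hdot_norm_ge0 f : 0 <= Hdot_norm s f. Proof. exact: sqrtr_ge0. Qed.

End SobolevNorm.

(** * Weak derivatives and Fourier coefficients *)

Section WeakDerivative.
Variable R : realType.
Local Notation C := R[i].
Local Notation mu := (@lebesgue_measure R).
Local Notation I := (`[0, 2 * pi]%classic : set (measurableTypeR R)).
Local Notation J f := (\int[mu]_(x in I) f x).
Implicit Types (f g : R -> R) (a : int -> C).

Definition deriv a (k : int) : C := 'i%C * k%:~R * a k.

Lemma csym_deriv a : csym a -> csym (deriv a).
Proof.
by move=> h k; rewrite /deriv h !conjM conj_i conj_int mulrNz !mulNr mulrN mulNr.
Qed.

Let wave (k : int) (c d : R) (x : R) := c * cos (k%:~R * x) + d * sin (k%:~R * x).

Lemma wave_derive (k : int) (c d x : R) : is_derive x 1 (wave k c d) (wave k (k%:~R * d) (- (k%:~R * c)) x).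
Proof.
have lin : is_derive x 1 (fun y => k%:~R * y) (k%:~R : R).
  rewrite (_ : (fun y => _) = (k%:~R : R) \*: (id : R -> R))//.
  by apply: is_derive_eq; rewrite /GRing.scale/= mulr1.
have d1 := @is_deriveZ _ _ _ _ c x 1 _ (is_derive1_comp (is_derive_cos (k%:~R * x)) lin).
have d2 := @is_deriveZ _ _ _ _ d x 1 _ (is_derive1_comp (is_derive_sin (k%:~R * x)) lin).
by apply: (is_derive_eq (is_deriveD d1 d2)); rewrite /GRing.scale/= /wave; ring.
Qed.

Lemma wave_derive1 k c d : derive1 (wave k c d) = wave k (k%:~R * d) (- (k%:~R * c)).
Proof. by apply/funext => x; rewrite derive1E; have h := wave_derive k c d x; exact: derive_val. Qed.

Lemma wave_test k c d : test_function (wave k c d).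
Proof.
split.
  move=> x; rewrite /wave mulrDr; have h := cexp_int2pi R k.
  have := cexpD (k%:~R * x) (k%:~R * (2 * pi)); rewrite h mulr1 => -[-> ->]//.
have dn n : exists c' d', derive1n n (wave k c d) = wave k c' d'.
  elim: n => [|n [c' [d' ih]]]; first by exists c, d.
  by rewrite derive1nS ih wave_derive1; do 2 eexists.
move=> n x; have [c' [d' ->]] := dn n; have h := wave_derive k c' d' x; exact: ex_derive.
Qed.

(** Tests against cos (k x) and sin (k x), which are test functions because real waves of frequency
    k are closed under differentiation. *)
Lemma weak_derivative_fourier f g k : is_weak_derivative f g -> fourier g k = deriv (fourier f) k.
Proof.
move=> [[_ hf] [_ hg] h]; rewrite /deriv !fourierE//.
have hc : J (fun x => g x * cos (k%:~R * x)) = k%:~R * J (fun x => f x * sin (k%:~R * x)).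
  have := h _ (wave_test k 1 0); rewrite wave_derive1 => /eqP; rewrite -eqr_oppLR => /eqP.
  have -> : J (fun x => g x * wave k 1 0 x) = J (fun x => g x * cos (k%:~R * x)).
    by apply: eq_Rintegral => x _; rewrite /wave; ring.
  move=> <-; rewrite -(RintegralZl _ mI (intg_sin k hf)).
  rewrite (_ : (fun x => _) = fun x => -1 * (k%:~R * (f x * sin (k%:~R * x)))).
    by rewrite (RintegralZl _ mI (intgZ _ (intg_sin k hf))) mulN1r opprK.
  by apply/funext => x; rewrite /wave; ring.
have hs : J (fun x => g x * sin (k%:~R * x)) = - (k%:~R * J (fun x => f x * cos (k%:~R * x))).
  have := h _ (wave_test k 0 1); rewrite wave_derive1 => /eqP; rewrite -eqr_oppLR => /eqP.
  have -> : J (fun x => g x * wave k 0 1 x) = J (fun x => g x * sin (k%:~R * x)).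
    by apply: eq_Rintegral => x _; rewrite /wave; ring.
  move=> <-; congr (- _); rewrite -(RintegralZl _ mI (intg_cos k hf)).
  by apply: eq_Rintegral => x _; rewrite /wave; ring.
rewrite hc hs opprK mulrCA; congr (_ * _); rewrite -rc_int.
by congr Complex => /=; ring.
Qed.

Lemma psum_derive a (N : nat) (x : R) : is_derive x 1 (psum a N) (psum (deriv a) N x).
Proof.
have psumE b : psum b N = fun x => \sum_(k <- zs N) wave k (complex.Re (b k)) (- complex.Im (b k)) x.
  apply/funext => y; rewrite /psum raddf_sum; apply: eq_bigr => k _.
  by rewrite /wave mulNr; case: (b k).
rewrite !psumE; elim: (zs N) => [|k r ih].
  by rewrite big_nil; under eq_fun do rewrite big_nil; exact: is_derive_cst.
rewrite big_cons; under eq_fun do rewrite big_cons.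
apply: (is_derive_eq (is_deriveD (wave_derive k _ _ x) ih)); congr (_ + _).
rewrite /wave /deriv -rc_int; case: (a k) => u v /=; ring.
Qed.

Lemma psum_parts a N psi : test_function psi ->
  J (fun x => psum a N x * derive1 psi x) = - J (fun x => psum (deriv a) N x * psi x).
Proof.
move=> [pp dp]; have d0 x : derivable psi x 1 := dp 0%N x.
have d1 x : derivable (derive1 psi) x 1 := dp 1%N x.
have c0 : continuous psi by move=> x; apply: differentiable_continuous; exact/derivable1_diffP.
have c1 : continuous (derive1 psi) by move=> x; apply: differentiable_continuous; exact/derivable1_diffP.
pose h x := psum (deriv a) N x * psi x + psum a N x * derive1 psi x.
have hd (x : R) : is_derive x 1 (fun y => psum a N y * psi y) (h x).
  have dpsi : is_derive x 1 psi (derive1 psi x) by rewrite derive1E; exact: derivableP.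
  apply: (is_derive_eq (is_deriveM (psum_derive a N x) dpsi)).
  by rewrite /h /GRing.scale/=; ring.
have i1 : intg (fun x => psum a N x * derive1 psi x).
  by apply: intg_continuous; apply: continuous_subspaceT => x; apply: cvgM; [exact: psum_continuous|exact: c1].
have i2 : intg (fun x => psum (deriv a) N x * psi x).
  by apply: intg_continuous; apply: continuous_subspaceT => x; apply: cvgM; [exact: psum_continuous|exact: c0].
apply/eqP; rewrite -addr_eq0 -(RintegralD mI i1 i2) /Rintegral (@continuous_FTC2 _ _ (fun y => psum a N y * psi y) _ _ (pi2_gt0 R)).
- by rewrite -[2 * pi]add0r psum_periodic pp subee.
- apply: continuous_subspaceT => x; apply: cvgD; apply: cvgM; try exact: psum_continuous.
    exact: c1.
  exact: c0.
- by apply: derivable_LRcontinuous => x; exact: ex_derive.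
- by move=> x _; rewrite derive1E; rewrite (@derive_val _ _ _ _ _ _ _ (hd x)) /h addrC.
Qed.

Lemma ae_J f g : intg f -> intg g -> {ae mu, forall x, f x = g x} -> J f = J g.
Proof.
move=> hf hg fg; rewrite /Rintegral; congr fine; apply: ae_eq_integral.
- exact: mI.
- by apply/measurable_EFinP; exact: intg_measurable.
- by apply/measurable_EFinP; exact: intg_measurable.
- by case: fg => A [mA A0 hA]; exists A; split=> // x /= hx; apply: hA => /= e; apply: hx => _; rewrite e.
Qed.

Lemma ae_fourier f g k : intg f -> intg g -> {ae mu, forall x, f x = g x} -> fourier f k = fourier g k.
Proof.
move=> hf hg fg; rewrite !fourierE//; congr (_ * _); congr Complex.
  apply: ae_J; [exact: intg_cos|exact: intg_cos|].
  by case: fg => A [mA A0 hA]; exists A; split=> // x /= hx; apply: hA => /= e; apply: hx; rewrite e.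
congr (- _); apply: ae_J; [exact: intg_sin|exact: intg_sin|].
by case: fg => A [mA A0 hA]; exists A; split=> // x /= hx; apply: hA => /= e; apply: hx; rewrite e.
Qed.

Lemma intg_test f (psi : R -> R) : intg f -> (forall x : R, derivable psi x 1) -> exists B,
  (forall x, I x -> `|psi x| <= B) /\ intg (fun x => f x * psi x).
Proof.
move=> hf dp.
have c0 : continuous psi by move=> x; apply: differentiable_continuous; exact/derivable1_diffP.
have [B hB] := continuous_within_bounded (continuous_subspaceT c0).
exists B; split=> //; apply: (intgMl hf) hB; exact: measurable_continuous.
Qed.

Lemma synth_pairing d a (psi : R -> R) (e : R) : d @ \oo --> 0 -> ctail d a -> csym a ->
  (forall x : R, derivable psi x 1) -> 0 < e ->
  \forall N \near \oo, `|J (fun x => synth a x * psi x) - J (fun x => psum a N x * psi x)| <= e.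
Proof.
move=> d0 da ca dp e0; have ha := synth_intg d0 da.
have [B [hB i1]] := intg_test ha dp.
have B0 : 0 <= B.
  by apply: le_trans (hB 0 _) => //; rewrite /= in_itv/= lexx ltW// pi2_gt0.
have e1 : 0 < e / (2 * pi * (B + 1)) by rewrite divr_gt0// mulr_gt0 ?pi2_gt0// ltr_pwDr.
move/cvgrPdist_le: (d0) => /(_ _ e1); apply: filterS => N; rewrite sub0r normrN => hN.
have [_ [_ i2]] := intg_test (psum_intg N ca) dp.
rewrite -(RintegralB mI i1 i2).
apply: (@le_trans _ _ (2 * pi * (d N * B))).
  apply: Rint_le; first exact: intgB.
  move=> x Ix; rewrite -mulrBl normrM; apply: ler_pM => //; last exact: hB.
  exact: synth_dist.
have := le_trans (ler_norm _) hN; rewrite ler_pdivlMr; last by rewrite mulr_gt0 ?pi2_gt0// ltr_pwDr.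
have dN0 : 0 <= d N by apply: le_trans (synth_dist N 0 d0 da).
have := pi2_gt0 R; set q := 2 * pi => q0; have := mulr_ge0 (ltW q0) dN0; nra.
Qed.

(** Integration by parts holds for the partial sums, by periodicity; both series converge uniformly,
    so it holds for their sums, which equal f and g almost everywhere. *)
Lemma fourier_weak_derivative d d' f g : periodicL1 f -> periodicL1 g ->
  d @ \oo --> 0 -> d' @ \oo --> 0 -> ctail d (fourier f) -> ctail d' (fourier g) ->
  (forall k, fourier g k = deriv (fourier f) k) -> is_weak_derivative f g.
Proof.
move=> pf pg d0 d'0 df dg fg; split => // psi tpsi; have [pp dp] := tpsi.
have [_ hf] := pf; have [_ hg] := pg.
have dp0 x : derivable psi x 1 := dp 0%N x.
have dp1 x : derivable (derive1 psi) x 1 := dp 1%N x.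
have sf := synth_fourier pf d0 df; have sg := synth_fourier pg d'0 dg.
have cf := fourier_csym hf; have cg := fourier_csym hg.
have egf : fourier g = deriv (fourier f) by exact/funext.
have s1 : J (fun x => f x * derive1 psi x) = J (fun x => synth (fourier f) x * derive1 psi x).
  have [_ [_ i1]] := intg_test hf dp1; have [_ [_ i2]] := intg_test (synth_intg d0 df) dp1.
  apply: ae_J => //; case: sf => A [mA A0 hA]; exists A; split=> // x /= hx.
  by apply: hA => /= e; apply: hx; rewrite e.
have s2 : J (fun x => g x * psi x) = J (fun x => synth (fourier g) x * psi x).
  have [_ [_ i1]] := intg_test hg dp0; have [_ [_ i2]] := intg_test (synth_intg d'0 dg) dp0.
  apply: ae_J => //; case: sg => A [mA A0 hA]; exists A; split=> // x /= hx.
  by apply: hA => /= e; apply: hx; rewrite e.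
rewrite s1 s2; apply/eqP; rewrite -subr_eq0 opprK -normr_eq0 eq_le normr_ge0 andbT.
have comb (e X Y Z : R) : `|X + Z| <= e / 2 -> `|Y - Z| <= e / 2 -> `|X + Y| <= e.
  by rewrite !ler_norml => /andP[? ?] /andP[? ?]; apply/andP; split; lra.
apply/ler_addgt0Pr => e e0; rewrite add0r; have e2 : 0 < e / 2 by rewrite divr_gt0.
have [N [h1 h2]] := filter_ex (filterI (synth_pairing d0 df cf dp1 e2) (synth_pairing d'0 dg cg dp0 e2)).
move: h1 h2; rewrite (psum_parts _ _ tpsi) -egf opprK.
exact: comb.
Qed.

End WeakDerivative.

Section SobolevSequences.
Variable R : realType.
Local Notation C := R[i].
Local Notation nc := (@ComplexField.Normc.normc R).
Implicit Types (a : int -> C) (t : R).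

Lemma hn_eq t M a a' : a =1 a' -> hn t M a = hn t M a'.
Proof. by move=> e; rewrite /hn; congr Num.sqrt; apply: eq_bigr => k _; rewrite e. Qed.

Lemma hn_triangle t M a a' : hn t M (fun k => a k + a' k) <= hn t M a + hn t M a'.
Proof.
apply: le_of_sqr_le; rewrite ?addr_ge0 ?hn_ge0//.
set H := hn t M (fun k => _); rewrite mulrDr [H * _]mulrC [H * hn t M a']mulrC.
have cs (b : int -> C) : \sum_(k <- zs M) (wp t k * nc (b k)) * (wp t k * nc (a k + a' k)) <= hn t M b * H.
  by rewrite /H !hn_sqr'; exact: cauchy_schwarz.
apply: le_trans (lerD (cs a) (cs a')); rewrite /H hn_sqr -big_split/=; apply: ler_sum => k _.
rewrite (_ : _ + _ = wp t k ^+ 2 * ((nc (a k) + nc (a' k)) * nc (a k + a' k))); last by rewrite /=; ring.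
rewrite wp_sqr expr2 -expr2; apply: ler_wpM2l; first exact: sqr_ge0.
by rewrite expr2; apply: ler_wpM2r; [exact: nc_ge0|exact: nc_leD].
Qed.

Lemma hnZ t M (z : C) a : hn t M (fun k => z * a k) = nc z * hn t M a.
Proof.
rewrite /hn -[nc z]ger0_norm ?nc_ge0// -sqrtr_sqr -sqrtrM ?sqr_ge0//; congr Num.sqrt.
by rewrite mulr_sumr; apply: eq_bigr => k _; rewrite ncM; ring.
Qed.

Lemma hnB_sym t M a a' : hn t M (fun k => a k - a' k) = hn t M (fun k => a' k - a k).
Proof. by rewrite /hn; congr Num.sqrt; apply: eq_bigr => k _; rewrite ncB. Qed.

Lemma hn_triangleB t M a a' : hn t M (fun k => a k - a' k) <= hn t M a + hn t M a'.
Proof.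
apply: le_trans (hn_triangle t M a (fun k => - a' k)) _; rewrite lerD2l.
by apply: eq_ler; rewrite /hn; congr Num.sqrt; apply: eq_bigr => k _; rewrite ncN.
Qed.

Lemma hn_lim (T : Type) (F : set_system T) (FF : ProperFilter F) t M (u : T -> int -> C) a (K : R) :
  (forall k, ccvg F (u^~ k) (a k)) -> (\forall n \near F, hn t M (u n) <= K) -> hn t M a <= K.
Proof.
move=> ua uK; have [n0 hn0] := filter_ex uK.
have K0 := le_trans (hn_ge0 t M _) hn0.
rewrite -[leRHS](ger0_norm K0) -sqrtr_sqr ler_wsqrtr//.
apply: (@ccvg_sum_le _ _ F _ _ xpredT _ 2 u) => //.
move: uK; apply: filterS => n h; rewrite -hn_sqr; apply: lerXn2r h; rewrite ?nnegrE//.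
Qed.

(* The coefficient sequences of the ball of radius K in the homogeneous Sobolev space. *)
Definition hball t (K : R) a := [/\ csym a, a 0 = 0 & forall M, hn t M a <= K].

Lemma hn_ctail t K a : 2^-1 < t -> (forall M, hn t M a <= K) ->
  exists2 d : nat -> R, d @ \oo --> 0 & ctail d a.
Proof.
(* Since q > 0 and q + 1/2 < t, the decay estimate applies with q in place of p. *)
move=> t2 aK; pose q := (t - 2^-1) / 2.
have q0 : 0 < q by rewrite /q; lra.
have qt : q + 2^-1 < t by rewrite /q; lra.
have K0 : 0 <= K := le_trans (hn_ge0 t 0 a) (aK 0%N).
exists (dec1 q t K); first exact: dec1_cvg.
exact: wcoef_ctail (wcoef_hn q0 qt aK).
Qed.

Lemma hball_synth t K a : 2^-1 < t -> hball t K a ->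
  [/\ periodicL1 (synth a), fourier (synth a) = a, Hdot t (synth a) & Hdot_norm t (synth a) <= K].
Proof.
move=> t2 [ca a0 aK]; have [d d0 da] := hn_ctail t2 aK.
have e : fourier (synth a) = a by apply/funext => k; exact: (fourier_synth d0 da k ca).
have pa := synth_periodicL1 d0 da.
by have [|M|h1 h2] := @Hdot_intro _ t (synth a) K pa; rewrite ?e.
Qed.

Lemma hball_synthB t K K' D a a' : 2^-1 < t -> hball t K a -> hball t K' a' ->
  (forall M, hn t M (fun k => a k - a' k) <= D) ->
  Hdot_norm t (fun x => synth a x - synth a' x) <= D.
Proof.
move=> t2 ha ha' aD; have [[p1 i1] e1 _ _] := hball_synth t2 ha; have [[p2 i2] e2 _ _] := hball_synth t2 ha'.
have e k : fourier (fun x => synth a x - synth a' x) k = a k - a' k by rewrite fourierB// e1 e2.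
have [_ a0 _] := ha; have [_ a0' _] := ha'.
have [||M|] // := @Hdot_intro _ t (fun x => synth a x - synth a' x) D.
- by split; [move=> x; rewrite p1 p2|exact: intgB].
- by rewrite e a0 a0' subrr.
- by rewrite (hn_eq t M e).
Qed.

Lemma hn_deriv t M a : 0 < t -> hn (t - 1) M (deriv a) = hn t M a.
Proof.
move=> t0; rewrite /hn; congr Num.sqrt; apply: eq_bigr => k _.
have [->|k0] := eqVneq k 0; first by rewrite /deriv mulr0z mulr0 mul0r nc0 expr0n mulr0 wp0 ?mul0r// mulf_neq0// gt_eqF.
rewrite /deriv !ncM nc_i mul1r nc_int exprMn mulrA; congr (_ * _).
by rewrite !wp_sqr -exprMn -wp1 -wpD// subrK.
Qed.

Lemma hn_scale t M a (w : int -> R) : (forall k, 0 <= w k) -> (forall k, k != 0 -> w k <= 1) -> a 0 = 0 ->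
  hn t M (fun k => (w k)%:C%C * a k) <= hn t M a.
Proof.
move=> w0 w1 a0; rewrite /hn ler_wsqrtr//; apply: ler_sum => k _.
apply: ler_wpM2l; first exact: wp_ge0.
have [->|k0] := eqVneq k 0; first by rewrite a0 mulr0 nc0.
rewrite ncM nc_real (ger0_norm (w0 k)) exprMn ler_piMl ?sqr_ge0//.
by apply: exprn_ile1; [exact: w0|exact: w1].
Qed.

End SobolevSequences.

(** * The field on infinite sequences *)

Section LimitField.
Variables (R : realType) (p s : R).
Hypotheses (p12 : 1 <= p <= 2) (ps : p + 2^-1 < s).
Local Notation C := R[i].
Implicit Types (a : int -> C).

(** For an infinite sequence the triple sum is replaced by the coefficients of the flux as a
    function; [fluxc_low] identifies them as limits of the finite sums, through which all bounds are
    inherited. *)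
Definition fluxc a : int -> C := fourier (flux p (synth a)).

Section Truncations.
Variables (K : R) (a : int -> C).
Hypothesis ha : hball s K a.

Let low_sym n : csym (low n a). Proof. by case: ha => h _ _; exact: csym_low. Qed.
Let low0 n : low n a 0 = 0. Proof. by case: ha => _ h _; rewrite /low; case: (_ <= _)%N. Qed.
Let lowK n M : hn s M (low n a) <= K.
Proof. by case: ha => _ _ h; exact: le_trans (hn_low _ _ _ _) (h M). Qed.

Lemma hball_powD m : (0 < m <= 3)%N ->
  is_absD p (fun x => synth a x ^+ m) (absd p (fun x => synth a x ^+ m)).
Proof.
exact: (pow_absD p12 ps (F := \oo) (N := id) (fun n => @supp_low _ n a) low_sym low0 lowK (ccvg_low a)).
Qed.

Lemma hball_flux_periodicL1 : periodicL1 (flux p (synth a)).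
Proof.
exact: (flux_periodicL1 p12 ps (F := \oo) (N := id) (fun n => @supp_low _ n a) low_sym low0 lowK (ccvg_low a)).
Qed.

Lemma fluxc_low k : ccvg \oo (fun n => flux3 p n (low n a) (low n a) (low n a) k) (fluxc a k).
Proof.
exact: (flux_ccvg p12 ps (F := \oo) (N := id) (fun n => @supp_low _ n a) low_sym low0 lowK (ccvg_low a)).
Qed.

Lemma fluxc_hn M : hn s M (fluxc a) <= tri_const p s * K ^+ 3.
Proof.
apply: (hn_lim _ fluxc_low); apply: nearW => n.
apply: le_trans (flux3_hn p12 ps n M _ _ _) _.
have := tri_const_ge0 s p12; move: (tri_const p s) => B B0.
rewrite -!mulrA; apply: ler_wpM2l => //.
have h := lowK n n; have h0 := hn_ge0 s n (low n a).
by rewrite !exprS expr0 mulr1; apply: ler_pM => //; [exact: mulr_ge0|exact: ler_pM].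
Qed.

Lemma fluxc_sym : csym (fluxc a).
Proof. by apply: fourier_csym; case: hball_flux_periodicL1. Qed.

End Truncations.

Lemma fluxc_diff K D a a' M : hball s K a -> hball s K a' ->
  (forall M, hn s M (fun k => a k - a' k) <= D) ->
  hn s M (fun k => fluxc a k - fluxc a' k) <= 3 * tri_const p s * K ^+ 2 * D.
Proof.
move=> ha ha' aD.
pose u n k := flux3 p n (low n a) (low n a) (low n a) k - flux3 p n (low n a') (low n a') (low n a') k.
apply: (@hn_lim _ _ \oo _ s M u).
  move=> k; rewrite /u -[- fluxc a' k]mulN1r.
  under eq_fun do rewrite -[X in _ + X]mulN1r.
  by apply: ccvgD; [exact: fluxc_low ha k|apply: ccvgZ; exact: fluxc_low ha' k].
apply: nearW => n; pose w k := low n a k - low n a' k.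
have [_ _ aK] := ha; have [_ _ aK'] := ha'.
have K0 : 0 <= K := le_trans (hn_ge0 s 0 a) (aK 0%N).
have hK : hn s n (low n a) <= K := le_trans (hn_low _ _ _ _) (aK n).
have hK' : hn s n (low n a') <= K := le_trans (hn_low _ _ _ _) (aK' n).
have hD : hn s n w <= D.
  have e k : w k = low n (fun k => a k - a' k) k by rewrite /w /low; case: ifP; rewrite ?subr0.
  by rewrite (hn_eq s n e); exact: le_trans (hn_low _ _ _ _) (aD n).
have D0 := le_trans (hn_ge0 s n w) hD.
have b x y : hn s n x <= K -> hn s n y <= K -> hn s M (flux3 p n w x y) <= tri_const p s * K ^+ 2 * D.
  move=> hx hy; apply: le_trans (flux3_hn p12 ps n M _ _ _) _.
  have := tri_const_ge0 s p12; move: (tri_const p s) => B B0.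
  rewrite (_ : _ * _ = B * (hn s n x * hn s n y * hn s n w)); last by ring.
  rewrite -[leRHS]mulrA; apply: ler_wpM2l => //.
  have hx0 := hn_ge0 s n x; have hy0 := hn_ge0 s n y; have hw0 := hn_ge0 s n w.
  by rewrite expr2; apply: ler_pM; rewrite ?mulr_ge0//; apply: ler_pM.
rewrite (hn_eq s M (fun k => flux3_diff p n (low n a) (low n a') k)).
apply: le_trans (hn_triangle _ _ _ _) _; apply: le_trans (lerD (hn_triangle _ _ _ _) (lexx _)) _.
apply: le_trans (lerD (lerD (b _ _ hK hK) (b _ _ hK' hK)) (b _ _ hK' hK')) _.
by apply: eq_ler; ring.
Qed.

Variables (b c : R).

Definition limfld a : int -> C := vfield p b c (fluxc a) a.

Lemma limfld_hball K a : hball s K a -> hball (s - 1) (fld_const p s b c K) (limfld a).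
Proof.
move=> ha; have [ca a0 aK] := ha; split.
- move=> k; rewrite /limfld /vfield (fluxc_sym ha) ca wpN intrN.
  by rewrite !(conjN, conjM, conjD, conjc_real, conj_int, conj_i); ring.
- exact: vfield0.
- move=> M; apply: le_sqrt; apply: le_trans (vfield_hn s b c p12 M _ _) _.
  have K0 : 0 <= K := le_trans (hn_ge0 s 0 a) (aK 0%N).
  rewrite ler_wpM2l//; apply: lerD; rewrite ler_wpM2l ?sqr_ge0//; apply: lerXn2r; rewrite ?nnegrE ?hn_ge0//.
    by rewrite mulr_ge0 ?tri_const_ge0 ?exprn_ge0.
  exact: fluxc_hn.
Qed.

Definition limfld_lip (K : R) : R :=
  Num.sqrt (2 * (c ^+ 2 * (3 * tri_const p s * K ^+ 2) ^+ 2 + b ^+ 2)).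

Lemma limfld_diff K D a a' M : hball s K a -> hball s K a' ->
  (forall M, hn s M (fun k => a k - a' k) <= D) ->
  hn (s - 1) M (fun k => limfld a k - limfld a' k) <= limfld_lip K * D.
Proof.
move=> ha ha' aD; have D0 := le_trans (hn_ge0 s 0 _) (aD 0%N).
have e k : limfld a k - limfld a' k =
    vfield p b c (fun k => fluxc a k - fluxc a' k) (fun k => a k - a' k) k.
  by rewrite /limfld /vfield; move: (fluxc a k) (fluxc a' k) (b * _)%:C%C c%:C%C => X X' B c'; ring.
rewrite (hn_eq _ M e) -[D]ger0_norm// -sqrtr_sqr -sqrtrM; last first.
  by rewrite mulr_ge0// addr_ge0//; [apply: mulr_ge0; exact: sqr_ge0|exact: sqr_ge0].
apply: le_sqrt; apply: le_trans (vfield_hn s b c p12 M _ _) _.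
rewrite -[leRHS]mulrA ler_wpM2l// mulrDl; apply: lerD; last first.
  by rewrite ler_wpM2l ?sqr_ge0//; apply: lerXn2r; rewrite ?nnegrE ?hn_ge0.
rewrite -[leRHS]mulrA ler_wpM2l ?sqr_ge0// -exprMn; apply: lerXn2r; rewrite ?nnegrE ?hn_ge0//.
  rewrite mulr_ge0// mulr_ge0 ?sqr_ge0// mulr_ge0// tri_const_ge0//.
exact: (fluxc_diff M ha ha').
Qed.

End LimitField.

Section FrontEquation.
Variables (R : realType) (alpha s : R).
Hypotheses (alpha_gt1 : 1 < alpha) (alpha_le2 : alpha <= 2) (s_gt : 7 / 2 - alpha < s).
Local Notation C := R[i].
Local Notation p := (3 - alpha).
Local Notation b := (b_coef alpha).
Local Notation c := (2^-1 * c_coef alpha).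

Let p12 : 1 <= p <= 2.
Proof. by have h1 := alpha_gt1; have h2 := alpha_le2; apply/andP; split; lra. Qed.
Let ps : p + 2^-1 < s. Proof. by have h := s_gt; lra. Qed.
Let s1_gt : 2^-1 < s - 1.
Proof. by have ps' := ps; have [p1 _] := andP p12; lra. Qed.

Let s_gt2 : 2^-1 < s. Proof. by have h := s1_gt; lra. Qed.

Lemma hball_deriv K (a : int -> C) : csym a -> (forall M, hn s M a <= K) -> hball (s - 1) K (deriv a).
Proof.
move=> ca aK; split; first exact: csym_deriv.
  by rewrite /deriv mulr0z mulr0 mul0r.
by move=> M; rewrite hn_deriv//; have h := s_gt2; lra.
Qed.

(** Every term is taken as the sum of a Fourier series. The equation then holds coefficient by
    coefficient by definition of [limfld], hence almost everywhere by uniqueness of coefficients. *)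
Lemma front_equation_synth K (a : int -> C) : hball s K a ->
  front_equation alpha (synth a) (synth (limfld p b c a)).
Proof.
move=> ha; have [ca a0 aK] := ha; have [pa ea _ _] := hball_synth s_gt2 ha.
have hd := hball_deriv ca aK; have [pd ed _ _] := hball_synth s1_gt hd.
have hF := hball_deriv (fluxc_sym p12 ps ha) (fluxc_hn p12 ps ha).
have [pF eF _ _] := hball_synth s1_gt hF.
have e1 : 1 - alpha = p - 2 by ring.
pose m k := (wp (1 - alpha) k)%:C%C * deriv a k.
have hm : hball (s - 1) K m.
  have [cd d0 dK] := hd; split.
  - by move=> k; rewrite /m wpN cd [RHS]conjM conjc_real.
  - by rewrite /m d0 mulr0.
  - move=> M; apply: le_trans (hn_scale _ _ _ _ d0) (dK M) => k; first exact: wp_ge0.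
    by move=> k0; apply: wp_le1 => //; have h := alpha_gt1; lra.
have [pm em _ _] := hball_synth s1_gt hm.
have [pv ev _ _] := hball_synth s1_gt (limfld_hball p12 ps b c ha).
exists (absd p (synth a)), (absd p (fun x => synth a x ^+ 2)), (absd p (fun x => synth a x ^+ 3)).
exists (synth (deriv (fluxc p a))), (synth (deriv a)), (synth m); split.
  split; [exact: (hball_powD p12 ps ha (m := 1) isT)|exact: (hball_powD p12 ps ha (m := 2) isT)|].
  exact: (hball_powD p12 ps ha (m := 3) isT).
have [dF dF0 tF] := hn_ctail s_gt2 (fluxc_hn p12 ps ha).
have [_ _ hF'] := hF; have [dF' dF'0 tF'] := hn_ctail s1_gt hF'.
have [da da0 ta] := hn_ctail s_gt2 aK.
have [_ _ hd'] := hd; have [dd dd0 td] := hn_ctail s1_gt hd'.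
split.
- apply: (fourier_weak_derivative (hball_flux_periodicL1 p12 ps ha) pF dF0 dF'0 tF); first by rewrite eF.
  by move=> k; rewrite eF.
- apply: (fourier_weak_derivative pa pd da0 dd0); rewrite ?ea ?ed//.
- split => //; rewrite ?em ?ed//; first by rewrite /deriv mulr0z mulr0 mul0r.
  by rewrite /m /deriv mulr0z mulr0 mul0r mulr0.
- have [[q1 j1] [q2 j2] [q3 j3]] : [/\ periodicL1 (synth (limfld p b c a)),
     periodicL1 (synth (deriv (fluxc p a))) & periodicL1 (synth m)] by [].
  apply: fourier_eq0.
  + by move=> x; rewrite q1 q2 q3.
  + by apply: intgD; [apply: intgD|]; [|exact: intgZ|exact: intgZ].
  + move=> k; rewrite (fourierD _ (intgD j1 (intgZ _ j2)) (intgZ _ j3)) (fourierD _ j1 (intgZ _ j2)).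
    rewrite (fourierZ _ _ j2) (fourierZ _ _ j3) ev eF em /limfld /vfield /m /deriv e1 rcM.
    move: (fluxc _ _ k) (wp _ _)%:C%C c%:C%C b%:C%C => X Y c' b'; ring.
Qed.

End FrontEquation.

Lemma norm_le_nat (R : realType) (k : int) (M : nat) : (`|k%:~R : R| <= M%:R) = (`|k| <= M)%N.
Proof. by rewrite -intr_norm -[M%:R]/((M%:Z)%:~R) ler_int -abszE lez_nat. Qed.

(** * Existence *)

Section UltrafilterLimit.
Variables (R : realType) (U : set_system nat).
Context {UU : UltraFilter U}.
Local Notation C := R[i].
Local Notation nc := (@ComplexField.Normc.normc R).

(** The image of an ultrafilter in a compact interval is an ultrafilter and converges. A single U
    thus serves all frequencies and all real times at once, where subsequences would have to be
    extracted and compared. *)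
Lemma ultra_cvg (u : nat -> R) (B : R) : (forall n, `|u n| <= B) -> exists l : R, u n @[n --> U] --> l.
Proof.
move=> uB; have cAB : compact (`[- B, B]%classic : set R) by exact: segment_compact.
move: cAB; rewrite compact_ultra => /(_ (u @ U) _ _)[||l [_ ul]]; last by exists l.
- split => [|G FG sG]; first exact: fmap_proper_filter.
  apply/seteqP; split=> // A GA; have [//|UA] := in_ultra_setVsetC (u @^-1` A) UU.
  have : G (~` A) by exact: sG.
  by move=> GA'; case: (@filter_not_empty _ G FG); rewrite -(setICr A); exact: filterI.
- by apply: nearW => n; rewrite /= in_itv/= -ler_norml.
Qed.

Lemma ultra_ccvg (u : nat -> C) (B : R) : (forall n, nc (u n) <= B) -> exists l, ccvg U u l.
Proof.
move=> uB.
have [x ux] := ultra_cvg (u := fun n => complex.Re (u n)) (fun n => le_trans (Re_le_nc _) (uB n)).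
have [y uy] := ultra_cvg (u := fun n => complex.Im (u n)) (fun n => le_trans (Im_le_nc _) (uB n)).
exists (x +i* y)%C => e e0; have e2 : 0 < e / 2 by rewrite divr_gt0.
move/cvgrPdist_le: ux => /(_ _ e2) ux; move/cvgrPdist_le: uy => /(_ _ e2) uy.
near=> n; apply: le_trans (nc_leReIm _) _; rewrite !raddfB/= distrC [`|complex.Im _ - _|]distrC.
have h1 : `|x - complex.Re (u n)| <= e / 2 by near: n.
have h2 : `|y - complex.Im (u n)| <= e / 2 by near: n.
lra.
Unshelve. all: by end_near. Qed.

End UltrafilterLimit.

(** * The limit of the truncated scheme *)

Section GalerkinLimit.
Variables (R : realType) (p s b c : R).
Hypotheses (p12 : 1 <= p <= 2) (ps : p + 2^-1 < s).
Local Notation C := R[i].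
Local Notation nc := (@ComplexField.Normc.normc R).
Variables (a0 : int -> C) (E0 : R).
Hypotheses (a0_sym : csym a0) (a00 : a0 0 = 0) (E0_ge0 : 0 <= E0).
Hypothesis a0_bound : forall M, hn s M a0 ^+ 2 <= E0.
Local Notation K := (ebound E0).
Local Notation T := (lifespan p s c E0).
Local Notation galN := (gal p s b c a0 E0).
Local Notation h := (hstep p s b c E0).
Local Notation V := (fld_const p s b c K).

Variable U : set_system nat.
Context {UU : UltraFilter U}.
Hypothesis Uoo : \oo `<=` U.

Let s_ge0 : 0 <= s.
Proof. by have ps' := ps; have [p1 _] := andP p12; lra. Qed.

(** The default value 0 can occur only outside [0, T]; inside, the limit exists by boundedness. *)
Definition galim (t : R) (k : int) : C := xget 0 [set l | ccvg U (fun N => galN N t k) l].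

Lemma galim_ccvg t k : 0 <= t <= T -> ccvg U (fun N => galN N t k) (galim t k).
Proof.
move=> tT; have [|l hl] := @ultra_ccvg R U UU (fun N => galN N t k) K; last exact: (xgetPex _ (ex_intro _ l hl)).
move=> N; have [->|k0] := eqVneq k 0.
  by rewrite /gal eul_at0// nc0 ebound_ge0.
exact: nc_le_hn (leqnn _) k0 s_ge0 (gal_bound b p12 ps a0_sym a0_bound N _ tT).
Qed.

Lemma galim_hball t : 0 <= t <= T -> hball s K (galim t).
Proof.
move=> tT; have lim k := galim_ccvg k tT; split.
- apply: (@ccvg_csym _ _ U _ (fun N => galN N t)) => // N; exact: eul_csym.
- apply: nc_eq0; apply/eqP; rewrite eq_le nc_ge0 andbT.
  by apply: (ccvg_le (lim 0)); apply: nearW => N; rewrite /gal eul_at0// nc0.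
- move=> M; apply: (hn_lim _ lim); apply: nearW => N; exact: gal_bound.
Qed.

Lemma galim0 k : galim 0 k = a0 k.
Proof.
have T0 : 0 <= (0 : R) <= T by rewrite lexx ltW// lifespan_gt0.
have l1 := galim_ccvg k T0.
have l2 : ccvg U (fun N => galN N 0 k) (a0 k).
  under eq_fun do rewrite gal0; move=> e e0; apply: Uoo; exact: ccvg_low.
exact: ccvg_unique l1 l2.
Qed.

Let hstep_small (e : R) : 0 < e -> \forall N \near U, h N <= e.
Proof.
move=> e0; apply: Uoo; exists (Num.truncn e^-1) => // N /= eN.
apply: le_trans (hstep_le _ _ _ _ _ _) _.
rewrite -[e]invrK lef_pV2 ?posrE ?invr_gt0//.
apply: le_trans (ltW (truncnS_gt _)) _; by rewrite ler_nat ltnS.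
Qed.

Let galim_fld t k : 0 <= t <= T ->
  ccvg U (fun N => fld p b c N (galN N t) k) (limfld p b c (galim t) k).
Proof.
move=> tT; have ha := galim_hball tT.
have F : ccvg U (fun N => flux3 p N (galN N t) (galN N t) (galN N t) k) (fluxc p (galim t) k).
  apply: (flux_ccvg p12 ps (F := U) (N := id) (K := K)).
  - by move=> N j; exact: eul_supp.
  - by move=> N; exact: eul_csym.
  - by move=> N; exact: eul_at0.
  - by move=> N M; exact: gal_bound.
  - by move=> j; exact: galim_ccvg.
rewrite /fld /limfld /vfield; apply: ccvgZ; apply: ccvgD; apply: ccvgZ => //.
exact: galim_ccvg.
Qed.

(** As the step h tends to 0 the discretization errors in [gal_taylor] vanish and the quadratic
    remainder stays. Together with the continuity of the field in time, this expresses the equation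
    at the frequency k. *)
Lemma galim_taylor k : exists2 A, 0 <= A & forall t t', 0 <= t -> t <= t' -> t' <= T ->
  nc (galim t' k - galim t k - (t' - t)%:C%C * limfld p b c (galim t) k) <= A * (t' - t) ^+ 2.
Proof.
pose L := `|k%:~R| * lip_const p s b c K * V.
have L0 : 0 <= L by rewrite !mulr_ge0 ?fld_const_ge0 ?lip_const_ge0.
have V0 : 0 <= V by exact: fld_const_ge0.
exists L => // t t' t0 tt' t'T.
have tT : 0 <= t <= T by rewrite t0 (le_trans tt').
have tT' : 0 <= t' <= T by rewrite t'T (le_trans t0).
have cv : ccvg U (fun N => galN N t' k - galN N t k - (t' - t)%:C%C * fld p b c N (galN N t) k)
   (galim t' k - galim t k - (t' - t)%:C%C * limfld p b c (galim t) k).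
  rewrite -[- galim t k]mulN1r -[- (_ * _)]mulN1r.
  under eq_fun do rewrite -[- galN _ t k]mulN1r -[- (_ * fld _ _ _ _ _ _)]mulN1r.
  apply: ccvgD; first by apply: ccvgD; [|apply: ccvgZ]; exact: galim_ccvg.
  by apply: ccvgZ; apply: ccvgZ; exact: galim_fld.
apply/ler_addgt0Pr => e e0; apply: (ccvg_le cv).
pose D := t' - t; have D0 : 0 <= D by rewrite subr_ge0.
(* Q collects the errors of order h: for h <= d <= 1, (D + h)^2 <= D^2 + d (2 D + 1). *)
pose Q := (2 * D + 1) * L + V + 1.
have Q0 : 0 < Q.
  by rewrite /Q; have := mulr_ge0 D0 L0; have := L0; have := V0; lra.
pose d := Num.min 1 (e / Q).
have d0 : 0 < d by rewrite lt_min ltr01 divr_gt0.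
have d1 : d <= 1 by rewrite ge_min lexx.
have dQ : d * Q <= e by rewrite -ler_pdivlMr// ge_min lexx orbT.
have kU : \forall N \near U, (`|k| <= N)%N by apply: Uoo; exact: nbhs_infty_ge.
apply: filterS2 (hstep_small d0) kU => N hd kN.
apply: le_trans (gal_taylor b p12 ps a0_sym a0_bound t0 tt' t'T kN) _; rewrite -/L -/D.
have h0 := hstep_gt0 p s b c E0 N.
have m1 : (D + h N) ^+ 2 <= D ^+ 2 + d * (2 * D + 1).
  have : h N * h N <= d * 1 by apply: ler_pM => //; [exact: ltW|exact: ltW|exact: le_trans hd d1].
  have := ler_wpM2r D0 hd; nra.
have m2 : h N * V <= d * V by apply: ler_wpM2r.
apply: le_trans (lerD (ler_wpM2r L0 m1) m2) _; move: dQ; rewrite /Q.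
have -> : (D ^+ 2 + d * (2 * D + 1)) * L + d * V = L * D ^+ 2 + d * ((2 * D + 1) * L + V) by ring.
by rewrite lerD2l mulrDr mulr1 => dQ; lra.
Qed.

(** The cutoff vanishes beyond M >= 1/e, so the energy of every truncation at N >= M is one and the
    same finite sum and passes to the limit. *)
Let en_ext e M N a : (0 < M)%N -> 1 <= e * M%:R -> (M <= N)%N -> en s e N a = en s e M a.
Proof.
move=> M0 eM MN; rewrite /en (zs_split _ MN) [X in _ + X]big1 ?addr0// => k Mk.
rewrite /wcut /cutoff (_ : Num.max _ _ = 0) ?mulr0 ?mul0r//; apply/max_idPl.
rewrite subr_le0; have e0 : 0 <= e.
  by rewrite -(@pmulr_lge0 _ M%:R) ?ltr0n//; exact: le_trans eM.
apply: le_trans eM _.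
apply: ler_wpM2l => //; apply: ltW; by rewrite ltNge norm_le_nat -ltnNge.
Qed.

(* The squared norm of the limit is Lipschitz in time; together with the
   continuity of the coefficients this gives strong continuity. *)
Lemma galim_energy M0 t t' (e : R) : 0 <= t <= T -> 0 <= t' <= T -> 0 < e ->
  exists M, hn s M0 (galim t) ^+ 2 <=
    hn s M (galim t') ^+ 2 + `|t' - t| * rate p s c E0 + e.
Proof.
move=> tT tT' e0; have r0 := rate_gt0 c p12 ps E0; set r := rate p s c E0 in r0 *.
have [_ _ aK] := galim_hball tT.
(* The cutoff with parameter d removes at most the fraction d M0 of each weight up to M0, that is at
   most e / 2 of the energy; M >= 1/d below makes the weight vanish beyond M. *)
pose d := e / 2 / (M0%:R * K ^+ 2 + 1).
have D0 : 0 < M0%:R * K ^+ 2 + 1 :> R by rewrite ltr_pwDr// mulr_ge0// sqr_ge0.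
have d0 : 0 < d by rewrite !divr_gt0.
pose M := maxn M0 (Num.truncn d^-1).+1; exists M.
have M_gt0 : (0 < M)%N by rewrite leq_max orbT.
have dM : 1 <= d * M%:R.
  rewrite mulrC -ler_pdivrMr// mul1r; apply: le_trans (ltW (truncnS_gt _)) _.
  by rewrite ler_nat leq_maxr.
have s1 : hn s M0 (galim t) ^+ 2 <= en s d M (galim t) + e / 2.
  apply: (@le_trans _ _ (en s d M0 (galim t) + d * M0%:R * hn s M0 (galim t) ^+ 2)); last first.
    apply: lerD.
      apply: ler_zs; first exact: leq_maxl.
      by move=> k; rewrite mulr_ge0 ?wcut_ge0 ?sqr_ge0.
    have h1 : hn s M0 (galim t) ^+ 2 <= K ^+ 2.
      by apply: lerXn2r (aK M0); rewrite ?nnegrE ?hn_ge0// ebound_ge0.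
    rewrite -mulrA; apply: le_trans (ler_wpM2l (ltW d0) (ler_wpM2l (ler0n _ M0) h1)) _.
    have : d * (M0%:R * K ^+ 2 + 1) = e / 2 by rewrite /d divfK// gt_eqF.
    rewrite mulrDr mulr1; lra.
  rewrite hn_sqr /en mulr_sumr -big_split/= big_seq [leRHS]big_seq; apply: ler_sum => k.
  rewrite mem_zs => kM; rewrite mulrA -mulrDl; apply: ler_wpM2r; first exact: sqr_ge0.
  rewrite /wcut -{1}[wp _ k]mulr1 [d * _ * _]mulrC -mulrDr; apply: ler_wpM2l; first exact: wp_ge0.
  apply: (@le_trans _ _ (1 - d * `|k%:~R| + d * M0%:R)); last first.
    by rewrite lerD2r le_max lexx orbT.
  rewrite -addrA lerDl addrC subr_ge0 ler_wpM2l//; first exact: ltW.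
  by rewrite norm_le_nat.
have s2 : en s d M (galim t') <= hn s M (galim t') ^+ 2.
  rewrite hn_sqr; apply: ler_sum => k _; apply: ler_wpM2r; first exact: sqr_ge0.
  by apply: wcut_le; exact: ltW.
have lip : en s d M (galim t) <= en s d M (galim t') + `|t' - t| * r + e / 2.
  have cv u : 0 <= u <= T -> en s d M (galN N u) @[N --> U] --> en s d M (galim u).
    by move=> uT; apply: (ccvg_sum_cvg (P := xpredT)) => k; exact: galim_ccvg.
  have e6 : 0 < e / 6 by rewrite divr_gt0.
  have er : 0 < e / 6 / r by rewrite divr_gt0.
  move/cvgrPdist_le: (cv _ tT) => /(_ _ e6) c1; move/cvgrPdist_le: (cv _ tT') => /(_ _ e6) c2.
  have MU : \forall N \near U, (M <= N)%N by apply: Uoo; exact: nbhs_infty_ge.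
  have [N [[h1 h2] [h3 h4]]] := filter_ex (filterI (filterI c1 c2) (filterI (hstep_small er) MU)).
  have h5 : h N * r <= e / 6 by rewrite -ler_pdivlMr.
  have h6 : `|en s d N (galN N t') - en s d N (galN N t)| <= (`|t' - t| + h N) * r.
    have [tt|tt] := leP t t'.
      rewrite (ger0_norm (_ : 0 <= t' - t)) ?subr_ge0//; apply: gal_en_lip => //; first exact: ltW.
        by case/andP: tT.
      by case/andP: tT'.
    rewrite distrC (ltr0_norm (_ : t' - t < 0)) ?subr_lt0// opprB; apply: gal_en_lip => //; try exact: ltW.
      by case/andP: tT'.
    by case/andP: tT.
  move: h6; rewrite !(en_ext _ M_gt0 dM h4) mulrDl; move: h1 h2; rewrite !ler_norml.
  by move=> /andP[? ?] /andP[? ?] /andP[? ?]; lra.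
lra.
Qed.

End GalerkinLimit.

Section RealPreliminaries.
Variable R : realType.

(** Over n + 1 equal pieces the quadratic remainders add up to A (v - u)^2 / (n + 1), which tends to
    0. *)
Lemma taylor_mean_value (f g : R -> R) (A B u v : R) : u <= v ->
  (forall x y, u <= x -> x <= y -> y <= v -> `|f y - f x - (y - x) * g x| <= A * (y - x) ^+ 2) ->
  (forall x, u <= x <= v -> `|g x| <= B) -> `|f v - f u| <= B * (v - u).
Proof.
move=> uv tf gB; pose D := v - u; have D0 : 0 <= D by rewrite subr_ge0.
suff h (n : nat) : `|f v - f u| <= B * D + A * D ^+ 2 / n.+1%:R.
  apply/ler_addgt0Pr => e e0; rewrite -/D.
  pose n := Num.truncn (A * D ^+ 2 / e); apply: le_trans (h n) _; rewrite lerD2l.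
  rewrite ler_pdivrMr// [leRHS]mulrC -ler_pdivrMr//; exact: ltW (truncnS_gt _).
pose d := D / n.+1%:R; have d0 : 0 <= d by rewrite divr_ge0.
have nd : n.+1%:R * d = D by rewrite mulrC divfK// pnatr_eq0.
have step (j : nat) : (j <= n.+1)%N -> `|f (u + j%:R * d) - f u| <= j%:R * (B * d + A * d ^+ 2).
  elim: j => [|j ih] jn; first by rewrite !mul0r addr0 subrr normr0.
  have jd : j.+1%:R * d <= D by rewrite -nd ler_wpM2r// ler_nat.
  have e1 : u + j.+1%:R * d - (u + j%:R * d) = d by rewrite -natr1; ring.
  have x1 : u <= u + j%:R * d by rewrite lerDl mulr_ge0.
  have x2 : u + j%:R * d <= u + j.+1%:R * d by rewrite lerD2l ler_wpM2r// ler_nat.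
  have x3 : u + j.+1%:R * d <= v by move: jd; rewrite /D; lra.
  have h1 := tf _ _ x1 x2 x3; rewrite e1 in h1.
  have h2 : `|g (u + j%:R * d)| <= B by apply: gB; rewrite x1 (le_trans x2).
  have h3 := ih (ltnW jn).
  have h4 : `|d * g (u + j%:R * d)| <= d * B by rewrite normrM ger0_norm// ler_wpM2l.
  rewrite [leRHS](_ : _ = j%:R * (B * d + A * d ^+ 2) + (B * d + A * d ^+ 2)); last first.
    by rewrite -natr1 mulrDl mul1r.
  move: h1 h3 h4; rewrite !ler_norml.
  by move=> /andP[? ?] /andP[? ?] /andP[? ?]; apply/andP; split; lra.
have := step n.+1 (leqnn _); rewrite nd (_ : u + D = v); last by rewrite /D addrC subrK.
move=> h; apply: le_trans h _; apply: eq_ler.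
by rewrite /d; field; rewrite addrC natr1 pnatr_eq0.
Qed.

Lemma cvg0_within (g : R -> R) (D : set R) (t0 : R) :
  (forall e, 0 < e -> exists2 d, 0 < d & forall t, D t -> `|t - t0| <= d -> `|g t| <= e) ->
  g @ within D (nbhs t0) --> (0 : R).
Proof.
move=> h; apply/cvgrPdist_le => e e0; rewrite near_withinE.
have [d d0 hd] := h e e0; have : \forall t \near nbhs t0, `|t0 - t| <= d.
  by apply/nbhs_ballP; exists d => // t /= /ltW.
by apply: filterS => t td Dt; rewrite sub0r normrN; apply: hd => //; rewrite distrC.
Qed.

Lemma cvg0_dwithin (g : R -> R) (D : set R) (t0 : R) :
  (forall e, 0 < e -> exists2 d, 0 < d & forall t, D t -> t != t0 -> `|t - t0| <= d -> `|g t| <= e) ->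
  g @ within D (dnbhs t0) --> (0 : R).
Proof.
move=> h; apply/cvgrPdist_le => e e0; rewrite near_withinE near_withinE.
have [d d0 hd] := h e e0; have : \forall t \near nbhs t0, `|t0 - t| <= d.
  by apply/nbhs_ballP; exists d => // t /= /ltW.
by apply: filterS => t td tt Dt; rewrite sub0r normrN; apply: hd => //; rewrite distrC.
Qed.

End RealPreliminaries.

(** * Time regularity of the limit curve *)

Section Curve.
Variables (R : realType) (p s b c T K r : R).
Hypotheses (p12 : 1 <= p <= 2) (ps : p + 2^-1 < s).
Local Notation C := R[i].
Local Notation nc := (@ComplexField.Normc.normc R).
Local Notation F := (limfld p b c).
Variable a : R -> int -> C.
Hypothesis r_ge0 : 0 <= r.
Hypothesis a_ball : forall t, 0 <= t <= T -> hball s K (a t).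
Hypothesis a_taylor : forall k, exists2 A, 0 <= A &
  forall t t', 0 <= t -> t <= t' -> t' <= T ->
    nc (a t' k - a t k - (t' - t)%:C%C * F (a t) k) <= A * (t' - t) ^+ 2.
Hypothesis a_energy : forall M t t' (e : R), 0 <= t <= T -> 0 <= t' <= T -> 0 < e ->
  exists M', hn s M (a t) ^+ 2 <= hn s M' (a t') ^+ 2 + `|t' - t| * r + e.

Let s1_gt : 2^-1 < s - 1.
Proof. by have ps' := ps; have [p1 _] := andP p12; lra. Qed.
Let s_gt : 2^-1 < s. Proof. by have := s1_gt; lra. Qed.
Let V := fld_const p s b c K.

Lemma hn_mono M (x : int -> C) : hn (s - 1) M x <= hn s M x.
Proof.
have s1 := s1_gt; rewrite /hn ler_wsqrtr//; apply: ler_sum => k _; apply: ler_wpM2r; first exact: sqr_ge0.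
have [->|k0] := eqVneq k 0; last by apply: wp_le => //; lra.
by rewrite !wp0 ?mulf_neq0// gt_eqF//; lra.
Qed.

Lemma curve_lip k : exists2 L, 0 <= L & forall t t', 0 <= t <= T -> 0 <= t' <= T ->
  nc (a t' k - a t k) <= L * `|t' - t|.
Proof.
have [A A0 hA] := a_taylor k; have V0 : 0 <= V by exact: fld_const_ge0.
have [Tn|T0] := ltP T 0.
  by exists 0 => // t t' /andP[t0 tT]; have := le_lt_trans (le_trans t0 tT) Tn; rewrite ltxx.
exists (A * T + V); first by rewrite addr_ge0// mulr_ge0.
suff ord t t' : 0 <= t -> t <= t' -> t' <= T -> nc (a t' k - a t k) <= (A * T + V) * (t' - t).
  move=> t t' /andP[t0 tT] /andP[t0' tT']; have [tt|tt] := leP t t'.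
    by rewrite ger0_norm ?subr_ge0//; exact: ord.
  by rewrite ncB distrC gtr0_norm ?subr_gt0//; apply: ord => //; exact: ltW.
move=> t0 tt tT; pose D := t' - t; have D0 : 0 <= D by rewrite subr_ge0.
have DT : D <= T by rewrite /D; lra.
have tT' : 0 <= t <= T by rewrite t0 (le_trans tt).
have [_ F0 FV] := limfld_hball p12 ps b c (a_ball tT').
have fv : nc (F (a t) k) <= V.
  have [->|k0] := eqVneq k 0; first by rewrite F0 nc0.
  by apply: nc_le_hn (leqnn _) k0 _ (FV _); have := s1_gt; lra.
rewrite -[a t' k - a t k](subrK ((t' - t)%:C%C * F (a t) k)).
apply: le_trans (nc_leD _ _) _; apply: le_trans (lerD (hA _ _ t0 tt tT) (lexx _)) _.
rewrite ncM nc_real -/D (ger0_norm D0).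
have h1 : A * D ^+ 2 <= A * T * D by rewrite expr2 -mulrA ler_wpM2l// ler_wpM2r.
have h2 : D * nc (F (a t) k) <= V * D by rewrite mulrC ler_wpM2r.
by rewrite [leRHS]mulrDl; exact: lerD.
Qed.

Lemma curve_hn_lip M : exists2 L, 0 <= L & forall t t', 0 <= t <= T -> 0 <= t' <= T ->
  hn s M (fun k => a t' k - a t k) <= L * `|t' - t|.
Proof.
have /choice[L hL] k : exists L : R, 0 <= L /\ forall t t', 0 <= t <= T -> 0 <= t' <= T ->
    nc (a t' k - a t k) <= L * `|t' - t|.
  by have [L L0 hL] := curve_lip k; exists L.
exists (Num.sqrt (\sum_(k <- zs M) wp (2 * s) k * L k ^+ 2)) => [|t t' tT tT']; first exact: sqrtr_ge0.
rewrite -[`|t' - t|]normr_id -sqrtr_sqr -sqrtrM; last first.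
  by apply: sumr_ge0 => k _; rewrite mulr_ge0 ?wp_ge0 ?sqr_ge0.
rewrite /hn ler_wsqrtr// mulr_suml; apply: ler_sum => k _.
rewrite -mulrA -exprMn; apply: ler_wpM2l; first exact: wp_ge0.
by have [L0 h] := hL k; apply: lerXn2r (h _ _ tT tT'); rewrite ?nnegrE ?nc_ge0// mulr_ge0.
Qed.

Lemma curve_energy_tail t0 (e : R) : 0 <= t0 <= T -> 0 < e ->
  exists M0, forall M, hn s M (a t0) ^+ 2 <= hn s M0 (a t0) ^+ 2 + e.
Proof.
move=> tT e0; pose S := [set hn s M (a t0) ^+ 2 | M in [set: nat]].
have [_ _ aK] := a_ball tT.
have hS : has_sup S.
  split; first by exists (hn s 0 (a t0) ^+ 2); exists 0%N.
  exists (K ^+ 2) => _ [M _ <-]; apply: lerXn2r (aK M); rewrite ?nnegrE ?hn_ge0//.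
  exact: le_trans (hn_ge0 _ _ _) (aK 0%N).
have [_ [M0 _ <-] h] := sup_adherent e0 hS; exists M0 => M.
have : hn s M (a t0) ^+ 2 <= sup S by apply: sup_upper_bound => //; exists M.
by move: h; lra.
Qed.

(** Up to M0 the coefficients are Lipschitz in time. Beyond M0 the energy at time t is the total
    minus the low part; by [a_energy] the total hardly exceeds the one at t0, and the low part is
    close to the one at t0, so the tail is as small as that at t0, where M0 was chosen. *)
Lemma curve_continuous t0 (e : R) : 0 <= t0 <= T -> 0 < e ->
  exists2 d, 0 < d & forall t, 0 <= t <= T -> `|t - t0| <= d ->
    forall M, hn s M (fun k => a t k - a t0 k) <= e.
Proof.
(* The tails at t and t0 contribute 2 (2 x + x) = e^2 / 2; the terms proportional to |t - t0| are
   collected in Q and use the other half. *)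
move=> t0T e_gt0; pose x := e ^+ 2 / 12; have x0 : 0 < x by rewrite divr_gt0// exprn_gt0.
have [M0 hM0] := curve_energy_tail t0T x0; have [L L0 hL] := curve_hn_lip M0.
have [_ _ aK0] := a_ball t0T; have K0 : 0 <= K := le_trans (hn_ge0 _ _ _) (aK0 0%N).
have T0 : 0 <= T by case/andP: t0T => h1 h2; exact: le_trans h2.
pose Q := L ^+ 2 * T + 2 * r + 4 * K * L + 1.
have Q0 : 0 < Q.
  rewrite /Q ltr_pwDr// !addr_ge0//; by rewrite !mulr_ge0.
pose d := e ^+ 2 / 2 / Q; have d0 : 0 < d by rewrite !divr_gt0// exprn_gt0.
exists d => // t tT td M; have [_ _ aK] := a_ball tT.
pose D := `|t - t0|; have D0 : 0 <= D by exact: normr_ge0.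
have DT : D <= T.
  by rewrite /D ler_norml; case/andP: tT => ? ?; case/andP: t0T => ? ?; apply/andP; split; lra.
have dQ : D * Q <= e ^+ 2 / 2 by rewrite -ler_pdivlMr.
rewrite -[e]gtr0_norm// -sqrtr_sqr; apply: le_sqrt.
pose w k := a t k - a t0 k.
have w0 M' : 0 <= hn s M' w by exact: hn_ge0.
have eta : hn s M0 w <= L * D by exact: hL.
have low2 : hn s M0 (a t0) ^+ 2 - hn s M0 (a t) ^+ 2 <= 2 * K * (L * D).
  have h1 : hn s M0 (a t0) <= hn s M0 w + hn s M0 (a t).
    rewrite [hn s M0 w]hnB_sym; apply: le_trans _ (hn_triangle _ _ _ _).
    by apply: eq_ler; apply: hn_eq => k; rewrite subrK.
  have h2 := aK M0; have h3 := aK0 M0; have h4 := hn_ge0 s M0 (a t); have h5 := hn_ge0 s M0 (a t0).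
  rewrite subr_sqr [leRHS]mulrC; apply: (@le_trans _ _ (L * D * (hn s M0 (a t0) + hn s M0 (a t)))).
    by apply: ler_wpM2r; [exact: addr_ge0|lra].
  by apply: ler_wpM2l; [exact: mulr_ge0|lra].
have tail (M' : nat) : hn s M' (a t) ^+ 2 <= hn s M0 (a t) ^+ 2 + (2 * K * (L * D) + D * r + 2 * x).
  have [M1 h1] := a_energy M' tT t0T x0; have h2 := hM0 M1.
  by move: h1; rewrite distrC -/D; lra.
pose N := maxn M0 M; have MN : (M0 <= N)%N by exact: leq_maxl.
apply: (@le_trans _ _ (hn s N w ^+ 2)).
  by apply: lerXn2r; rewrite ?nnegrE ?hn_ge0//; apply: hn_homo; exact: leq_maxr.
have split_tail y : \sum_(k <- zs N | (M0 < `|k|)%N) wp (2 * s) k * nc (y k) ^+ 2 = hn s N y ^+ 2 - hn s M0 y ^+ 2.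
  by rewrite !hn_sqr (zs_split _ MN) addrC addKr.
rewrite hn_sqr (zs_split _ MN) -hn_sqr.
have hi : \sum_(k <- zs N | (M0 < `|k|)%N) wp (2 * s) k * nc (w k) ^+ 2 <=
    2 * ((hn s N (a t) ^+ 2 - hn s M0 (a t) ^+ 2) + (hn s N (a t0) ^+ 2 - hn s M0 (a t0) ^+ 2)).
  rewrite -!split_tail -big_split/= mulr_sumr; apply: ler_sum => k _.
  rewrite -mulrDr [leRHS]mulrCA; apply: ler_wpM2l; first exact: wp_ge0.
  by apply: le_trans (nc_sqrD_le _ _) _; rewrite ncN.
have h3 := tail N; have h4 := hM0 N.
have h5 : hn s M0 w ^+ 2 <= L ^+ 2 * T * D.
  apply: (@le_trans _ _ ((L * D) ^+ 2)).
    by apply: lerXn2r eta; rewrite ?nnegrE// mulr_ge0.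
  by rewrite exprMn -mulrA ler_wpM2l ?sqr_ge0// expr2 ler_wpM2r.
have h6 : x = e ^+ 2 / 12 by [].
move: dQ; rewrite /Q.
have -> : D * (L ^+ 2 * T + 2 * r + 4 * K * L + 1) = L ^+ 2 * T * D + 2 * (D * r) + 2 * (2 * K * (L * D)) + D by ring.
lra.
Qed.

Lemma curve_field_continuous t0 (e : R) : 0 <= t0 <= T -> 0 < e ->
  exists2 d, 0 < d & forall t, 0 <= t <= T -> `|t - t0| <= d ->
    forall M, hn (s - 1) M (fun k => F (a t) k - F (a t0) k) <= e.
Proof.
move=> t0T e0; pose L := limfld_lip p s b c K.
have L0 : 0 <= L by exact: sqrtr_ge0.
have x0 : 0 < e / (L + 1) by rewrite divr_gt0// ltr_pwDr.
have [d d0 hd] := curve_continuous t0T x0; exists d => // t tT td M.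
apply: le_trans (limfld_diff p12 ps b c M (a_ball tT) (a_ball t0T) (hd t tT td)) _.
rewrite -/L mulrCA -[leRHS]mulr1; apply: ler_wpM2l; first exact: ltW.
by rewrite ler_pdivrMr ?mul1r ?lerDl ?ltr_pwDr.
Qed.

(** Mean value inequality in a Hilbert space: the remainder Z is paired with its own final value Y,
    the scalar [taylor_mean_value] applies, and a factor equal to the norm of Y is cancelled. *)
Lemma curve_derivable t0 t (e : R) M : 0 <= t0 <= T -> 0 <= t <= T ->
  (forall u, 0 <= u <= T -> `|u - t0| <= `|t - t0| ->
     hn (s - 1) M (fun k => F (a u) k - F (a t0) k) <= e) ->
  hn (s - 1) M (fun k => a t k - a t0 k - (t - t0)%:C%C * F (a t0) k) <= e * `|t - t0|.
Proof.
move=> t0T tT hF.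
pose Z u k := a u k - a t0 k - (u - t0)%:C%C * F (a t0) k.
pose Y := Z t; have Y0 : 0 <= hn (s - 1) M Y by exact: hn_ge0.
have e0 : 0 <= e by apply: le_trans (hF t0 t0T _); rewrite ?hn_ge0// subrr normr0.
pose pr (X : int -> C) := \sum_(k <- zs M) wp (2 * (s - 1)) k * complex.Re ((Y k)^*%C * X k).
have prB X X' : pr X - pr X' = pr (fun k => X k - X' k).
  by rewrite /pr -sumrB; apply: eq_bigr => k _; rewrite -mulrBr -raddfB/= -mulrBr.
have prZ (z : R) X : z * pr X = pr (fun k => z%:C%C * X k).
  rewrite /pr mulr_sumr; apply: eq_bigr => k _; rewrite mulrCA; congr (_ * _).
  by case: (Y k) (X k) => y1 y2 [x1 x2] /=; ring.
have pr_le X : `|pr X| <= hn (s - 1) M Y * hn (s - 1) M X.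
  apply: le_trans (ler_norm_sum _ _ _) _; rewrite !hn_sqr'.
  apply: le_trans (cauchy_schwarz _ _ _); apply: ler_sum => k _.
  rewrite normrM (ger0_norm (wp_ge0 _ _)) wp_sqr expr2 mulrACA; apply: ler_wpM2l.
    by rewrite mulr_ge0 ?wp_ge0.
  by apply: le_trans (Re_le_nc _) _; rewrite ncM nc_conj.
have /choice[A hA] k : exists A : R, 0 <= A /\ forall t t', 0 <= t -> t <= t' -> t' <= T ->
    nc (a t' k - a t k - (t' - t)%:C%C * F (a t) k) <= A * (t' - t) ^+ 2.
  by have [A A0 h] := a_taylor k; exists A.
pose B := hn (s - 1) M Y * hn (s - 1) M (fun k => (A k)%:C%C).
have ty u v : 0 <= u -> u <= v -> v <= T ->
    `|pr (Z v) - pr (Z u) - (v - u) * pr (fun k => F (a u) k - F (a t0) k)| <= B * (v - u) ^+ 2.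
  move=> u0 uv vT; rewrite prB prZ prB; apply: le_trans (pr_le _) _.
  rewrite /B -mulrA; apply: ler_wpM2l => //.
  rewrite -[X in _ <= _ * X]ger0_norm ?sqr_ge0// -nc_real mulrC -hnZ.
  rewrite /hn ler_wsqrtr//; apply: ler_sum => k _; apply: ler_wpM2l; first exact: wp_ge0.
  apply: lerXn2r; rewrite ?nnegrE ?nc_ge0//.
  have [A0 h] := hA k; rewrite ncM !nc_real ger0_norm ?sqr_ge0// (ger0_norm A0) [leRHS]mulrC.
  apply: le_trans (h _ _ u0 uv vT); apply: eq_ler; congr nc.
  have -> : (v - u)%:C%C = (v - t0)%:C%C - (u - t0)%:C%C by rewrite -rmorphB/=; congr (_%:C%C); ring.
  by rewrite /Z; move: (F (a u) k) (F (a t0) k) (v - t0)%:C%C (u - t0)%:C%C => X1 X2 w1 w2; ring.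
have gB u : 0 <= u <= T -> `|u - t0| <= `|t - t0| ->
    `|pr (fun k => F (a u) k - F (a t0) k)| <= hn (s - 1) M Y * e.
  by move=> uT ut; apply: le_trans (pr_le _) _; apply: ler_wpM2l => //; exact: hF.
have Zt0 : pr (Z t0) = 0.
  rewrite /pr big1// => k _; rewrite /Z !subrr mul0r subr0 mulr0.
  by rewrite /= mulr0.
have prY : pr (Z t) = hn (s - 1) M Y ^+ 2.
  by rewrite hn_sqr; apply: eq_bigr => k _; rewrite -/Y ReM_conj.
apply: le_of_sqr_le => //; first by rewrite mulr_ge0.
rewrite -/Y -prY -[pr (Z t)]subr0 -Zt0 mulrA.
have [t0_ge0 t0_le] := andP t0T; have [t_ge0 t_le] := andP tT.
have [tt|tt] := leP t0 t.
  rewrite (ger0_norm (_ : 0 <= t - t0)) ?subr_ge0//; apply: le_trans (ler_norm _) _.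
  apply: (@taylor_mean_value _ (fun u => pr (Z u)) (fun u => pr (fun k => F (a u) k - F (a t0) k)) B) => // [x y|x].
    by move=> h1 h2 h3; apply: ty => //; [exact: le_trans h1|exact: le_trans h3 _].
  move=> /andP[h1 h2]; apply: gB; first by apply/andP; split; lra.
  by rewrite !ger0_norm ?subr_ge0// lerD2r.
rewrite distrC (gtr0_norm (_ : 0 < t0 - t)) ?subr_gt0//.
apply: le_trans (ler_norm _) _; rewrite distrC.
apply: (@taylor_mean_value _ (fun u => pr (Z u)) (fun u => pr (fun k => F (a u) k - F (a t0) k)) B) => // [|x y|x].
- exact: ltW.
- by move=> h1 h2 h3; apply: ty => //; [exact: le_trans h1|exact: le_trans h3 _].
- move=> /andP[h1 h2]; apply: gB; first by apply/andP; split; lra.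
  rewrite distrC [leRHS]distrC !ger0_norm ?subr_ge0//; first exact: lerB.
  exact: ltW.
Qed.

Lemma curve_difference_quotient t0 (e : R) : 0 <= t0 <= T -> 0 < e ->
  exists2 d, 0 < d & forall t, 0 <= t <= T -> t != t0 -> `|t - t0| <= d ->
    Hdot_norm (s - 1) (fun x => (synth (a t) x - synth (a t0) x) / (t - t0) - synth (F (a t0)) x) <= e.
Proof.
move=> t0T e0; have [d d0 hd] := curve_field_continuous t0T e0; exists d => // t tT tt0 td.
have [[p1 i1] e1 _ _] := hball_synth s_gt (a_ball tT).
have [[p2 i2] e2 _ _] := hball_synth s_gt (a_ball t0T).
have [[p3 i3] e3 _ _] := hball_synth s1_gt (limfld_hball p12 ps b c (a_ball t0T)).
have [_ z1 _] := a_ball tT; have [_ z2 _] := a_ball t0T; have [_ z3 _] := limfld_hball p12 ps b c (a_ball t0T).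
have dn0 : t - t0 != 0 by rewrite subr_eq0.
pose Y k := a t k - a t0 k - (t - t0)%:C%C * F (a t0) k.
have eg : (fun x => (synth (a t) x - synth (a t0) x) / (t - t0) - synth (F (a t0)) x) =
    fun x => (t - t0)^-1 * (synth (a t) x - synth (a t0) x) - synth (F (a t0)) x.
  by apply/funext => x; rewrite mulrC.
have ef k : fourier (fun x => (t - t0)^-1 * (synth (a t) x - synth (a t0) x) - synth (F (a t0)) x) k =
    ((t - t0)^-1)%:C%C * Y k.
  rewrite (fourierB _ (intgZ _ (intgB i1 i2)) i3) (fourierZ _ _ (intgB i1 i2)) (fourierB _ i1 i2) e1 e2 e3.
  by rewrite [RHS]mulrBr mulrA -rcM mulVf// mul1r.
rewrite eg; have [||M|] // := @Hdot_intro _ (s - 1) (fun x => (t - t0)^-1 * (synth (a t) x - synth (a t0) x) - synth (F (a t0)) x) e.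
- split; first by move=> x; rewrite p1 p2 p3.
  exact: intgB (intgZ _ (intgB i1 i2)) i3.
- by rewrite ef /Y z1 z2 z3 mulr0 !subrr mulr0.
- rewrite (hn_eq _ M ef) hnZ nc_real normrV ?unitfE// mulrC ler_pdivrMr ?normr_gt0//.
  by apply: curve_derivable => // u uT ut; apply: hd => //; exact: le_trans td.
Qed.

Let phi t := synth (a t).
Let phit t := synth (F (a t)).

Lemma curve_C0 : C0_Hdot T s phi.
Proof.
split=> [t|t0]; rewrite in_itv/= => tT; first by case: (hball_synth s_gt (a_ball tT)).
apply: cvg0_within => e e0; have [d d0 hd] := curve_continuous tT e0; exists d => // t.
rewrite /= in_itv/= => tT' td; rewrite ger0_norm ?Hdot_norm_ge0//.
exact: hball_synthB s_gt (a_ball tT') (a_ball tT) (hd t tT' td).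
Qed.

Lemma curve_C1 : C1_Hdot T (s - 1) phi phit.
Proof.
have ball1 t : 0 <= t <= T -> hball (s - 1) K (a t).
  by move=> tT; have [h1 h2 h3] := a_ball tT; split=> // M; exact: le_trans (hn_mono _ _) (h3 M).
split.
- split=> [t|t0]; rewrite in_itv/= => tT; first by case: (hball_synth s1_gt (ball1 _ tT)).
  apply: cvg0_within => e e0; have [d d0 hd] := curve_continuous tT e0; exists d => // t.
  rewrite /= in_itv/= => tT' td; rewrite ger0_norm ?Hdot_norm_ge0//.
  apply: (hball_synthB s1_gt (ball1 _ tT') (ball1 _ tT)) => M.
  exact: le_trans (hn_mono _ _) (hd t tT' td M).
- split=> [t|t0]; rewrite in_itv/= => tT.
    by case: (hball_synth s1_gt (limfld_hball p12 ps b c (a_ball tT))).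
  apply: cvg0_within => e e0; have [d d0 hd] := curve_field_continuous tT e0; exists d => // t.
  rewrite /= in_itv/= => tT' td; rewrite ger0_norm ?Hdot_norm_ge0//.
  exact: hball_synthB s1_gt (limfld_hball p12 ps b c (a_ball tT')) (limfld_hball p12 ps b c (a_ball tT)) (hd t tT' td).
- move=> t0; rewrite in_itv/= => tT.
  apply: cvg0_dwithin => e e0; have [d d0 hd] := curve_difference_quotient tT e0; exists d => // t.
  by rewrite /= in_itv/= => tT' tt td; rewrite ger0_norm ?Hdot_norm_ge0//; exact: hd.
Qed.

End Curve.

Section Existence.
Variables (R : realType) (alpha s : R).
Hypotheses (alpha_gt1 : 1 < alpha) (alpha_le2 : alpha <= 2) (s_gt : 7 / 2 - alpha < s).
Local Notation p := (3 - alpha).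
Local Notation c := (2^-1 * c_coef alpha).

Definition existence_time (r : R) : R := lifespan p s c (r ^+ 2).

Let p12 : 1 <= p <= 2.
Proof. by have h1 := alpha_gt1; have h2 := alpha_le2; apply/andP; split; lra. Qed.
Let ps : p + 2^-1 < s. Proof. by have h := s_gt; lra. Qed.

Lemma existence_time_gt0 (r : R) : 0 < existence_time r.
Proof. by apply: lifespan_gt0 => //; exact: sqr_ge0. Qed.

Lemma solution_exists (phi0 : R -> R) : Hdot s phi0 ->
  exists phi, is_solution alpha s (existence_time (Hdot_norm s phi0)) phi0 phi.
Proof.
move=> h0; have [p0 z0 _] := h0; have [_ i0] := p0.
pose a0 := fourier phi0; pose r := Hdot_norm s phi0; pose E0 := r ^+ 2.
have a0_sym : csym a0 by exact: fourier_csym.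
have E0_ge0 : 0 <= E0 by exact: sqr_ge0.
have a0_bound M : hn s M a0 ^+ 2 <= E0.
  by apply: lerXn2r (Hdot_hn M h0); rewrite ?nnegrE ?hn_ge0// Hdot_norm_ge0.
have [U [UU Uoo]] := @ultraFilterLemma nat \oo _.
pose a := galim p s (b_coef alpha) c a0 E0 U.
have a_ball t : 0 <= t <= existence_time r -> hball s (ebound E0) (a t) by exact: galim_hball.
exists (fun t => synth (a t)), (fun t => synth (limfld p (b_coef alpha) c (a t))).
have r_ge0 : 0 <= rate p s c E0 by apply: ltW; exact: rate_gt0.
have ty := @galim_taylor _ p s (b_coef alpha) c p12 ps a0 E0 a0_sym z0 a0_bound U UU Uoo.
have en := @galim_energy _ p s (b_coef alpha) c p12 ps a0 E0 a0_sym z0 a0_bound U UU Uoo.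
split.
- exact: (curve_C0 p12 ps r_ge0 a_ball ty en).
- exact: (curve_C1 p12 ps r_ge0 a_ball ty en).
- have s2 : 2^-1 < s by have ps' := ps; have [p1 _] := andP p12; lra.
  have [d d0 da] := hn_ctail s2 (fun M => Hdot_hn M h0).
  have -> : a 0 = fourier phi0 by apply/funext => k; exact: galim0.
  have [A [mA A0 hA]] := synth_fourier p0 d0 da; exists A; split=> // x /= hx.
  by apply: hA => /= e; apply: hx; rewrite e.
- move=> t; rewrite in_itv/= => tT; exact: (front_equation_synth alpha_gt1 alpha_le2 s_gt (a_ball t tT)).
Qed.

End Existence.

(** * Uniqueness *)

Section WithinLimits.
Variable R : realType.
Implicit Types (g : R -> R) (D : set R).

Lemma within_cvg0 g D (t0 e : R) : g @ within D (nbhs t0) --> (0 : R) -> 0 < e ->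
  exists2 d, 0 < d & forall t, D t -> `|t - t0| < d -> `|g t| <= e.
Proof.
move=> /cvgrPdist_le h e0; have := h e e0; rewrite near_withinE => /nbhs_ballP[d /= d0 hd].
exists d => // t Dt td; have := hd t; rewrite /ball/= distrC => /(_ td Dt).
by rewrite sub0r normrN.
Qed.

Lemma dwithin_cvg0 g D (t0 e : R) : g @ within D (dnbhs t0) --> (0 : R) -> 0 < e ->
  exists2 d, 0 < d & forall t, D t -> t != t0 -> `|t - t0| < d -> `|g t| <= e.
Proof.
move=> /cvgrPdist_le h e0; have := h e e0; rewrite near_withinE near_withinE => /nbhs_ballP[d /= d0 hd].
exists d => // t Dt tt td; have := hd t; rewrite /ball/= distrC => /(_ td tt Dt).
by rewrite sub0r normrN.
Qed.

Lemma within_continuous g D :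
  (forall t0 e, D t0 -> 0 < e -> exists2 d, 0 < d & forall t, D t -> `|t - t0| < d -> `|g t0 - g t| <= e) ->
  {within D, continuous g}.
Proof.
move=> h; apply/subspace_continuousP => t0 Dt0; apply/cvgrPdist_le => e e0; rewrite near_withinE.
have [d d0 hd] := h t0 e Dt0 e0; apply/nbhs_ballP; exists d => // t.
by rewrite /ball/= distrC => td Dt; exact: hd.
Qed.

End WithinLimits.

(** * Derivatives on a closed interval and Gronwall's inequality *)

Section Gronwall.
Variable R : realType.

(** The derivative relative to [0, T], one-sided at the end points, as a first-order expansion. *)
Definition wderiv (T : R) (f : R -> R) (t0 g : R) := forall e, 0 < e ->
  exists2 d, 0 < d & forall t, 0 <= t <= T -> `|t - t0| <= d ->
    `|f t - f t0 - (t - t0) * g| <= e * `|t - t0|.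

Lemma wderiv_cst (T c t0 : R) : wderiv T (fun=> c) t0 0.
Proof. by move=> e e0; exists 1 => // t _ _; rewrite subrr mulr0 subrr normr0 mulr_ge0// ltW. Qed.

Lemma wderivD (T : R) f f' (t0 g g' : R) : wderiv T f t0 g -> wderiv T f' t0 g' ->
  wderiv T (fun t => f t + f' t) t0 (g + g').
Proof.
move=> h h' e e0; have e2 : 0 < e / 2 by rewrite divr_gt0.
have [d d0 hd] := h _ e2; have [d' d'0 hd'] := h' _ e2.
exists (Num.min d d'); first by rewrite lt_min d0.
move=> t tT; rewrite le_min => /andP[h1 h2].
rewrite (_ : _ - _ - _ = (f t - f t0 - (t - t0) * g) + (f' t - f' t0 - (t - t0) * g')); last by ring.
apply: le_trans (ler_normD _ _) _; have := hd t tT h1; have := hd' t tT h2; lra.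
Qed.

Lemma wderivB (T : R) f f' (t0 g g' : R) : wderiv T f t0 g -> wderiv T f' t0 g' ->
  wderiv T (fun t => f t - f' t) t0 (g - g').
Proof.
move=> h h'; apply: wderivD h _ => e e0; have [d d0 hd] := h' e e0; exists d => // t tT td.
by rewrite mulrN -!opprD normrN; exact: hd.
Qed.

Lemma wderiv_sum (T t0 : R) (I : Type) (l : seq I) (f : I -> R -> R) (g : I -> R) :
  (forall i, wderiv T (f i) t0 (g i)) -> wderiv T (fun t => \sum_(i <- l) f i t) t0 (\sum_(i <- l) g i).
Proof.
move=> h; elim: l => [|j l ih].
  by under eq_fun do rewrite big_nil; rewrite big_nil; exact: wderiv_cst.
by under eq_fun do rewrite big_cons; rewrite big_cons; exact: wderivD.
Qed.

Lemma wderiv_growth (T : R) f (t0 g : R) : wderiv T f t0 g ->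
  exists2 d, 0 < d & forall t, 0 <= t <= T -> `|t - t0| <= d -> `|f t - f t0| <= (`|g| + 1) * `|t - t0|.
Proof.
move=> h; have [d d0 hd] := h _ ltr01; exists d => // t tT td.
rewrite -[f t - f t0](subrK ((t - t0) * g)); apply: le_trans (ler_normD _ _) _.
have := hd t tT td; rewrite normrM mulrDl [`|t - t0| * `|g|]mulrC; lra.
Qed.

Lemma wderiv_sqr (T : R) f (t0 g : R) : wderiv T f t0 g ->
  wderiv T (fun t => f t ^+ 2) t0 (2 * f t0 * g).
Proof.
move=> h e e0; pose A := 2 * `|f t0| + 1; pose B := `|g| + 1.
have A0 : 0 < A by rewrite ltr_pwDr// mulr_ge0.
have B0 : 0 < B by rewrite ltr_pwDr.
have e1 : 0 < e / 2 / A by rewrite !divr_gt0.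
have [d d0 hd] := h _ e1; have [d' d'0 hd'] := wderiv_growth h.
have d20 : 0 < e / 2 / B ^+ 2 by rewrite !divr_gt0// exprn_gt0.
exists (Num.min (Num.min d d') (e / 2 / B ^+ 2)); first by rewrite !lt_min d0 d'0.
move=> t tT; rewrite !le_min => /andP[/andP[h1 h2] h3].
rewrite (_ : _ - _ - _ = 2 * f t0 * (f t - f t0 - (t - t0) * g) + (f t - f t0) ^+ 2); last by ring.
apply: le_trans (ler_normD _ _) _; rewrite normrX normrM [`|2 * _|]normrM (ger0_norm (_ : 0 <= 2))//.
have k1 := hd t tT h1; have k2 := hd' t tT h2; pose D := `|t - t0|; rewrite -/D in h3 k1 k2 *.
have D0 : 0 <= D by exact: normr_ge0.
have m1 : 2 * `|f t0| * `|f t - f t0 - (t - t0) * g| <= e / 2 * D.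
  apply: (@le_trans _ _ (A * (e / 2 / A * D))).
    by apply: ler_pM => //; rewrite lerDl.
  by rewrite mulrA [A * _]mulrC divfK// gt_eqF.
have m2 : `|f t - f t0| ^+ 2 <= e / 2 * D.
  apply: (@le_trans _ _ ((B * D) ^+ 2)).
    by apply: lerXn2r k2; rewrite ?nnegrE// mulr_ge0// ltW.
  rewrite exprMn [D ^+ 2]expr2 mulrA; apply: ler_wpM2r => //.
  by rewrite mulrC -ler_pdivlMr// exprn_gt0.
lra.
Qed.

Lemma wderiv_is_derive (T : R) f (t0 g : R) : 0 < t0 < T -> wderiv T f t0 g -> is_derive t0 1 f g.
Proof.
move=> /andP[t00 t0T] h.
have cv : h0^-1 *: (f (h0 *: 1 + t0) - f t0) @[h0 --> 0^'] --> g.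
  apply/cvgrPdist_le => e e0; rewrite near_withinE; have [d d0 hd] := h e e0.
  apply/nbhs_ballP; exists (Num.min d (Num.min t0 (T - t0))).
    by rewrite /= !lt_min d0 t00 subr_gt0.
  move=> y; rewrite /ball/= sub0r normrN !lt_min => /andP[yd /andP[y1 y2]] y0.
  have yT : 0 <= y + t0 <= T by move: y1 y2; rewrite !ltr_norml => /andP[? ?] /andP[? ?]; apply/andP; split; lra.
  have := hd _ yT; rewrite addrK => /(_ (ltW yd)) hy.
  rewrite /GRing.scale/= mulr1.
  have -> : g - y^-1 * (f (y + t0) - f t0) = - (y^-1 * (f (y + t0) - f t0 - y * g)) by field.
  by rewrite normrN normrM normfV mulrC ler_pdivrMr ?normr_gt0.
split; first by apply/cvg_ex; exists g.
by apply: (@cvg_lim R).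
Qed.

Lemma wderiv_continuous (T : R) f g : (forall t, 0 <= t <= T -> wderiv T f t (g t)) ->
  {within `[0, T], continuous f}.
Proof.
move=> h; apply/subspace_continuousP => t0; rewrite /= in_itv/= => tT.
have [d d0 hd] := wderiv_growth (h _ tT); pose B := `|g t0| + 1.
have B0 : 0 < B by rewrite ltr_pwDr.
apply/cvgrPdist_le => e e0; rewrite near_withinE; apply/nbhs_ballP.
exists (Num.min d (e / B)); first by rewrite /= lt_min d0 divr_gt0.
move=> t; rewrite /ball/= lt_min distrC => /andP[/ltW h1 /ltW h2]; rewrite in_itv/= => tT'.
rewrite distrC; apply: le_trans (hd t tT' h1) _; rewrite -/B.
by rewrite mulrC -ler_pdivlMr.
Qed.

(** The function f(t) exp(- C t) - e t is nonincreasing: its derivative is at most e (exp(- C t) -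
    1) <= 0. *)
Lemma gronwall (T C e : R) f g : 0 <= C -> 0 <= e -> f 0 = 0 ->
  (forall t, 0 <= t <= T -> wderiv T f t (g t)) ->
  (forall t, 0 <= t <= T -> g t <= C * f t + e) ->
  forall t, 0 <= t <= T -> f t <= e * t * expR (C * t).
Proof.
move=> C0 e0 f0 df gf.
pose E x : R := expR (- C * x); pose F x := f x * E x - e * x.
have dE (x : R) : is_derive x 1 E (- C * E x).
  have lin : is_derive x 1 (fun y => - C * y) (- C).
    rewrite (_ : (fun y => _) = (- C) \*: (id : R -> R))//.
    by apply: is_derive_eq; rewrite /GRing.scale/= mulr1.
  by apply: (is_derive_eq (is_derive1_comp (is_derive_expR _) lin)); rewrite /E mulrC.
have dF x : 0 < x < T -> is_derive x 1 F (g x * E x + f x * (- C * E x) - e).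
  move=> xT; have x0T : 0 <= x <= T by case/andP: xT => h1 h2; rewrite !ltW.
  have h1 := wderiv_is_derive xT (df x x0T).
  have lin : is_derive x 1 (fun y => e * y) e.
    rewrite (_ : (fun y => _) = e \*: (id : R -> R))//.
    by apply: is_derive_eq; rewrite /GRing.scale/= mulr1.
  apply: (is_derive_eq (is_deriveB (is_deriveM h1 (dE x)) lin)).
  by rewrite /GRing.scale/=; ring.
have E1 x : 0 <= x -> E x <= 1.
  by move=> x0; rewrite -expR0 ler_expR mulNr oppr_le0 mulr_ge0.
have cF : {within `[0, T], continuous F}.
  have cf := wderiv_continuous df; have cE : continuous E.
    by move=> x; apply: differentiable_continuous; apply/derivable1_diffP; exact: ex_derive.
  have ce : continuous (fun y : R => e * y) by move=> x; apply: cvgMr; exact: cvg_id.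
  move=> x; apply: cvgB; first by apply: cvgM; [exact: cf|exact: continuous_subspaceT].
  exact: continuous_subspaceT.
have mono : {in `[0, T] &, {homo F : x y /~ x <= y}}.
  apply: ler0_derive1_le_cc cF => x; rewrite in_itv/= => xT; have h := dF x xT.
    exact: ex_derive.
  rewrite derive1E derive_val.
  have [x1 x2] := andP xT; have x0T : 0 <= x <= T by rewrite !ltW.
  have Ex0 : 0 <= E x by exact: expR_ge0.
  have k1 := ler_wpM2r Ex0 (gf x x0T); have k2 := ler_wpM2l e0 (E1 x (ltW x1)).
  have -> : g x * E x + f x * (- C * E x) - e = (g x * E x - (C * f x + e) * E x) + (e * E x - e) by ring.
  by lra.
move=> t tT; have [t0 tT'] := andP tT.
have := mono t 0; rewrite !in_itv/= tT lexx (le_trans t0 tT') => /(_ isT isT t0).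
rewrite /F f0 mul0r mulr0 subrr subr_le0 => h.
have Ex : E t * expR (C * t) = 1 by rewrite /E -expRD mulNr addNr expR0.
rewrite -[f t]mulr1 -Ex mulrA; apply: ler_wpM2r => //; exact: expR_ge0.
Qed.

End Gronwall.

(** * Growth of the truncated L^2 distance of two solutions *)

Section TruncationError.
Variables (R : realType) (p s : R).
Hypotheses (p12 : 1 <= p <= 2) (ps : p + 2^-1 < s).
Local Notation C := R[i].
Local Notation nc := (@ComplexField.Normc.normc R).
Local Notation l1c := (l1_const p s).
Implicit Types (u w : int -> C).

Lemma wp_nc_le_hn (t : R) M u k : (`|k| <= M)%N -> wp t k * nc (u k) <= hn t M u.
Proof.
move=> kM; rewrite hn_sqr'; apply: le_sqrt.
rewrite (bigD1_seq k) ?uniq_zs ?mem_zs//= lerDl sumr_ge0// => j _; exact: sqr_ge0.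
Qed.

(** Of the s available powers of |k|, one is used, giving the rate 1 / (M + 1). *)
Lemma hball_high K u k M : hball s K u -> (M < `|k|)%N -> nc (u k) <= K / M.+1%:R.
Proof.
move=> [_ _ uK] Mk; rewrite ler_pdivlMr// mulrC; apply: le_trans _ (uK `|k|%N).
apply: le_trans _ (wp_nc_le_hn s u (leqnn `|k|%N)); apply: ler_wpM2r; first exact: nc_ge0.
have k0 : k != 0 by rewrite -absz_gt0; exact: leq_ltn_trans Mk.
apply: (@le_trans _ _ `|k%:~R|).
  by rewrite -intr_norm -[M.+1%:R]/((M.+1%:Z)%:~R) ler_int -abszE lez_nat.
rewrite -wp1; apply: wp_le => //; have ps' := ps; have [p1 _] := andP p12; lra.
Qed.

Lemma big_zs_low (V : nmodType) M n (F : int -> V) : (M <= n)%N ->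
  (forall k, (M < `|k|)%N -> F k = 0) -> \sum_(k <- zs n) F k = \sum_(k <- zs M) F k.
Proof.
move=> Mn F0; rewrite (bigID (fun k => (`|k| <= M)%N))/= [X in _ + X]big1 ?addr0; last first.
  by move=> k; rewrite -ltnNge; exact: F0.
rewrite -big_filter; apply: perm_big; apply: uniq_perm; rewrite ?filter_uniq ?uniq_zs//.
by move=> k; rewrite mem_filter !mem_zs; apply: andb_idr => h; exact: leq_trans h Mn.
Qed.

Lemma flux3_low M n u k : (M <= n)%N -> flux3 p n (low M u) (low M u) (low M u) k = flux3 p M u u u k.
Proof.
move=> Mn; have low0 j : (M < `|j|)%N -> low M u j = 0 by move=> h; rewrite /low leqNgt h.
have lowE j : (`|j| <= M)%N -> low M u j = u j by move=> h; rewrite /low h.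
rewrite /flux3 /sum4 (big_zs_low Mn); last first.
  move=> k1 h; rewrite big1// => k2 _; rewrite big1// => k3 _; rewrite big_seq1.
  by rewrite low0// !mul0r mulr0; case: ifP.
rewrite big_seq [RHS]big_seq; apply: eq_bigr => k1; rewrite mem_zs => h1.
rewrite (big_zs_low Mn); last first.
  move=> k2 h; rewrite big1// => k3 _; rewrite big_seq1.
  by rewrite (low0 k2 h) mulr0 !mul0r mulr0; case: ifP.
rewrite big_seq [RHS]big_seq; apply: eq_bigr => k2; rewrite mem_zs => h2.
rewrite (big_zs_low Mn); last first.
  by move=> k3 h; rewrite big_seq1 (low0 k3 h) !mulr0; case: ifP.
rewrite big_seq [RHS]big_seq; apply: eq_bigr => k3; rewrite mem_zs => h3.
by rewrite !big_seq1 !lowE.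
Qed.

Definition flux_gain (K : R) : R := 3 * (4 * p * l1c ^+ 2 * K * K).

Let q_ge0 : 0 <= 4 * p * l1c ^+ 2.
Proof. by have [p1 _] := andP p12; rewrite mulr_ge0 ?sqr_ge0//; lra. Qed.

Lemma flux_gain_ge0 K : 0 <= K -> 0 <= flux_gain K.
Proof. by move=> K0; rewrite /flux_gain; have h := q_ge0; rewrite mulr_ge0// mulr_ge0// mulr_ge0. Qed.

(** In the telescoped difference one factor lives on frequencies above M and is small in the sup
    norm by [hball_high], which is what [flux3_sup] asks for. The bound is uniform in k. *)
Lemma fluxc_trunc K u k M : hball s K u ->
  nc (fluxc p u k - flux3 p M u u u k) <= flux_gain K * (K / M.+1%:R).
Proof.
move=> hu; have [_ _ uK] := hu; have K0 : 0 <= K := le_trans (hn_ge0 s 0 u) (uK 0%N).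
have cv : ccvg \oo (fun n => flux3 p n (low n u) (low n u) (low n u) k + - flux3 p M u u u k)
    (fluxc p u k + - flux3 p M u u u k).
  by apply: ccvgD; [exact: fluxc_low hu k|exact: ccvg_cst].
apply: (ccvg_le cv); near=> n.
have Mn : (M <= n)%N by near: n; exact: nbhs_infty_ge.
rewrite -(flux3_low _ _ Mn) flux3_diff.
have b x y : hn s n x <= K -> hn s n y <= K ->
    nc (flux3 p n (fun j => low n u j - low M u j) x y k) <= 4 * p * l1c ^+ 2 * K * K * (K / M.+1%:R).
  move=> hx hy; apply: le_trans (flux3_sup p12 ps n x y k (e := K / M.+1%:R) _) _.
    move=> j; rewrite /low; have [jM|jM] := leqP `|j| M.
      by rewrite (leq_trans jM Mn) subrr nc0 divr_ge0.
    by case: ifP => _; rewrite subr0 ?nc0 ?divr_ge0//; exact: hball_high hu jM.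
  apply: ler_wpM2r; first by rewrite divr_ge0.
  have h0 := q_ge0; move: (4 * p * l1c ^+ 2) h0 => q q0; rewrite -!mulrA.
  by apply: ler_wpM2l => //; apply: ler_pM => //; exact: hn_ge0.
have ln : hn s n (low n u) <= K := le_trans (hn_low _ _ _ _) (uK n).
have lM : hn s n (low M u) <= K := le_trans (hn_low _ _ _ _) (uK n).
apply: le_trans (nc_leD _ _) _; apply: le_trans (lerD (nc_leD _ _) (lexx _)) _.
apply: le_trans (lerD (lerD (b _ _ ln ln) (b _ _ lM ln)) (b _ _ lM lM)) _.
by apply: eq_ler; rewrite /flux_gain; ring.
Unshelve. all: by end_near. Qed.

Variables (b c : R).

(** The fluxes are replaced by those of the truncations at M, to which [flux3_diff_energy] applies.
    The replacement costs at most 2 rho at each frequency, multiplied by the sum of |k| |w k|, which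
    is bounded by [l1_const] times 2 K. *)
Lemma energy_rate K u1 u2 M : hball s K u1 -> hball s K u2 ->
  \sum_(k <- zs M) 2 * complex.Re ((u1 k - u2 k)^*%C * (limfld p b c u1 k - limfld p b c u2 k)) <=
  2 * `|c| * flux_gain K * (\sum_(k <- zs M) nc (u1 k - u2 k) ^+ 2) +
  8 * `|c| * l1c * K * flux_gain K * (K / M.+1%:R).
Proof.
move=> h1 h2; have [c1 _ uK1] := h1; have [c2 _ uK2] := h2.
have K0 : 0 <= K := le_trans (hn_ge0 s 0 u1) (uK1 0%N).
pose w k := u1 k - u2 k; have cw : csym w by move=> k; rewrite /w c1 c2 [RHS]conjD conjN.
pose X k := fluxc p u1 k - fluxc p u2 k; pose Xf k := flux3 p M u1 u1 u1 k - flux3 p M u2 u2 u2 k.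
pose S := \sum_(k <- zs M) (k%:~R * (w k)^*%C) * X k.
have term k : complex.Re ((w k)^*%C * (limfld p b c u1 k - limfld p b c u2 k)) =
    complex.Re (- ('i%C * c%:C%C) * ((k%:~R * (w k)^*%C) * X k)).
  have -> : (w k)^*%C * (limfld p b c u1 k - limfld p b c u2 k) =
      - ('i%C * c%:C%C) * ((k%:~R * (w k)^*%C) * X k) + - 'i%C * (k%:~R * (b * wp (p - 2) k)%:C%C * ((w k)^*%C * w k)).
    rewrite /limfld /vfield /X /w.
    move: (fluxc p u1 k) (fluxc p u2 k) (b * _)%:C%C c%:C%C ('i%C : C) (u1 k) (u2 k) (_ - _)^*%C => f1 f2 B c' i' v1 v2 w'; ring.
  rewrite raddfD/= ReM_conj -rc_int -!rcM [X in _ + X](_ : _ = 0) ?addr0//.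
  by rewrite /= !(mulr0, mul0r, oppr0, mul1r, subr0).
have -> : \sum_(k <- zs M) 2 * complex.Re ((u1 k - u2 k)^*%C * (limfld p b c u1 k - limfld p b c u2 k)) =
    2 * complex.Re (- ('i%C * c%:C%C) * S).
  rewrite /S mulr_sumr raddf_sum/= mulr_sumr; apply: eq_bigr => k _.
  by congr (2 * _); exact: term.
have Sle : nc S <= flux_gain K * (\sum_(k <- zs M) nc (w k) ^+ 2) + 4 * l1c * K * flux_gain K * (K / M.+1%:R).
  pose rho := flux_gain K * (K / M.+1%:R).
  have rho0 : 0 <= rho by rewrite mulr_ge0 ?flux_gain_ge0// divr_ge0.
  have -> : S = \sum_(k <- zs M) (k%:~R * (w k)^*%C) * Xf k + \sum_(k <- zs M) (k%:~R * (w k)^*%C) * (X k - Xf k).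
    by rewrite -big_split; apply: eq_bigr => k _; rewrite /= -mulrDr addrC subrK.
  apply: le_trans (nc_leD _ _) _; apply: lerD.
    have -> : \sum_(k <- zs M) (k%:~R * (w k)^*%C) * Xf k =
        \sum_(k <- zs M) (k%:~R * (w k)^*%C) * flux3 p M w u1 u1 k +
        \sum_(k <- zs M) (k%:~R * (w k)^*%C) * flux3 p M w u2 u1 k +
        \sum_(k <- zs M) (k%:~R * (w k)^*%C) * flux3 p M w u2 u2 k.
      by rewrite -!big_split; apply: eq_bigr => k _ /=; rewrite -!mulrDr /Xf flux3_diff.
    have bd x y : hn s M x <= K -> hn s M y <= K ->
        nc (\sum_(k <- zs M) (k%:~R * (w k)^*%C) * flux3 p M w x y k) <=
        4 * p * l1c ^+ 2 * K * K * (\sum_(k <- zs M) nc (w k) ^+ 2).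
      move=> hx hy; apply: le_trans (flux3_diff_energy p12 ps M x y cw) _.
      apply: ler_wpM2r; first by apply: sumr_ge0 => k _; exact: sqr_ge0.
      have h0 := q_ge0; move: (4 * p * l1c ^+ 2) h0 => q q0; rewrite -!mulrA.
  by apply: ler_wpM2l => //; apply: ler_pM => //; exact: hn_ge0.
    apply: le_trans (nc_leD _ _) _; apply: le_trans (lerD (nc_leD _ _) (lexx _)) _.
    apply: le_trans (lerD (lerD (bd _ _ (uK1 M) (uK1 M)) (bd _ _ (uK2 M) (uK1 M))) (bd _ _ (uK2 M) (uK2 M))) _.
    by apply: eq_ler; rewrite /flux_gain; ring.
  apply: le_trans (nc_sum _ _) _.
  apply: (@le_trans _ _ (\sum_(k <- zs M) (wp p k * nc (w k)) * (2 * rho))).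
    apply: ler_sum => k _; rewrite !ncM nc_int nc_conj; apply: ler_pM; rewrite ?mulr_ge0 ?nc_ge0//.
      by apply: ler_wpM2r; [exact: nc_ge0|exact: norm_le_wp].
    have -> : X k - Xf k = (fluxc p u1 k - flux3 p M u1 u1 u1 k) - (fluxc p u2 k - flux3 p M u2 u2 u2 k).
      by rewrite /X /Xf; move: (fluxc p u1 k) (fluxc p u2 k) (flux3 _ _ u1 _ _ _) (flux3 _ _ u2 _ _ _) => f1 f2 g1 g2; ring.
    apply: le_trans (nc_leB _ _) _; rewrite (_ : 2 * rho = rho + rho); last by ring.
    exact: lerD (fluxc_trunc k M h1) (fluxc_trunc k M h2).
  rewrite -mulr_suml; have wK : hn s M w <= K + K.
    by apply: le_trans (hn_triangleB _ _ _ _) _; exact: lerD.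
  have h := le_trans (l1_hn p12 ps M w) (ler_wpM2l (l1_const_ge0 p s) wK).
  have r20 : 0 <= 2 * rho by rewrite mulr_ge0.
  apply: le_trans (ler_wpM2r r20 h) _; apply: eq_ler; rewrite /rho; ring.
have h3 : complex.Re (- ('i%C * c%:C%C) * S) <= `|c| * nc S.
  apply: le_trans (ler_norm _) _; apply: le_trans (Re_le_nc _) _.
  by rewrite ncM ncN ncM nc_i mul1r nc_real.
apply: le_trans (ler_wpM2l _ h3) _ => //.
have h4 := ler_wpM2l (normr_ge0 c) Sle.
apply: le_trans (ler_wpM2l _ h4) _ => //.
by apply: eq_ler; ring.
Qed.

End TruncationError.

Section HdotStructure.
Variables (R : realType) (t : R).
Implicit Types (f g : R -> R).

Lemma HdotB f g : Hdot t f -> Hdot t g -> Hdot t (fun x => f x - g x).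
Proof.
move=> hf hg; have [[p1 i1] f0 _] := hf; have [[p2 i2] g0 _] := hg.
have e k : fourier (fun x => f x - g x) k = fourier f k - fourier g k by exact: fourierB.
have [||M|] // := @Hdot_intro _ t (fun x => f x - g x) (Hdot_norm t f + Hdot_norm t g).
- by split; [move=> x; rewrite p1 p2|exact: intgB].
- by rewrite e f0 g0 subrr.
- rewrite (hn_eq _ _ e); apply: le_trans (hn_triangleB _ _ _ _) _.
  by apply: lerD; exact: Hdot_hn.
Qed.

Lemma HdotZ (z : R) f : Hdot t f -> Hdot t (fun x => f x * z).
Proof.
move=> hf; have [[p1 i1] f0 _] := hf.
have ez : (fun x => f x * z) = (fun x => z * f x) by apply/funext => x; rewrite mulrC.
have e k : fourier (fun x => f x * z) k = z%:C%C * fourier f k by rewrite ez fourierZ.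
have [||M|] // := @Hdot_intro _ t (fun x => f x * z) (`|z| * Hdot_norm t f).
- by split; [move=> x; rewrite p1|rewrite ez; exact: intgZ].
- by rewrite e f0 mulr0.
- rewrite (hn_eq _ _ e) hnZ nc_real; apply: ler_wpM2l => //; exact: Hdot_hn.
Qed.

Lemma Hdot_norm_triangle f g : Hdot t f -> Hdot t g ->
  Hdot_norm t f <= Hdot_norm t g + Hdot_norm t (fun x => f x - g x).
Proof.
move=> hf hg; have [pf f0 _] := hf; have hfg := HdotB hf hg.
have [[p1 i1] _ _] := hf; have [[p2 i2] _ _] := hg.
have [M|_] // := @Hdot_intro _ t f (Hdot_norm t g + Hdot_norm t (fun x => f x - g x)) pf f0.
have e : fourier f =1 fun k => fourier g k + fourier (fun x => f x - g x) k.
  by move=> k; rewrite fourierB// addrC subrK.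
rewrite (hn_eq _ _ e); apply: le_trans (hn_triangle _ _ _ _) _.
by apply: lerD; exact: Hdot_hn.
Qed.

(** By the triangle inequality the norm is continuous in time, hence attains its maximum on [0, T];
    this provides the ball in which a given solution stays. *)
Lemma C0_Hdot_bounded T (u : R -> R -> R) : 0 <= T -> C0_Hdot T t u ->
  exists K, forall x, 0 <= x <= T -> Hdot_norm t (u x) <= K.
Proof.
have gen (X Y A B e : R) : X <= Y + A -> Y <= X + B -> A <= B -> B <= e -> `|X - Y| <= e.
  by move=> *; rewrite ler_norml; apply/andP; split; lra.
move=> T0 [hu cu]; have huT x : 0 <= x <= T -> Hdot t (u x) by move=> h; apply: hu; rewrite in_itv.
have cN : {within `[0, T], continuous (fun x => Hdot_norm t (u x))}.
  apply: within_continuous => x e; rewrite /= in_itv/= => xT e0.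
  have := cu x; rewrite in_itv/= => /(_ xT) /within_cvg0 /(_ e0) [d d0 hd].
  exists d => // y; rewrite /= in_itv/= => yT yd.
  have := hd y; rewrite /= in_itv/= => /(_ yT yd); rewrite ger0_norm ?Hdot_norm_ge0// => {}hd.
  have k1 := Hdot_norm_triangle (huT y yT) (huT x xT).
  have k2 := Hdot_norm_triangle (huT x xT) (huT y yT).
  have k3 : Hdot_norm t (fun z => u x z - u y z) <= Hdot_norm t (fun z => u y z - u x z).
    have [[p1 i1] _ _] := huT x xT; have [[p2 i2] _ _] := huT y yT.
    have hyx := HdotB (huT y yT) (huT x xT); have [pxy xy0 _] := HdotB (huT x xT) (huT y yT).
    have [M|_] // := @Hdot_intro _ t (fun z => u x z - u y z) (Hdot_norm t (fun z => u y z - u x z)) pxy xy0.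
    rewrite (hn_eq _ _ (fun k => fourierB k i1 i2)) hnB_sym -(hn_eq _ _ (fun k => fourierB k i2 i1)).
    exact: Hdot_hn.
  exact: gen k2 k1 k3 hd.
have [x0 _ h] := EVT_max T0 cN; exists (Hdot_norm t (u x0)) => x xT.
by apply: h; rewrite in_itv.
Qed.

End HdotStructure.

(** * From a solution back to its coefficients *)

Section SolutionCoefficients.
Variables (R : realType) (alpha s : R).
Hypotheses (alpha_gt1 : 1 < alpha) (alpha_le2 : alpha <= 2) (s_gt : 7 / 2 - alpha < s).
Local Notation C := R[i].
Local Notation nc := (@ComplexField.Normc.normc R).
Local Notation p := (3 - alpha).
Local Notation b := (b_coef alpha).
Local Notation c := (2^-1 * c_coef alpha).
Local Notation mu := (@lebesgue_measure R).
Local Notation F := (limfld p b c).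
Implicit Types (f g : R -> R).

Let p12 : 1 <= p <= 2.
Proof. by have h1 := alpha_gt1; have h2 := alpha_le2; apply/andP; split; lra. Qed.
Let ps : p + 2^-1 < s. Proof. by have h := s_gt; lra. Qed.
Let s1_gt : 2^-1 < s - 1.
Proof. by have ps' := ps; have [p1 _] := andP p12; lra. Qed.
Let s_gt2 : 2^-1 < s. Proof. by have h := s1_gt; lra. Qed.

Lemma aeI (P Q : R -> Prop) : {ae mu, forall x, P x} -> {ae mu, forall x, Q x} ->
  {ae mu, forall x, P x /\ Q x}.
Proof. by move=> hP hQ; exact: (@filterI _ _ (ae_filter_ringOfSetsType mu) _ _ hP hQ). Qed.

Lemma fourier_inj f g : periodicL1 f -> periodicL1 g -> (forall k, fourier f k = fourier g k) ->
  {ae mu, forall x, f x = g x}.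
Proof.
move=> [pf hf] [pg hg] fg; have := @fourier_eq0 R (fun x => f x - g x).
move=> /(_ _ (intgB hf hg)); case=> [x||A [mA A0 hA]].
- by rewrite pf pg.
- by move=> k; rewrite fourierB// fg subrr.
- by exists A; split => // x h; apply: hA => /= /eqP; rewrite subr_eq0 => /eqP.
Qed.

Lemma is_absD_ae f f' g g' : {ae mu, forall x, f x = f' x} -> is_absD p f g -> is_absD p f' g' ->
  {ae mu, forall x, g x = g' x}.
Proof.
move=> ff' [[_ i1] pg _ g0 hg] [[_ i1'] pg' _ g0' hg']; apply: fourier_inj => // k.
have [->|k0] := eqVneq k 0; first by rewrite g0 g0'.
by rewrite hg// hg'// (ae_fourier k i1 i1' ff').
Qed.

(** The functions witnessing the equation are known up to equality almost everywhere, through their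
    coefficients. They are therefore identified with those built from the Fourier series of f, and
    coefficients are compared. *)
Lemma front_equation_fourier f ft K : hball s K (fourier f) -> periodicL1 f -> periodicL1 ft ->
  front_equation alpha f ft -> forall k, fourier ft k = F (fourier f) k.
Proof.
move=> hb pf pft [Lf [Lf2 [Lf3 [dflux [fx [Nfx [[h1 h2 h3] [w1 w2 h4 heq]]]]]]]] k.
set a := fourier f in hb *; have [ca a0 aK] := hb.
have [da da0 ta] := hn_ctail s_gt2 aK; have fa := synth_fourier pf da0 ta.
have l1 := is_absD_ae fa h1 (hball_powD p12 ps hb (m := 1) isT).
have sq m : {ae mu, forall x, f x ^+ m = synth a x ^+ m}.
  by case: fa => A [mA A0 hA]; exists A; split=> // x /= hx; apply: hA => /= e; apply: hx; rewrite e.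
have l2 := is_absD_ae (sq 2) h2 (hball_powD p12 ps hb (m := 2) isT).
have l3 := is_absD_ae (sq 3) h3 (hball_powD p12 ps hb (m := 3) isT).
have [[_ iflux] [pd id] _] := w1; have [_ ig] := hball_flux_periodicL1 p12 ps hb.
have fl : {ae mu, forall x, f x ^+ 2 * Lf x - f x * Lf2 x + 3^-1 * Lf3 x = flux p (synth a) x}.
  have [A [mA A0 hA]] := aeI (aeI fa l1) (aeI l2 l3); exists A; split=> // x /= hx; apply: hA => /= -[[e1 e2] [e3 e4]].
  by apply: hx; rewrite e1 e2 e3 e4.
have ed j : fourier dflux j = deriv (fluxc p a) j.
  rewrite (weak_derivative_fourier j w1) /deriv; congr (_ * _); exact: ae_fourier.
have ex j : fourier fx j = deriv a j by exact: weak_derivative_fourier.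
have [[_ ifx] [pN iN] _ N0 hN] := h4; have [_ ift] := pft.
have eN : fourier Nfx k = (wp (p - 2) k)%:C%C * deriv a k.
  have [->|k0] := eqVneq k 0; first by rewrite N0 /deriv mulr0z mulr0 mul0r mulr0.
  rewrite hN// ex /wp (_ : p - 2 = 1 - alpha)//; ring.
have := ae_fourier k (intgD (intgD ift (intgZ c id)) (intgZ b iN)) (intgZ 0 ift).
(* Zero is written as 0 * ft, whose coefficients vanish by linearity. *)
have eq0 : {ae mu, forall x, ft x + c * dflux x + b * Nfx x = 0 * ft x}.
  have [A [mA A0 hA]] := heq; exists A; split=> // x /= hx; apply: hA => /= e; apply: hx.
  by rewrite e mul0r.
move=> /(_ eq0); rewrite (fourierZ 0 k ift) mul0r.
rewrite (fourierD _ (intgD ift (intgZ c id)) (intgZ b iN)) (fourierD _ ift (intgZ c id)).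
rewrite (fourierZ _ _ id) (fourierZ _ _ iN) ed eN -addrA => /eqP; rewrite addr_eq0 => /eqP ->.
rewrite /limfld /vfield /deriv rcM.
move: (fluxc _ _ k) (wp _ _)%:C%C c%:C%C b%:C%C => X Y c' b'; ring.
Qed.

(** As |k|^(s-1) >= 1 for k != 0, convergence of the difference quotients in the norm of index s - 1
    differentiates each coefficient. *)
Lemma solution_coefficients T phi0 phi : 0 <= T -> is_solution alpha s T phi0 phi ->
  exists K, forall t, 0 <= t <= T ->
    [/\ periodicL1 (phi t), hball s K (fourier (phi t)) &
      forall k, wderiv T (fun t => complex.Re (fourier (phi t) k)) t (complex.Re (F (fourier (phi t)) k)) /\
                wderiv T (fun t => complex.Im (fourier (phi t) k)) t (complex.Im (F (fourier (phi t)) k))].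
Proof.
move=> T0 [phit [c0 [_ c1 dq] _ eqn]]; have [K hK] := C0_Hdot_bounded T0 c0.
exists K => t tT; have tT' : t \in `[0, T] by rewrite in_itv.
have ht u : 0 <= u <= T -> Hdot s (phi u) by move=> uT; apply: (proj1 c0); rewrite in_itv.
have hb u : 0 <= u <= T -> hball s K (fourier (phi u)).
  move=> uT; have hu := ht u uT; have [[_ iu] u0 _] := hu; split => //; first exact: fourier_csym.
  by move=> M; exact: le_trans (Hdot_hn M hu) (hK u uT).
have hv : Hdot (s - 1) (phit t) by exact: (proj1 c1).
have [pv v0 _] := hv; have [pu u0 _] := ht t tT.
have vE k : fourier (phit t) k = F (fourier (phi t)) k.
  exact: front_equation_fourier (hb t tT) pu pv (eqn t tT') k.
split; [exact: pu|exact: hb|].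
have key k (e : R) : 0 < e -> exists2 d, 0 < d & forall u, 0 <= u <= T -> `|u - t| <= d ->
    nc (fourier (phi u) k - fourier (phi t) k - (u - t)%:C%C * F (fourier (phi t)) k) <= e * `|u - t|.
  move=> e0; have [d d0 hd] := dwithin_cvg0 (dq t tT') e0.
  exists (d / 2) => [|u uT ud]; first by rewrite divr_gt0.
  have [->|ut] := eqVneq u t; first by rewrite !subrr mul0r subr0 nc0 normr0 mulr0.
  have udd : `|u - t| < d by apply: le_lt_trans ud _; lra.
  have := hd u; rewrite /= in_itv/= => /(_ uT ut udd); rewrite ger0_norm ?Hdot_norm_ge0// => hn1.
  have ut0 : u - t != 0 by rewrite subr_eq0.
  have [[_ iu] uz _] := ht u uT; have [_ it] := pu; have [_ iv] := pv.
  pose Y := fourier (phi u) k - fourier (phi t) k - (u - t)%:C%C * F (fourier (phi t)) k.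
  have hB1 : Hdot (s - 1) (fun x => phi u x - phi t x).
    have hd1 := HdotB (ht u uT) (ht t tT); have [q1 q2 _] := hd1.
    have [M|//] := @Hdot_intro _ (s - 1) (fun x => phi u x - phi t x) (Hdot_norm s (fun x => phi u x - phi t x)) q1 q2.
    exact: le_trans (hn_mono p12 ps _ _) (Hdot_hn M hd1).
  have hB := HdotB (HdotZ (u - t)^-1 hB1) hv.
  have fY : fourier (fun x => (phi u x - phi t x) / (u - t) - phit t x) k = ((u - t)^-1)%:C%C * Y.
    have iB := intgB iu it.
    have iBZ : intg (fun x => (phi u x - phi t x) / (u - t)).
      rewrite (_ : (fun x => _) = fun x => (u - t)^-1 * (phi u x - phi t x)); first exact: intgZ.
      by apply/funext => x; rewrite mulrC.
    rewrite (fourierB _ iBZ iv) vE (_ : (fun x => (phi u x - phi t x) / (u - t)) = fun x => (u - t)^-1 * (phi u x - phi t x)); last first.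
      by apply/funext => x; rewrite mulrC.
    by rewrite (fourierZ _ _ iB) (fourierB _ iu it) /Y [RHS]mulrBr mulrA -rcM mulVf// mul1r.
  have [k0|k0] := eqVneq k 0.
    have [_ f0 _] := hb u uT; have [_ g0 _] := hb t tT.
    by rewrite k0 f0 g0 /limfld vfield0 mulr0 !subrr nc0 mulr_ge0// ltW.
  have s10 : 0 <= s - 1 by have h := s1_gt; lra.
  have := nc_le_hn (leqnn `|k|%N) k0 s10 (le_trans (Hdot_hn _ hB) hn1).
  by rewrite fY ncM nc_real normfV mulrC ler_pdivrMr ?normr_gt0.
move=> k; split=> e e0; have [d d0 hd] := key k e e0; exists d => // u uT ud.
  apply: le_trans (hd u uT ud); apply: le_trans (Re_le_nc _); rewrite !raddfB/= .
  by apply: eq_ler; congr (`| _ - _|); case: (F _ _) => x y /=; ring.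
apply: le_trans (hd u uT ud); apply: le_trans (Im_le_nc _); rewrite !raddfB/= .
by apply: eq_ler; congr (`| _ - _|); case: (F _ _) => x y /=; ring.
Qed.

Lemma solution_unique T phi0 phi1 phi2 : 0 <= T ->
  is_solution alpha s T phi0 phi1 -> is_solution alpha s T phi0 phi2 ->
  forall t, 0 <= t <= T -> {ae mu, forall x, phi1 t x = phi2 t x}.
Proof.
move=> T0 sol1 sol2; have [K1 h1] := solution_coefficients T0 sol1; have [K2 h2] := solution_coefficients T0 sol2.
pose K := Num.max K1 K2; pose u1 t := fourier (phi1 t); pose u2 t := fourier (phi2 t).
have b1 t : 0 <= t <= T -> hball s K (u1 t).
  by move=> tT; have [_ [x y z] _] := h1 t tT; split=> // M; rewrite le_max z.
have b2 t : 0 <= t <= T -> hball s K (u2 t).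
  by move=> tT; have [_ [x y z] _] := h2 t tT; split=> // M; rewrite le_max z orbT.
pose E M t := \sum_(k <- zs M) nc (u1 t k - u2 t k) ^+ 2.
pose G M t := \sum_(k <- zs M) 2 * complex.Re ((u1 t k - u2 t k)^*%C * (F (u1 t) k - F (u2 t) k)).
have dE M t : 0 <= t <= T -> wderiv T (E M) t (G M t).
  move=> tT; have [_ _ d1] := h1 t tT; have [_ _ d2] := h2 t tT.
  apply: wderiv_sum => k; have [r1 i1] := d1 k; have [r2 i2] := d2 k.
  have dr := wderiv_sqr (wderivB r1 r2); have di := wderiv_sqr (wderivB i1 i2).
  have := wderivD dr di; rewrite (_ : (fun t => _) = fun t => nc (u1 t k - u2 t k) ^+ 2); last first.
    by apply/funext => x; rewrite nc_sqr !raddfB.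
  rewrite (_ : _ + _ = 2 * complex.Re ((u1 t k - u2 t k)^*%C * (F (u1 t) k - F (u2 t) k)))//.
  rewrite /u1 /u2; case: (fourier _ k) (fourier _ k) (F _ k) (F _ k) => x1 y1 [x2 y2] [x3 y3] [x4 y4] /=; ring.
have z0 : 0 <= (0 : R) <= T by rewrite lexx.
have u0 : u1 0 = u2 0.
  have [? [_ _ i1 _]] := sol1; have [? [_ _ i2 _]] := sol2.
  have [[_ j1] _ _] := h1 0 z0; have [[_ j2] _ _] := h2 0 z0.
  apply/funext => k; apply: ae_fourier => //.
  have [A [mA A0 hA]] := aeI i1 i2; exists A; split=> // x /= hx; apply: hA => /= -[e1 e2].
  by apply: hx; rewrite e1 e2.
have E00 M : E M 0 = 0 by rewrite /E u0 big1// => k _; rewrite subrr nc0 expr0n.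
have K0 : 0 <= K by have [_ _ h] := b1 0 z0; exact: le_trans (hn_ge0 s 0 _) (h 0%N).
pose Q := 2 * `|c| * flux_gain p s K; pose P := 8 * `|c| * l1_const p s * K * flux_gain p s K * K.
have g0 : 0 <= flux_gain p s K by exact: flux_gain_ge0.
have Q0 : 0 <= Q by rewrite mulr_ge0// mulr_ge0.
have P0 : 0 <= P by have l0 := l1_const_ge0 p s; do 3! rewrite mulr_ge0//; rewrite mulr_ge0// mulr_ge0.
have EG M t : 0 <= t <= T -> E M t <= P / M.+1%:R * t * expR (Q * t).
  move=> tT; apply: (gronwall (T := T) (g := G M) Q0 _ (E00 M) (dE M) _ tT); first by rewrite divr_ge0.
  move=> x xT; apply: le_trans (energy_rate p12 ps b c M (b1 x xT) (b2 x xT)) _.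
  by apply: eq_ler; rewrite -/Q /P /E; ring.
move=> t tT; have [p1 _ _] := h1 t tT; have [p2 _ _] := h2 t tT.
apply: fourier_inj => // k; apply/eqP; rewrite -subr_eq0; apply/eqP; apply: nc_eq0.
apply/eqP; rewrite -sqrf_eq0 eq_le sqr_ge0 andbT; apply/ler_addgt0Pr => e e0; rewrite add0r.
pose D := P * t * expR (Q * t).
have t0 : 0 <= t by case/andP: tT.
have D0 : 0 <= D by rewrite mulr_ge0 ?expR_ge0// mulr_ge0.
(* M >= |k| puts the frequency k into the truncated energy, and M + 1 > D / e makes the Gronwall
   bound D / (M + 1) at most e. *)
pose M := maxn `|k|%N (Num.truncn (D / e)).
apply: (@le_trans _ _ (E M t)).
  rewrite /E (bigD1_seq k) ?uniq_zs ?mem_zs ?leq_maxl//= lerDl sumr_ge0// => j _; exact: sqr_ge0.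
apply: le_trans (EG M t tT) _.
rewrite (_ : P / M.+1%:R * t * expR (Q * t) = D / M.+1%:R); last by rewrite /D; ring.
rewrite ler_pdivrMr// [leRHS]mulrC -ler_pdivrMr//; apply: le_trans (ltW (truncnS_gt _)) _.
by rewrite ler_nat ltnS leq_maxr.
Qed.

End SolutionCoefficients.

Theorem theorem5p2 (R : realType) (alpha s : R)
    (alpha_gt1 : 1 < alpha) (alpha_le2 : alpha <= 2)
    (s_gt : 7 / 2 - alpha < s) :
  exists T : R -> R,
    (forall r, 0 <= r -> 0 < T r) /\
    forall phi0 : R -> R, Hdot s phi0 ->
      (exists phi, is_solution alpha s (T (Hdot_norm s phi0)) phi0 phi) /\
      (5 / 2 < s ->
       forall phi1 phi2 : R -> R -> R,
         is_solution alpha s (T (Hdot_norm s phi0)) phi0 phi1 ->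
         is_solution alpha s (T (Hdot_norm s phi0)) phi0 phi2 ->
         forall t, t \in `[0, T (Hdot_norm s phi0)] ->
           \forall x \ae (@lebesgue_measure R), phi1 t x = phi2 t x).
Proof.
exists (existence_time alpha s); have T_gt0 := existence_time_gt0 alpha_gt1 alpha_le2 s_gt.
split=> [r _|phi0 h0]; first exact: T_gt0.
split=> [|_ phi1 phi2 sol1 sol2 t]; first exact: solution_exists.
rewrite in_itv/=; exact: (solution_unique alpha_gt1 alpha_le2 s_gt (ltW (T_gt0 _)) sol1 sol2).
Qed.
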